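(* Let $\phi\in\mathfrak{D}$, $\ell\in\{0,1\}$ and $w\in A_\infty$; if $\ell=1$, let $\vec b=(b_1,\dots,b_m)\in BMO^m$. Then the following inequalities hold for every $\vec f=(f_1,\dots,f_m)$ with each $f_i$ bounded with compact support, with constants independent of $\vec f$. (i) If $0<p\le1$ and $\ell=0$, there exists a constant $C_\ell$ such that $$\int_{\mathbb{R}^n}|\mathcal{T}_\phi\vec f(x)|^p\,w(x)\,dx\le C_\ell\int_{\mathbb{R}^n}[\mathcal{M}_{\Phi_p,L}\vec f(x)]^p\,w(x)\,dx.$$ (ii) If $0<p\le1$, $\ell=1$ and $w\in RH(1/p)$, there exists a constant $C_\ell$ such that $$\int_{\mathbb{R}^n}|\mathcal{T}_{\vec b,\phi}\vec f(x)|^p\,w(x)\,dx\le C_\ell\int_{\mathbb{R}^n}[\mathcal{M}_{\Phi_p,L(\log L)}\vec f(x)]^p\,w(x)\,dx.$$ (iii) If $p>1$, there exists a constant $C_\ell$ such that $$\int_{\mathbb{R}^n}|\mathcal{T}_{\vec b^\ell,\phi}\vec f(x)|^p\,w(x)\,dx\le C_\ell\int_{\mathbb{R}^n}[\mathcal{M}_{\Phi_1,L(\log L)^\ell}\vec f(x)]^p\,w(x)\,dx.$$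
   Context: Here $n,m\ge1$ are integers; $Q$ denotes a cube in $\mathbb{R}^n$, $l(Q)$ its sidelength, $|Q|$ its Lebesgue measure. A weight is a nonnegative locally integrable function on $\mathbb{R}^n$; $A_\infty$ is the Muckenhoupt class. For $s>1$, $w\in RH(s)$ means there is $C>0$ with $\left(\frac1{|Q|}\int_Qw^s\right)^{1/s}\le C\,\frac1{|Q|}\int_Qw$ for all cubes $Q$ (for $s=1$ this is trivially satisfied). Condition $\mathfrak{D}$: for $t>0$ let $\mathcal{A}_{(t,\tau,\epsilon)}=\{\vec y=(y_1,\dots,y_m)\in(\mathbb{R}^n)^m:\ \tau(1-\epsilon)t<\sum_{i=1}^m|y_i|\le\tau(1+\epsilon)2t\}$. A nonnegative locally integrable function $\phi$ on $(\mathbb{R}^n)^m$ satisfies $\phi\in\mathfrak{D}$ if there are positive constants $\tau,\epsilon$ (and $C$) with $$\sup_{\vec w\in\mathcal{A}_{(2^k,1,0)}}\phi(\vec w)\le\frac{C}{2^{knm}}\int_{\mathcal{A}_{(2^k,\tau,\epsilon)}}\phi(\vec y)\,d\vec y\quad\text{for every }k\in\mathbb{Z}.$$ With these $\tau,\epsilon$, for $0<\theta\le1$ and $t>0$, $$\Phi_\theta(t)=\Bigl[\sum_{\nu\in\mathbb{Z},\ \nu\ge\log_{1/2}t}\Bigl(\int_{\mathcal{A}_{(2^{-\nu},\tau,\epsilon)}}\phi(\vec y)\,d\vec y\Bigr)^\theta\Bigr]^{1/\theta}.$$ Operators: $\mathcal{T}_\phi\vec f(x)=\int_{(\mathbb{R}^n)^m}\phi(x-y_1,\dots,x-y_m)\prod_{i=1}^m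 f_i(y_i)\,d\vec y$; $\mathcal{T}_{b_j,\phi}\vec f(x)=b_j(x)\mathcal{T}_\phi\vec f(x)-\mathcal{T}_\phi(f_1,\dots,b_jf_j,\dots,f_m)(x)$; $\mathcal{T}_{\vec b,\phi}\vec f=\sum_{j=1}^m\mathcal{T}_{b_j,\phi}\vec f$. The symbol $\mathcal{T}_{\vec b^\ell,\phi}$ means $\mathcal{T}_\phi$ if $\ell=0$ and $\mathcal{T}_{\vec b,\phi}$ if $\ell=1$. $C_\ell$ may depend on $\|\vec b\|_*=\sup_j\|b_j\|_*$ (the BMO norm) if $\ell=1$. Averages and maximal operators: for a Young function $\mathcal{B}$, $\|f\|_{\mathcal{B},Q}=\inf\{\lambda>0:\frac1{|Q|}\int_Q\mathcal{B}(|f|/\lambda)\le1\}$. $L(\log L)^\alpha$, $\alpha\ge0$, corresponds to $t(1+\log^+t)^\alpha$, and $L=L(\log L)^0=L^1$. $\mathcal{M}_{\Phi_\theta,X}\vec f(x)=\sup_{Q\ni x}\Phi_\theta(l(Q))\prod_{i=1}^m\|f_i\|_{X,Q}$. *)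

(* Defs.v *)
From HB Require Import structures.
From mathcomp Require Import all_boot all_order all_algebra.
From mathcomp Require Import all_classical all_reals all_analysis.
From mathcomp Require Import measurable_realfun.

Set Implicit Arguments.
Unset Strict Implicit.
Unset Printing Implicit Defensive.

Import Order.TTheory GRing.Theory Num.Theory.
Import numFieldNormedType.Exports.

Local Open Scope classical_set_scope.
Local Open Scope ring_scope.

Lemma pushforward_sigma_finite d1 d2 (T1 : measurableType d1)
    (T2 : measurableType d2) (R : realType)
    (mu : set T1 -> \bar R) (f : T1 -> T2) (g : T2 -> T1) :
  measurable_fun [set: T2] g -> cancel f g ->
  sigma_finite [set: T1] mu -> sigma_finite [set: T2] (pushforward mu f).
Proof.
move=> mg fK [F FT Foo].
exists (fun k => g @^-1` F k).
  by rewrite -preimage_bigcup -FT preimage_setT.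
move=> k; have [mF muF] := Foo k; split.
  by rewrite -[X in measurable X]setTI; exact: mg.
rewrite /pushforward (_ : f @^-1` _ = F k)//.
by apply/funext => x /=; rewrite /preimage /= fK.
Qed.

Lemma product_measure1_sigma_finite d1 d2 (T1 : measurableType d1)
    (T2 : measurableType d2) (R : realType)
    (mu : {sigma_finite_measure set T1 -> \bar R})
    (nu : {sigma_finite_measure set T2 -> \bar R}) :
  sigma_finite [set: T1 * T2] (mu \x nu)%E.
Proof.
have /sigma_finiteP[F [TF ndF Foo]] := sigma_finiteT mu.
have /sigma_finiteP[G [TG ndG Goo]] := sigma_finiteT nu.
exists (fun k => F k `*` G k).
  rewrite -setXTT TF TG predeqE => -[x y]; split.
    move=> [/= [k _ Fkx] [l _ Gly]]; exists (maxn k l) => //; split.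
    - by move: x Fkx; exact/subsetPset/ndF/leq_maxl.
    - by move: y Gly; exact/subsetPset/ndG/leq_maxr.
  by move=> [k _ []/= ? ?]; split; exists k.
move=> k; have [? ?] := Foo k; have [? ?] := Goo k.
split; first exact: measurableX.
by rewrite product_measure1E// lte_mul_pinfty// ge0_fin_numE.
Qed.

Section tuple_cons_measure.
Context d (T : measurableType d) (R : realType) (n : nat).
Variables (mu : {sigma_finite_measure set T -> \bar R})
  (nu : {sigma_finite_measure set (n.-tuple T) -> \bar R}).

Definition tuple_cons (z : T * n.-tuple T) : n.+1.-tuple T :=
  [the n.+1.-tuple T of z.1 :: z.2].

Definition tuple_uncons (t : n.+1.-tuple T) : T * n.-tuple T :=
  (thead t, [tuple of behead t]).

Lemma tuple_consK : cancel tuple_cons tuple_uncons.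
Proof.
by case=> x t; congr pair; apply: val_inj.
Qed.

Lemma measurable_tuple_cons : measurable_fun [set: T * n.-tuple T] tuple_cons.
Proof. exact: measurable_cons. Qed.

Lemma measurable_tuple_uncons : measurable_fun [set: n.+1.-tuple T] tuple_uncons.
Proof.
apply/measurable_fun_pair.
  exact: measurable_tnth.
exact: measurable_behead.
Qed.

Definition tuple_cons_measure : set (n.+1.-tuple T) -> \bar R :=
  pushforward (mu \x nu)%E tuple_cons.

Let mcons := measurable_tuple_cons.

Let cons0 : tuple_cons_measure set0 = 0%E.
Proof. by rewrite /tuple_cons_measure measure0. Qed.

Let cons_ge0 A : (0 <= tuple_cons_measure A)%E.
Proof. exact: measure_ge0. Qed.

Let cons_sigma_additive : semi_sigma_additive tuple_cons_measure.
Proof. exact: measure_semi_sigma_additive. Qed.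

HB.instance Definition _ := isMeasure.Build _ _ _ tuple_cons_measure
  cons0 cons_ge0 cons_sigma_additive.

Let cons_sigma_finite : sigma_finite [set: n.+1.-tuple T] tuple_cons_measure.
Proof.
apply: pushforward_sigma_finite measurable_tuple_uncons tuple_consK _.
exact: product_measure1_sigma_finite.
Qed.

HB.instance Definition _ := Measure_isSigmaFinite.Build _ _ _
  tuple_cons_measure cons_sigma_finite.

End tuple_cons_measure.

Fixpoint product_power d (T : measurableType d) (R : realType)
    (mu : {sigma_finite_measure set T -> \bar R}) (n : nat) :
    {sigma_finite_measure set (n.-tuple T) -> \bar R} :=
  match n with
  | 0 => \d_([tuple] : 0.-tuple T)
  | k.+1 => tuple_cons_measure mu (product_power mu k)
  end.

Definition measure_matrix_display : measure_display.
Proof. exact: default_measure_display. Qed.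

(* Borel sigma-algebra of 'M[R]_(m, n), generated by the coordinate maps *)
Section matrix_measurable.
Context (R : realType) (m n : nat).

Definition matrix_cylinder : set (set 'M[R]_(m, n)) :=
  [set A | exists (i : 'I_m) (j : 'I_n) (B : set (measurableTypeR R)),
     measurable B /\ A = [set M : 'M[R]_(m, n) | B (M i j)]].

HB.instance Definition _ := @isMeasurable.Build measure_matrix_display
  'M[R]_(m, n) <<s matrix_cylinder >>
  (@sigma_algebra0 _ setT matrix_cylinder) (@sigma_algebraC _ _)
  (@sigma_algebra_bigcup _ setT _).

Lemma measurable_coord (i : 'I_m) (j : 'I_n) :
  measurable_fun [set: 'M[R]_(m, n)]
    (fun M : 'M[R]_(m, n) => M i j : measurableTypeR R).
Proof.
move=> _ B mB; rewrite setTI; apply: sub_sigma_algebra.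
by exists i, j, B.
Qed.

Lemma measurable_fun_matrix d (T : measurableType d) (f : T -> 'M[R]_(m, n)) :
  (forall i j, measurable_fun [set: T] (fun x => f x i j : measurableTypeR R)) ->
  measurable_fun [set: T] f.
Proof.
move=> mf; apply: (@measurability _ _ _ _ _ _ matrix_cylinder) => //.
move=> _ [_ [i [j [B [mB ->]]]] <-].
exact: mf.
Qed.

End matrix_measurable.

Section lebesgue_rV.
Context (R : realType) (n : nat).

Definition row_of_tuple (t : n.-tuple (measurableTypeR R)) : 'rV[R]_n :=
  \row_j tnth t j.

Definition tuple_of_row (x : 'rV[R]_n) : n.-tuple (measurableTypeR R) :=
  [tuple x 0 j | j < n].

Lemma row_of_tupleK : cancel row_of_tuple tuple_of_row.
Proof. by move=> t; apply: eq_from_tnth => j; rewrite tnth_mktuple mxE. Qed.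

Lemma measurable_row_of_tuple : measurable_fun setT row_of_tuple.
Proof.
apply: measurable_fun_matrix => i j; rewrite (_ : (fun _ => _) = @tnth _ _ ^~ j).
  exact: measurable_tnth.
by apply/funext => t; rewrite mxE.
Qed.

Lemma measurable_tuple_of_row : measurable_fun setT tuple_of_row.
Proof.
apply/measurable_fun_tnthP => j.
rewrite (_ : _ \o _ = fun x : 'rV[R]_n => x 0 j : measurableTypeR R).
  exact: measurable_coord.
by apply/funext => x /=; rewrite tnth_mktuple.
Qed.

Definition lebesgue_rV : set 'rV[R]_n -> \bar R :=
  pushforward (product_power (@lebesgue_measure R) n) row_of_tuple.

Let mrow := measurable_row_of_tuple.

Let rV0 : lebesgue_rV set0 = 0%E.
Proof. by rewrite /lebesgue_rV measure0. Qed.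

Let rV_ge0 A : (0 <= lebesgue_rV A)%E.
Proof. exact: measure_ge0. Qed.

Let rV_sigma_additive : semi_sigma_additive lebesgue_rV.
Proof. exact: measure_semi_sigma_additive. Qed.

HB.instance Definition _ := isMeasure.Build _ _ _ lebesgue_rV
  rV0 rV_ge0 rV_sigma_additive.

Let rV_sigma_finite : sigma_finite [set: 'rV[R]_n] lebesgue_rV.
Proof.
apply: pushforward_sigma_finite measurable_tuple_of_row row_of_tupleK _.
exact: sigma_finiteT.
Qed.

HB.instance Definition _ := Measure_isSigmaFinite.Build _ _ _
  lebesgue_rV rV_sigma_finite.

End lebesgue_rV.
Arguments lebesgue_rV : clear implicits.

(* 'M[R]_(m, n) stands for (R^n)^m, the i-th component of y being row i y *)
Section lebesgue_mx.
Context (R : realType) (m n : nat).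

Definition matrix_of_tuple (t : m.-tuple 'rV[R]_n) : 'M[R]_(m, n) :=
  \matrix_i tnth t i.

Definition tuple_of_matrix (y : 'M[R]_(m, n)) : m.-tuple 'rV[R]_n :=
  [tuple row i y | i < m].

Lemma matrix_of_tupleK : cancel matrix_of_tuple tuple_of_matrix.
Proof. by move=> t; apply: eq_from_tnth => j; rewrite tnth_mktuple rowK. Qed.

Lemma measurable_matrix_of_tuple : measurable_fun setT matrix_of_tuple.
Proof.
apply: measurable_fun_matrix => i j.
rewrite (_ : (fun _ => _) = (fun x : 'rV[R]_n => x 0 j : measurableTypeR R) \o
   @tnth _ _ ^~ i).
  by apply: measurableT_comp; [exact: measurable_coord|exact: measurable_tnth].
by apply/funext => t; rewrite mxE.
Qed.

Lemma measurable_tuple_of_matrix : measurable_fun setT tuple_of_matrix.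
Proof.
apply/measurable_fun_tnthP => i; apply: measurable_fun_matrix => k j.
rewrite (_ : (fun _ => _) = fun x : 'M[R]_(m, n) => x i j : measurableTypeR R).
  exact: measurable_coord.
by apply/funext => x /=; rewrite tnth_mktuple mxE.
Qed.

Definition lebesgue_mx : set 'M[R]_(m, n) -> \bar R :=
  pushforward (product_power (lebesgue_rV R n) m) matrix_of_tuple.

Let mmx := measurable_matrix_of_tuple.

Let mx0 : lebesgue_mx set0 = 0%E.
Proof. by rewrite /lebesgue_mx measure0. Qed.

Let mx_ge0 A : (0 <= lebesgue_mx A)%E.
Proof. exact: measure_ge0. Qed.

Let mx_sigma_additive : semi_sigma_additive lebesgue_mx.
Proof. exact: measure_semi_sigma_additive. Qed.

HB.instance Definition _ := isMeasure.Build _ _ _ lebesgue_mx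
  mx0 mx_ge0 mx_sigma_additive.

Let mx_sigma_finite : sigma_finite [set: 'M[R]_(m, n)] lebesgue_mx.
Proof.
apply: pushforward_sigma_finite measurable_tuple_of_matrix matrix_of_tupleK _.
exact: sigma_finiteT.
Qed.

HB.instance Definition _ := Measure_isSigmaFinite.Build _ _ _
  lebesgue_mx mx_sigma_finite.

End lebesgue_mx.
Arguments lebesgue_mx : clear implicits.

Section lebesgue_functions.
Context (R : realType) (m n : nat).
Variable mu : set 'M[R]_(m, n) -> \bar R.

(* Lebesgue (not only Borel) measurability: preimages of Borel sets lie in the
   completion of the Borel sigma-algebra.  On such nonnegative functions, the
   integral of the library, a supremum over Borel simple functions below,
   is the Lebesgue integral. *)
Definition lebesgue_measurable (f : 'M[R]_(m, n) -> R) :=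
  forall Y : set R, measurable Y -> completed_algebra_gen mu (f @^-1` Y).

Definition locally_integrable_mx (f : 'M[R]_(m, n) -> R) :=
  lebesgue_measurable f /\
  forall K, compact K -> (\int[mu]_(x in K) `|(f x)%:E| < +oo)%E.

End lebesgue_functions.

Section cubes.
Context (R : realType) (n : nat).
Implicit Types (a x : 'rV[R]_n) (l : R) (Q : set 'rV[R]_n).

Local Notation mu := (lebesgue_rV R n).

Definition cube a l : set 'rV[R]_n :=
  [set x : 'rV[R]_n | forall i, a 0 i <= x 0 i <= a 0 i + l].

Definition mean Q (f : 'rV[R]_n -> \bar R) : \bar R :=
  ((mu Q)^-1 * \int[mu]_(x in Q) f x)%E.

Definition weight (w : 'rV[R]_n -> R) :=
  (forall x, 0 <= w x) /\ locally_integrable_mx mu w.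

(* the inverse in \bar R of w x = 0 is +oo, so that w^(1 - p') is +oo on the
   zeros of w; the inverse in R (or a negative powR) would give 0 there *)
Definition muckenhoupt (p : R) (w : 'rV[R]_n -> R) :=
  weight w /\
  exists C : R, forall a l, 0 < l ->
    (mean (cube a l) (EFin \o w) *
     mean (cube a l) (fun x => ((w x)%:E^-1) `^ (p - 1)^-1) `^ (p - 1)
       <= C%:E)%E.

Definition muckenhoupt_infty (w : 'rV[R]_n -> R) :=
  exists2 p : R, 1 < p & muckenhoupt p w.

Definition reverse_holder (s : R) (w : 'rV[R]_n -> R) :=
  exists2 C : R, 0 < C & forall a l, 0 < l ->
    ((mean (cube a l) (fun x => (w x `^ s)%:E)) `^ s^-1
       <= C%:E * mean (cube a l) (EFin \o w))%E.

Definition bmo_norm (b : 'rV[R]_n -> R) : \bar R :=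
  ereal_sup [set z | exists a l, 0 < l /\
    z = mean (cube a l)
          (fun x => `|(b x)%:E - mean (cube a l) (EFin \o b)|)%E].

Definition bmo (b : 'rV[R]_n -> R) :=
  locally_integrable_mx mu b /\ (bmo_norm b < +oo)%E.

(* Luxemburg norm of f over Q for the Young function B *)
Definition luxemburg (B : R -> R) (f : 'rV[R]_n -> R) Q : \bar R :=
  ereal_inf [set lam%:E | lam in [set lam : R | 0 < lam /\
    (mean Q (fun x => (B (`|f x| / lam))%:E) <= 1)%E]].

(* t (1 + log^+ t)^alpha; log^+ t is 0 for t <= 1, in particular at t = 0 *)
Definition LlogL (alpha t : R) : R :=
  t * (1 + Num.max 0 (ln t)) `^ alpha.

Definition bounded_compactly_supported (f : 'rV[R]_n -> R) :=
  [/\ lebesgue_measurable mu f,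
      exists M : R, forall x, `|f x| <= M &
      compact (closure [set x | f x != 0])].

End cubes.

Section operators.
Context (R : realType) (m n : nat).
Implicit Types (f b : 'I_m -> 'rV[R]_n -> R) (x : 'rV[R]_n).
Implicit Types y : 'M[R]_(m, n).

Local Notation mum := (lebesgue_mx R m n).

Definition euclidean_norm x : R := Num.sqrt (\sum_i x 0 i ^+ 2).

Definition annulus (t tau eps : R) : set 'M[R]_(m, n) :=
  [set y : 'M[R]_(m, n) | tau * (1 - eps) * t < \sum_i euclidean_norm (row i y)
             <= tau * (1 + eps) * (2 * t)].

Variable phi : 'M[R]_(m, n) -> R.

Definition condition_D (tau eps : R) :=
  [/\ forall y, 0 <= phi y,
      locally_integrable_mx mum phi,
      0 < tau,
      0 < eps &
      exists2 C : R, 0 < C & forall k : int,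
        (ereal_sup [set (phi y)%:E | y in annulus (2 ^ k) 1 0] <=
         (C / 2 ^ (k * n%:Z * m%:Z))%:E *
         \int[mum]_(y in annulus (2 ^ k) tau eps) (phi y)%:E)%E].

Definition Phi (tau eps theta t : R) : \bar R :=
  ((\esum_(nu in [set nu : int | (ln t / ln 2^-1 <= nu%:~R)%R])
     (\int[mum]_(y in annulus (2 ^ (- nu)) tau eps) (phi y)%:E) `^ theta)
   `^ theta^-1)%E.

Definition potential f x : \bar R :=
  (\int[mum]_y (phi (\matrix_i (x - row i y)) * \prod_i f i (row i y))%:E)%E.

Definition commutator_at (j : 'I_m) b f x : \bar R :=
  ((b j x)%:E * potential f x -
   potential (fun i => if i == j then (b j \* f j)%R else f i) x)%E.

Definition commutator b f x : \bar R := (\sum_j commutator_at j b f x)%E.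

Definition bmo_vector_norm b : \bar R :=
  ereal_sup (range (fun j => bmo_norm (b j))).

(* M_{Phi_theta, L (log L)^alpha} *)
Definition maximal (tau eps theta alpha : R) f x : \bar R :=
  ereal_sup [set z | exists a l, [/\ 0 < l, cube a l x &
    z = (Phi tau eps theta l *
         \prod_i luxemburg (LlogL alpha) (f i) (cube a l))%E]].

End operators.

(* Main.v *)
From HB Require Import structures.
Require Import Defs.
From mathcomp Require Import all_boot all_order all_algebra.
From mathcomp Require Import all_classical all_reals all_analysis.
From mathcomp Require Import measurable_realfun.
From mathcomp Require Import ring lra zify.
Import Order.TTheory GRing.Theory Num.Theory.
Import numFieldNormedType.Exports.

Set Implicit Arguments.
Unset Strict Implicit.
Unset Printing Implicit Defensive.

Local Open Scope classical_set_scope.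
Local Open Scope ring_scope.

(** Write nu for the measure w dx. The weighted inequalities are reduced to one
    discrete inequality on dyadic grids, which is proved for nu by a stopping time
    argument.

    Discretization. On the shell of radius 2^j the kernel is at most a constant times
    2^(-jnm) times its mass on the fattened shell, and a ball of radius comparable to
    2^j lies in a cube of comparable size of one of the 2^n shifted dyadic grids. Hence
    (potential_le_cubes) the operator is at most a constant times the sum over the
    grids and over the scales j of a_j G_j(x), where a_j is the mass of the fattened shell and G_j(x) is
    the product of the averages of the |f_i| over the cube of scale j that contains x.
    For a commutator (commutator_at_le) there is one more factor b(x) - b(y), which is
    split at the average of b over the cube. The part at y is integrated against f by
    the duality of L log L and exp L (exp_LlogL_duality), the exponential moment coming
    from the John-Nirenberg inequality (john_nirenberg); this is why the L log L norm
    replaces the average. The part at x stays outside as a multiplier beta_j(x), all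
    powers of which have controlled means over cubes.

    The maximal operator dominates c_k G_k for every k, where c_k is the sum of the
    masses at the scales up to k (for p at most one, of their p-th powers, to the
    power 1/p): that is the definition of Phi. So the sums of a_j G_j beta_j have to be
    compared with the maxima of c_k G_k in L^p(nu), for each grid.

    The comparison (sparse_bound). Starting from a cell, descend until G exceeds A
    times its value on the cell; the cells reached are the next principal cells, and
    so on. Between two consecutive principal cells G is at most A times its value on
    the upper one, so the sum at x is controlled by a sum over the chain of principal
    cells that contain x. The principal cells next below a given one occupy at most a
    fraction theta < 1 of its nu measure (lux_prod_jump_small). Therefore the number of
    stops has exponential moments (stop_count_exp_integrable); the p-th power of the
    sum over the chain can be replaced by the sum of the p-th powers with
    geometric weights; and each term can be charged to the part of its principal cell
    that the next ones leave free, where the maximum is at least c_k G_k.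

    The fraction theta. For Lebesgue measure the weak type inequality (stopped_weak_type)
    makes it as small as wanted when A is large. It is transferred to nu by the
    property of Muckenhoupt weights that one half of a cube carries at most a fixed
    proportion of its weight (muckenhoupt_half), a direct consequence of the A_p
    condition. The same property and the same stopping times give the John-Nirenberg
    inequality for nu, from which the moments of beta follow (multiplier_osc).

    For p > 1 the comparison is applied to the functions themselves; for p at most one
    it is applied with exponent 1 to their p-th powers, which are subadditive. Both
    cases are contained in p = e r with e at most 1 and r at least 1
    (maximal_domination).

    The functions of the statement are Lebesgue measurable only. They are replaced by
    Borel functions off null sets (borel_representative), and the integrals are
    compared without measurability (le_integral_off_null). *)

(** * Inequalities for real powers *)

Section real_powers.
Context (R : realType).
Implicit Types (x y r p c : R).

Lemma ler_powR_base r x y : 0 <= r -> 0 <= x -> x <= y -> x `^ r <= y `^ r.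
Proof.
move=> r0 x0 xy; apply: ge0_ler_powR => //; rewrite nnegrE//.
exact: le_trans xy.
Qed.

Lemma ler_powR_cancel r x y : 0 < r -> 0 <= y -> x `^ r <= y `^ r -> x <= y.
Proof.
move=> r0 y0 h; rewrite leNgt; apply/negP => yx.
have : y `^ r < x `^ r by apply: gt0_ltr_powR; rewrite ?nnegrE// (le_trans y0)// ltW.
by rewrite ltNge h.
Qed.

Lemma powR_tangent r s t : 1 < r -> 0 <= s -> 0 <= t ->
  s `^ r + r * s `^ (r - 1) * (t - s) <= t `^ r.
Proof.
move=> r1 s0 t0.
have r0 : 0 < r by exact: lt_trans r1.
have rB : r - 1 != 0 by rewrite subr_eq0 gt_eqF.
have rN : r != 0 by rewrite gt_eqF.
have := @conjugate_powR R t (s `^ (r - 1)) r (r / (r - 1)) t0 (powR_ge0 _ _) r0.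
rewrite -powRrM.
have -> : (r - 1) * (r / (r - 1)) = r by field.
move=> H; have {H} := H _ _.
rewrite divr_gt0 ?subr_gt0// invf_div (_ : r^-1 + (r - 1) / r = 1); last by field.
move=> /(_ erefl erefl).
rewrite -(ler_pM2l r0) => h.
have E : s `^ (r - 1) * s = s `^ r.
  have [->|sN0] := eqVneq s 0; first by rewrite mulr0 powR0.
  by rewrite -{2}(powRr1 s0) -powRD ?sN0 ?implybT// subrK.
have e1 : r * (t `^ r / r + s `^ r * ((r - 1) / r)) = t `^ r + (r - 1) * s `^ r.
  by field.
rewrite e1 in h.
have : r * s `^ (r - 1) * (t - s) = r * (t * s `^ (r - 1)) - r * s `^ r.
  by rewrite -E; ring.
move=> ->; lra.
Qed.

(** Jensen's inequality, from the tangent of the power function at the mean. *)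
Lemma powR_sum_jensen (I : Type) (s : seq I) (a b : I -> R) r : 1 < r ->
  (forall i, 0 <= a i) -> (forall i, 0 <= b i) ->
  (\sum_(i <- s) a i * b i) `^ r <=
  (\sum_(i <- s) a i) `^ (r - 1) * \sum_(i <- s) a i * b i `^ r.
Proof.
move=> r1 a0 b0.
have r0 : 0 < r by exact: lt_trans r1.
set A := \sum_(i <- s) a i; set B := \sum_(i <- s) a i * b i.
have A0 : 0 <= A by exact: sumr_ge0.
have B0 : 0 <= B by apply: sumr_ge0 => i _; rewrite mulr_ge0.
have S0 : 0 <= \sum_(i <- s) a i * b i `^ r.
  by apply: sumr_ge0 => i _; rewrite mulr_ge0// powR_ge0.
have [Az|AN0] := eqVneq A 0.
  have -> : B = 0.
    move: Az; rewrite /A /B; elim: s {A B A0 B0 S0} => [|i s IH]; first by rewrite !big_nil.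
    rewrite !big_cons => /eqP; rewrite paddr_eq0 ?sumr_ge0// => /andP[/eqP-> /eqP s0].
    by rewrite mul0r add0r IH.
  by rewrite powR0 ?gt_eqF// mulr_ge0// powR_ge0.
have Ap : 0 < A by rewrite lt_def AN0.
pose m := B / A.
have m0 : 0 <= m by exact: divr_ge0.
have h : A * m `^ r <= \sum_(i <- s) a i * b i `^ r.
  have e : A * m `^ r = \sum_(i <- s) a i *
      (m `^ r + r * m `^ (r - 1) * (b i - m)).
    under eq_bigr do rewrite mulrDr mulrCA mulrBr.
    rewrite big_split/= -mulr_suml -/A -mulr_sumr big_split/= -/B sumrN.
    by rewrite -mulr_suml -/A /m mulrCA divff// mulr1 subrr mulr0 addr0.
  rewrite e; apply: ler_sum => i _.
  by rewrite ler_wpM2l//; exact: powR_tangent.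
have := ler_wpM2l (powR_ge0 A (r - 1)) h.
apply: le_trans; rewrite mulrA.
rewrite (_ : A `^ (r - 1) * A = A `^ r); last first.
  by rewrite -{2}(powRr1 A0) -powRD ?AN0 ?implybT// subrK.
by rewrite -powRM// /m mulrCA divff// mulr1.
Qed.

Lemma powR_subadd p x y : 0 < p <= 1 -> 0 <= x -> 0 <= y ->
  (x + y) `^ p <= x `^ p + y `^ p.
Proof.
move=> /andP[p0 p1] x0 y0.
have [xy0|xyN0] := eqVneq (x + y) 0.
  by rewrite xy0 powR0 ?gt_eqF// addr_ge0// powR_ge0.
have xyp : 0 < x + y by rewrite lt_def xyN0 addr_ge0.
have H u : 0 <= u -> u <= x + y -> u / (x + y) * (x + y) `^ p <= u `^ p.
  move=> u0 uxy.
  have [->|uN0] := eqVneq u 0; first by rewrite !mul0r powR_ge0.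
  have up : 0 < u by rewrite lt_def uN0.
  have u1 : 0 < u / (x + y) <= 1 by rewrite divr_gt0//= ler_pdivrMr// mul1r.
  have -> : u `^ p = (u / (x + y)) `^ p * (x + y) `^ p.
    by rewrite -powRM ?divfK// ?divr_ge0// ltW.
  rewrite ler_wpM2r ?powR_ge0//.
  rewrite -{1}(@powRr1 _ (u / (x + y))) ?divr_ge0 ?(ltW xyp)//.
  exact: ger_powR.
have hx := H x x0; rewrite lerDl in hx; have hy := H y y0; rewrite lerDr in hy.
have := lerD (hx y0) (hy x0).
by rewrite -mulrDl -mulrDl divff// mul1r.
Qed.

Lemma powR_sum_subadd (I : Type) (s : seq I) (F : I -> R) p : 0 < p <= 1 ->
  (forall i, 0 <= F i) ->
  (\sum_(i <- s) F i) `^ p <= \sum_(i <- s) F i `^ p.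
Proof.
move=> p01 F0; elim: s => [|i s IH].
  by rewrite !big_nil powR0// gt_eqF//; case/andP: p01.
rewrite !big_cons (le_trans (powR_subadd p01 _ _))// ?sumr_ge0//.
by rewrite lerD2l.
Qed.

Lemma powR_sum_le (I : finType) (F : I -> R) p : 0 < p ->
  (forall i, 0 <= F i) ->
  (\sum_i F i) `^ p <= #|I|%:R `^ p * \sum_i F i `^ p.
Proof.
move=> p0 F0.
set S := \sum_i F i `^ p.
have S0 : 0 <= S by apply: sumr_ge0 => i _; exact: powR_ge0.
have FS i : F i <= S `^ p^-1.
  apply: (@ler_powR_cancel p) => //; first exact: powR_ge0.
  rewrite -powRrM mulVf ?gt_eqF// powRr1//.
  by rewrite /S (bigD1 i)//= lerDl sumr_ge0// => j _; exact: powR_ge0.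
have h : \sum_i F i <= #|I|%:R * S `^ p^-1.
  rewrite mulr_natl -sumr_const; apply: ler_sum => i _; exact: FS.
apply: (le_trans (ler_powR_base (ltW p0) _ h)); first exact: sumr_ge0.
by rewrite powRM ?powR_ge0// -powRrM mulVf ?gt_eqF// powRr1.
Qed.

End real_powers.

(** * Integrals of functions that need not be Borel measurable *)

Section raw_integral.
Context d (T : measurableType d) (R : realType).
Variable mu : {measure set T -> \bar R}.
Implicit Types (D N : set T) (f g : T -> \bar R).
Local Open Scope ereal_scope.

Import HBNNSimple.

Lemma null_bigcup (F : (set T)^nat) : (forall i, measurable (F i)) ->
  (forall i, mu (F i) = 0) -> mu (\bigcup_i F i) = 0.
Proof.
move=> mF F0; apply: measure_negligible; first exact: bigcupT_measurable.
by apply: negligible_bigcup => i; exists (F i); split; [exact: mF|exact: F0|].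
Qed.

(** The integral of a nonnegative function is a supremum over Borel simple
    functions below it, and cutting such a simple function off on a null set
    does not change its integral. *)
Lemma le_integral_off_null D N f g : measurable N -> mu N = 0 ->
  (forall x, D x -> 0 <= f x) -> (forall x, D x -> 0 <= g x) ->
  (forall x, D x -> ~ N x -> f x <= g x) ->
  \int[mu]_(x in D) f x <= \int[mu]_(x in D) g x.
Proof.
move=> mN N0 f0 g0 fg; rewrite !ge0_integralE//.
apply: ge_ereal_sup => _ [h /= hf <-].
have mNC : measurable (~` N) by exact: measurableC.
apply: le_ereal_sup_tmp; exists (sintegral mu (proj_nnsfun h mNC)).
  exists (proj_nnsfun h mNC) => // x; rewrite /= mindicE.
  have [Dx|Dx] := pselect (D x); last first.
    have := hf x; rewrite !patchE memNset// !lee_fin => hx0.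
    suff -> : h x = 0%R by rewrite mul0r.
    by apply/eqP; rewrite eq_le hx0/=; exact: fun_ge0.
  rewrite patchE (mem_set Dx).
  case: (boolP (x \in ~` N)) => [|_]; last first.
    by rewrite mulr0 g0.
  rewrite inE mulr1 => nN.
  by apply: le_trans (fg _ Dx nN); have := hf x; rewrite patchE mem_set.
rewrite -!integralT_nnsfun.
rewrite (@ge0_ae_eq_integral _ _ _ mu setT (EFin \o h)
  (EFin \o proj_nnsfun h mNC))//.
- exact/measurable_EFinP.
- exact/measurable_EFinP.
- by move=> x _; rewrite lee_fin; exact: fun_ge0.
- by move=> x _; rewrite lee_fin; exact: fun_ge0.
- exists N; split => // x /= /not_implyP[_].
  apply: contra_notP => nN; rewrite mindicE mem_set ?mulr1//.
Qed.

Lemma le_integral_raw D f g : (forall x, D x -> 0 <= f x) ->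
  (forall x, D x -> f x <= g x) ->
  \int[mu]_(x in D) f x <= \int[mu]_(x in D) g x.
Proof.
move=> f0 fg; apply: (@le_integral_off_null _ set0) => //.
- by move=> x Dx; exact: le_trans (f0 _ Dx) (fg _ Dx).
- by move=> x Dx _; exact: fg.
Qed.

Lemma eq_integral_off_null_ge0 D N f g : measurable N -> mu N = 0 ->
  (forall x, D x -> 0 <= f x) -> (forall x, D x -> 0 <= g x) ->
  (forall x, D x -> ~ N x -> f x = g x) ->
  \int[mu]_(x in D) f x = \int[mu]_(x in D) g x.
Proof.
move=> mN N0 f0 g0 fg; apply/eqP; rewrite eq_le; apply/andP; split.
  by apply: (le_integral_off_null mN) => // x Dx nN; rewrite fg.
by apply: (le_integral_off_null mN) => // x Dx nN; rewrite fg.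
Qed.

Lemma eq_integral_off_null D N f g : measurable N -> mu N = 0 ->
  (forall x, D x -> ~ N x -> f x = g x) ->
  \int[mu]_(x in D) f x = \int[mu]_(x in D) g x.
Proof.
move=> mN N0 fg; rewrite integralE [RHS]integralE; congr (_ - _).
  by apply: (eq_integral_off_null_ge0 mN) => // x Dx nN; rewrite !funeposE fg.
by apply: (eq_integral_off_null_ge0 mN) => // x Dx nN; rewrite !funenegE fg.
Qed.

Lemma eq_integral_null_domain D E f : D `<=` E -> measurable (E `\` D) ->
  mu (E `\` D) = 0 -> \int[mu]_(x in D) f x = \int[mu]_(x in E) f x.
Proof.
move=> DE mED ED0; rewrite integral_mkcond [RHS]integral_mkcond.
apply: (eq_integral_off_null mED) => // x _ nED; rewrite !patchE.
have [Dx|nDx] := pselect (D x).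
  by rewrite !mem_set//; exact: DE.
rewrite memNset// memNset// => Ex; apply: nED; split => //.
Qed.

Lemma abse_integral_le_raw D f :
  `| \int[mu]_(x in D) f x | <= \int[mu]_(x in D) `|f x|.
Proof.
rewrite integralE.
have h1 : \int[mu]_(x in D) f ^\+ x <= \int[mu]_(x in D) `|f x|.
  apply: le_integral_raw => [x _|x _]; first exact: funepos_ge0.
  by rewrite funeposE ge_max abse_ge0 lee_abs.
have h2 : \int[mu]_(x in D) f ^\- x <= \int[mu]_(x in D) `|f x|.
  apply: le_integral_raw => [x _|x _]; first exact: funeneg_ge0.
  by rewrite funenegE ge_max abse_ge0 andbT -abseN lee_abs.
have p1 : 0 <= \int[mu]_(x in D) f ^\+ x by apply: integral_ge0.
have p2 : 0 <= \int[mu]_(x in D) f ^\- x by apply: integral_ge0.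
move: h1 h2 p1 p2; set a := integral _ _ _; set b := integral _ _ _.
set c := integral _ _ _.
move: a b c => [a| |] [b| |] [c| |] //=; rewrite ?lee_fin ?leey// => ac bc a0 b0.
by rewrite ler_norml; apply/andP; split; lra.
Qed.

(** A function whose preimages of Borel sets lie in the completion agrees off a
    Borel null set with a Borel function: the null sets of the countably many
    superlevel sets at rational heights can be removed simultaneously. *)
Lemma borel_representative (f : T -> R) :
  (forall Y : set R, measurable Y -> completed_algebra_gen mu (f @^-1` Y)) ->
  exists2 g : T -> R, measurable_fun setT g &
  exists N, [/\ measurable N, mu N = 0, forall x, ~ N x -> f x = g x &
             forall x, N x -> g x = 0%R].
Proof.
move=> mf.
have H q : exists AN : set T * set T, [/\ measurable AN.1, measurable AN.2,
    mu AN.2 = 0 & forall x, ~ AN.2 x -> (AN.1 x <-> (q < f x)%R)].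
  have [A mA [N [M [mM M0 NM]] ANE]] := mf `]q, +oo[%classic (measurable_itv _).
  exists (A, M); split => // x /= nM.
  have -> : (q < f x)%R = (x \in f @^-1` `]q, +oo[%classic).
    by apply/idP/idP; rewrite inE/= in_itv/= andbT.
  rewrite -ANE inE; split; first by left.
  by case=> // /NM.
have /choice[AN ANP] := H.
pose r (i : nat) : R := ratr (odflt 0%R (choice.unpickle i : option rat)).
have rE (q : rat) : exists i, r i = ratr q.
  by exists (choice.pickle q); rewrite /r choice.pickleK.
pose N := \bigcup_i (AN (r i)).2.
have mN : measurable N by apply: bigcupT_measurable => i; have [] := ANP (r i).
have N0 : mu N = 0.
  by apply: null_bigcup => i; have [] := ANP (r i).
exists (fun x => if x \in N then 0%R else f x); last first.
  exists N; split => // x Nx; last by rewrite mem_set.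
  by rewrite memNset.
apply: (measurability _ (RGenOInfty.measurableE R)) => _ [_ [c ->]] <-.
rewrite setTI.
suff -> : (fun x => if x \in N then 0%R else f x) @^-1` `]c, +oo[ =
    (if (c < 0)%R then N else set0) `|`
    \bigcup_(i in [set i | (c < r i)%R]) ((AN (r i)).1 `\` N).
  apply: measurableU; first by case: ifP.
  apply: bigcup_measurable => i _; apply: measurableD => //.
  by have [] := ANP (r i).
apply/seteqP; split => x; rewrite /= in_itv/= andbT.
  case: ifPn => [|]; rewrite ?inE ?notin_setE => Nx.
    by move=> c0; left; rewrite c0.
  move=> cf; right; have [q /itvP qcf] := rat_in_itvoo cf.
  have [i ri] := rE q; exists i; first by rewrite /= ri qcf.
  split => //; have [_ _ _ /(_ x) []] := ANP (r i).
    by apply: contra_not Nx; exists i.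
  by move=> _; apply; rewrite ri qcf.
case=> [|[i /= ci [Ax Nx]]].
  by case: ifP => // c0 Nx; rewrite mem_set.
rewrite memNset//; apply: lt_trans ci _.
have [_ _ _ /(_ x) []] := ANP (r i); last by move=> /(_ Ax).
by apply: contra_not Nx; exists i.
Qed.

End raw_integral.

Section density.
Context d (T : measurableType d) (R : realType).
Variable mu : {measure set T -> \bar R}.
Variable w : T -> R.
Hypothesis w0 : forall x, 0 <= w x.
Hypothesis mw : measurable_fun setT w.
Local Open Scope ereal_scope.

Definition density (A : set T) : \bar R := \int[mu]_(x in A) (w x)%:E.

Let mwE : measurable_fun setT (EFin \o w).
Proof. exact/measurable_EFinP. Qed.

Let density0 : density set0 = 0.
Proof. by rewrite /density integral_set0. Qed.

Let density_ge0 A : 0 <= density A.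
Proof. by apply: integral_ge0 => x _; rewrite lee_fin. Qed.

Let density_sigma_additive : semi_sigma_additive density.
Proof.
move=> F mF tF mUF; rewrite /density.
rewrite ge0_integral_bigcup//; last 2 first.
  exact: measurable_funTS.
  by move=> x _; rewrite lee_fin.
by apply: is_cvg_ereal_nneg_natsum => n _; exact: density_ge0.
Qed.

HB.instance Definition _ := isMeasure.Build _ _ _ density
  density0 density_ge0 density_sigma_additive.

Import HBNNSimple.

Let integral_density D (f : T -> \bar R) : measurable D ->
  measurable_fun D f -> (forall x, D x -> 0 <= f x) ->
  \int[density]_(x in D) f x = \int[mu]_(x in D) (f x * (w x)%:E).
Proof.
move=> mD mf f0.
pose h := nnsfun_approx mD mf.
have mwD : measurable_fun D (EFin \o w) by exact: measurable_funTS.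
have mh n : measurable_fun D (EFin \o h n).
  by apply/measurable_EFinP; exact: measurable_funTS.
have hn n x : (0 <= h n x)%R by exact: fun_ge0.
have ndh x : D x -> {homo (fun n => h n x) : a b / (a <= b)%N >-> (a <= b)%R}.
  by move=> Dx a b ab; exact/lefP/nd_nnsfun_approx.
have -> : \int[density]_(x in D) f x =
    limn (fun n => \int[density]_(x in D) (EFin \o h n) x).
  have fE x : D x -> f x = limn (EFin \o h ^~ x).
    by move=> Dx; apply/esym/cvg_lim => //; exact: cvg_nnsfun_approx.
  under eq_integral => x /[!inE] /fE -> //.
  apply: monotone_convergence => //.
  by move=> n x Dx; rewrite lee_fin.
have -> : \int[mu]_(x in D) (f x * (w x)%:E) =
    limn (fun n => \int[mu]_(x in D) ((EFin \o h n) x * (w x)%:E)).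
  have fE x : D x -> f x * (w x)%:E = limn (fun n => (h n x)%:E * (w x)%:E).
    move=> Dx; apply/esym/cvg_lim => //.
    by apply: cvgeZr => //; exact: cvg_nnsfun_approx.
  under eq_integral => x /[!inE] /fE -> //.
  apply: monotone_convergence => //.
  - by move=> n; exact: (emeasurable_funM (mh n) mwD).
  - by move=> n x Dx; rewrite mule_ge0// lee_fin.
  - by move=> x Dx a b ab; rewrite lee_wpmul2r ?lee_fin//; exact: ndh.
congr (limn _); apply/funext => n.
transitivity (\int[density]_(x in D)
   (\sum_(y \in range (h n)) (y * \1_(h n @^-1` [set y]) x)%:E)).
  by apply: eq_integral => t tD; rewrite /= fimfunE -fsumEFin.
have mi r : measurable_fun D (fun x => (r * \1_(h n @^-1` [set r]) x)%:E).
  by apply/measurable_EFinP; apply: measurable_funM.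
rewrite ge0_integral_fsum//; last by move=> y x Dx; exact: nnfun_muleindic_ge0.
transitivity (\int[mu]_(x in D) (\sum_(y \in range (h n))
   ((y * \1_(h n @^-1` [set y]) x)%:E * (w x)%:E))); last first.
  apply: eq_integral => t tD; rewrite /= fimfunE -fsumEFin//.
  rewrite ge0_mule_fsuml// => r.
  exact: nnfun_muleindic_ge0.
rewrite ge0_integral_fsum//; last 2 first.
- by move=> y; apply: emeasurable_funM.
- move=> y x Dx; rewrite mule_ge0 ?lee_fin//; exact: nnfun_muleindic_ge0.
apply: eq_fsbigr => r /[!inE] -[t _ <-{r}].
under eq_integral do rewrite EFinM.
rewrite ge0_integralZl//; last 2 first.
- exact/measurable_EFinP.
- by rewrite lee_fin.
rewrite integral_indic//.
transitivity ((h n t)%:E * \int[mu]_(x in D)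
    ((\1_(h n @^-1` [set h n t]) x)%:E * (w x)%:E)); last first.
  rewrite -ge0_integralZl//.
  - by apply: eq_integral => x _; rewrite EFinM muleA.
  - by apply: emeasurable_funM => //; exact/measurable_EFinP.
  - by move=> x _; rewrite mule_ge0 ?lee_fin.
  - by rewrite lee_fin.
congr (_ * _); rewrite setIC.
rewrite [LHS](_ : _ = density (D `&` h n @^-1` [set h n t]))//.
rewrite /density integral_mkcondr; apply: eq_integral => x _.
rewrite patchE indicE; case: ifPn => _; first by rewrite mul1e.
by rewrite mul0e.
Qed.

(** With the weight turned into a measure, stopping time arguments apply to the
    weighted and to the unweighted integral alike. *)
Lemma weighted_measure : exists nu : {measure set T -> \bar R},
  (forall A, measurable A -> nu A = \int[mu]_(x in A) (w x)%:E) /\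
  (forall D (f : T -> \bar R), measurable D -> measurable_fun D f ->
     (forall x, D x -> 0 <= f x) ->
     \int[nu]_(x in D) f x = \int[mu]_(x in D) (f x * (w x)%:E)).
Proof. by exists density; split => // D f; exact: integral_density. Qed.

End density.

(** * Nested countable partitions and stopping times *)

(** A cell is a fibre of idx k, and level 0 is the coarsest. Numbering the cells by
    natural numbers makes countability, and with it the measurability of every union
    of cells, part of the data. *)
Record grid d (T : measurableType d) := Grid {
  idx :> nat -> T -> nat ;
  idx_measurable : forall k, measurable_fun setT (idx k) ;
  idx_nested : forall k x y, idx k.+1 x = idx k.+1 y -> idx k x = idx k y }.

Section grid_theory.
Context d (T : measurableType d) (R : realType).
Variable q : grid T.
Implicit Types (k j p f : nat) (x y : T) (S U : set T).

Definition cell k x : set T := [set y | q k y = q k x].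
Definition saturated k S := forall x y, q k x = q k y -> S x -> S y.

Lemma idx_le j k x y : (j <= k)%N -> q k x = q k y -> q j x = q j y.
Proof.
move=> /subnK <-; elim: (k - j)%N => [//|i IH]; rewrite addSn => /idx_nested.
exact: IH.
Qed.

Lemma cellS j k x : (j <= k)%N -> cell k x `<=` cell j x.
Proof. by move=> jk y; exact: idx_le. Qed.

Lemma eq_cell k x y : q k x = q k y -> cell k x = cell k y.
Proof. by rewrite /cell => ->. Qed.

Lemma saturated_measurable k S : saturated k S -> measurable S.
Proof.
move=> satS; have -> : S = q k @^-1` (q k @` S).
  apply/seteqP; split => [x Sx|x [y Sy yx]]; first by exists x.
  exact: satS Sy.
by rewrite -[X in measurable X]setTI; exact: idx_measurable.
Qed.

Lemma saturated_le j k S : (j <= k)%N -> saturated j S -> saturated k S.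
Proof. by move=> jk satS x y /(idx_le jk); exact: satS. Qed.

Lemma saturated_cell j k x : (j <= k)%N -> saturated k (cell j x).
Proof. by move=> jk y z /(idx_le jk); rewrite /cell/= => ->. Qed.

Lemma measurable_cell k x : measurable (cell k x).
Proof. exact/(@saturated_measurable k)/saturated_cell. Qed.

Lemma saturatedI k S U : saturated k S -> saturated k U -> saturated k (S `&` U).
Proof. by move=> sS sU x y xy [/(sS _ _ xy) ? /(sU _ _ xy)]. Qed.

Lemma saturatedC k S : saturated k S -> saturated k (~` S).
Proof. by move=> sS x y /esym xy nSx /(sS _ _ xy). Qed.

Lemma measurable_cellwise k d' (T' : measurableType d') (g : T -> T') :
  (forall x y, q k x = q k y -> g x = g y) -> measurable_fun setT g.
Proof.
move=> gq _ Y _; rewrite setTI; apply: (@saturated_measurable k) => x y /gq.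
by rewrite /preimage/= => ->.
Qed.

Local Open Scope ereal_scope.

Section cell_integrals.
Variable nu : {measure set T -> \bar R}.

Lemma le_integral_cells k S (f g : T -> \bar R) : saturated k S ->
  measurable_fun setT f -> measurable_fun setT g ->
  (forall x, 0 <= f x) -> (forall x, 0 <= g x) ->
  (forall x, S x ->
     \int[nu]_(y in cell k x) f y <= \int[nu]_(y in cell k x) g y) ->
  \int[nu]_(y in S) f y <= \int[nu]_(y in S) g y.
Proof.
move=> satS mf mg f0 g0 fg.
pose F i := S `&` [set x | q k x = i].
have SF : S = \bigcup_i F i.
  by apply/seteqP; split => [x Sx|x [i _ []//]]; exists (q k x).
have mF i : measurable (F i).
  by apply: (@saturated_measurable k) => x y xy [/(satS _ _ xy) ?]; rewrite /F/= xy.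
have tF : trivIset setT F.
  by move=> i j _ _ [x [[_ <-] [_ <-]]].
rewrite SF !ge0_integral_bigcup//; try exact: measurable_funTS.
apply: lee_nneseries => [i _ _|i _]; first exact: integral_ge0.
have [[x [Sx xi]]|F0] := pselect (F i !=set0); last first.
  by move/set0P/negP/negPn/eqP : F0 => ->; rewrite !integral_set0.
suff -> : F i = cell k x by exact: fg.
apply/seteqP; split => [y [Sy yi]|y yx]; first by rewrite /cell/= yi xi.
by split; [apply: satS Sx; exact/esym|rewrite /= -xi].
Qed.

End cell_integrals.

Section stopping.
Variable stop : nat -> nat -> T -> bool.
Hypothesis stop_cell : forall p j x y,
  (p < j)%N -> q j x = q j y -> stop p j x = stop p j y.

(** The number of principal cells that contain x at the levels j, ..., j+f-1, when p
    is the level of the last principal cell before them: stopping at a level makes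
    the cell of that level principal, and later levels are compared with it. *)
Fixpoint stop_count f p j x : nat :=
  if f is f'.+1 then
    if stop p j x then (stop_count f' j j.+1 x).+1 else stop_count f' p j.+1 x
  else 0%N.

Fixpoint stopped f p j x : bool :=
  if f is f'.+1 then stop p j x || stopped f' p j.+1 x else false.

Lemma stoppedP f p j x :
  reflect (exists2 i, (j <= i < j + f)%N & stop p i x) (stopped f p j x).
Proof.
elim: f j => [|f IH] j /=.
  by constructor => -[i]; rewrite addn0 ltnNge => /andP[->].
apply: (iffP orP) => [[sj|/IH[i /andP[ji ijf] si]]|[i /andP[ji ijf] si]].
- by exists j => //; rewrite leqnn addnS ltnS leq_addr.
- by exists i => //; rewrite (ltnW ji)/= addnS -addSn.
move: ji; rewrite leq_eqVlt => /orP[/eqP->|ji]; first by left.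
by right; apply/IH; exists i => //; rewrite ji addSn -addnS.
Qed.

Lemma stop_count_cellwise k f p j x y : (p < j)%N -> (j + f <= k.+1)%N ->
  q k x = q k y -> stop_count f p j x = stop_count f p j y.
Proof.
move=> + + xy; elim: f p j => [//|f IH] p j pj; rewrite addnS ltnS => jfk /=.
have jk : (j <= k)%N by exact: leq_trans (leq_addr _ _) jfk.
rewrite (stop_cell pj (idx_le jk xy)); case: ifP => _.
  by rewrite IH// addSn ltnS.
by rewrite IH// ?(leq_trans pj)// addSn ltnS.
Qed.

Lemma stopped_cellwise k f p j x y : (p < j)%N -> (j + f <= k.+1)%N ->
  q k x = q k y -> stopped f p j x = stopped f p j y.
Proof.
move=> + + xy; elim: f j => [//|f IH] j pj; rewrite addnS ltnS => jfk /=.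
have jk : (j <= k)%N by exact: leq_trans (leq_addr _ _) jfk.
by rewrite (stop_cell pj (idx_le jk xy)) IH// ?(leq_trans pj)// addSn ltnS.
Qed.

Lemma stop_count_le f f' p j x : (f <= f')%N ->
  (stop_count f p j x <= stop_count f' p j x)%N.
Proof.
elim: f f' p j => [//|f IH] [//|f'] p j; rewrite ltnS => ff' /=.
by case: ifP => _; rewrite ?ltnS IH.
Qed.

Lemma measurable_stopped f p j : (p < j)%N -> measurable [set x | stopped f p j x].
Proof.
move=> pj; apply: (@saturated_measurable (j + f)) => x y xy.
by rewrite /= (stopped_cellwise (k := (j + f)%N) _ _ xy)//; exact: leqW.
Qed.

Variable nu : {measure set T -> \bar R}.

(** Weak type (1,1) bound of the maximal function of the grid, in the form used
    here: the first cells that are stopped are disjoint. *)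
Lemma stopped_weak_type (g : T -> \bar R) (B : R) f p j U : (0 <= B)%R ->
  measurable_fun setT g -> (forall x, 0 <= g x) -> (p < j)%N -> saturated j U ->
  (forall i x, (j <= i)%N -> U x -> stop p i x ->
     B%:E * nu (cell i x) <= \int[nu]_(y in cell i x) g y) ->
  B%:E * nu (U `&` [set y | stopped f p j y]) <= \int[nu]_(y in U) g y.
Proof.
move=> B0 mg g0; elim: f j U => [|f IH] j U pj sU H.
  rewrite /= (_ : [set y | false] = set0); last by apply/seteqP; split.
  by rewrite setI0 measure0 mule0 integral_ge0.
have mU : measurable U by exact: saturated_measurable sU.
pose S := [set y | stop p j y].
have sS : saturated j S by move=> y z yz; rewrite /S/= (stop_cell pj yz).
have mS : measurable S by exact: saturated_measurable sS.
have mUS : measurable (U `&` S) by exact: measurableI.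
have mUSC : measurable (U `\` S) by exact: measurableD.
rewrite -[in leRHS](setUIDK U S) ge0_integral_setU//; last 2 first.
- exact/measurable_funTS.
- by apply/disj_setPS => y [[_ ?] []].
have -> : U `&` [set y | stopped f.+1 p j y] =
    (U `&` S) `|` ((U `\` S) `&` [set y | stopped f p j.+1 y]).
  apply/seteqP; split => y /=.
    case=> Uy; have [sy _|/negP sy] := boolP (stop p j y); first by left.
    by move=> /= s; right.
  by case=> [[Uy ->]//|[[Uy sy] ->]]; rewrite orbT.
rewrite measureU//; last 2 first.
- by apply: measurableI => //; apply: measurable_stopped; exact: leqW.
- by apply/seteqP; split => // y [[_ ?] [[]]].
rewrite ge0_muleDr//; apply: leeD; last first.
  apply: IH; first exact: leqW.
    apply: (saturated_le (leqnSn j)).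
    by rewrite setDE; apply: saturatedI => //; exact: saturatedC.
  by move=> i x ji [Ux _]; apply: H => //; exact: ltnW.
rewrite -(integral_cst nu mUS).
apply: (@le_integral_cells nu j) => //; first exact: saturatedI.
move=> x [Ux Sx]; rewrite integral_cst; last exact: measurable_cell.
exact: H.
Qed.

Variables (theta mu : R).
Hypothesis mu1 : (1 <= mu)%R.
Hypothesis thetamu : (theta * mu < 1)%R.
Hypothesis nu_fin : forall k x, nu (cell k x) < +oo.
Hypothesis sparse : forall f p x,
  nu (cell p x `&` [set y | stopped f p p.+1 y]) <= theta%:E * nu (cell p x).

Let mu0 : (0 <= mu)%R. Proof. exact: le_trans mu1. Qed.

Let C : R := (1 - theta * mu)^-1.

Let C0 : (0 <= C)%R. Proof. by rewrite invr_ge0 subr_ge0 ltW. Qed.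

Let mcount f p j : (p < j)%N ->
  measurable_fun setT (fun x => (mu ^+ stop_count f p j x)%:E).
Proof.
move=> pj; apply: (@measurable_cellwise (j + f)) => x y xy.
by rewrite (stop_count_cellwise (k := (j + f)%N) _ _ xy)//; exact: leqW.
Qed.

(** Each stop costs a factor theta of the measure, so the number of stops has an
    exponential moment of every base mu less than the inverse of theta. *)
Lemma stop_count_exp_integrable f p x :
  \int[nu]_(y in cell p x) (mu ^+ stop_count f p p.+1 y)%:E
    <= (1 - theta * mu)^-1%:E * nu (cell p x).
Proof.
rewrite -/C; elim/ltn_ind: f p x => f0 IH p x.
have aux f : (f <= f0)%N -> forall j U, (p < j)%N -> saturated j U ->
    \int[nu]_(y in U) (mu ^+ stop_count f p j y)%:E <=
    nu U + (C * mu)%:E * nu (U `&` [set y | stopped f p j y]).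
  elim: f => [|f IHf] ff0 j U pj sU.
    rewrite /= (_ : [set y | false] = set0); last by apply/seteqP; split.
    rewrite setI0 measure0 mule0 adde0 integral_cst ?mul1e//.
    exact: saturated_measurable sU.
  have mU : measurable U by exact: saturated_measurable sU.
  pose S := [set y | stop p j y].
  have sS : saturated j S by move=> y z yz; rewrite /S/= (stop_cell pj yz).
  have mS : measurable S by exact: saturated_measurable sS.
  have mUS : measurable (U `&` S) by exact: measurableI.
  have mUSC : measurable (U `\` S) by exact: measurableD.
  rewrite -[in leLHS](setUIDK U S) ge0_integral_setU//; last 3 first.
  - exact/measurable_funTS/mcount.
  - by move=> y _; rewrite lee_fin exprn_ge0.
  - by apply/disj_setPS => y [[_ ?] []].
  have -> : U `&` [set y | stopped f.+1 p j y] =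
      (U `&` S) `|` ((U `\` S) `&` [set y | stopped f p j.+1 y]).
    apply/seteqP; split => y /=.
      case=> Uy; have [sy _|/negP sy] := boolP (stop p j y); first by left.
      by move=> /= s; right.
    by case=> [[Uy ->]//|[[Uy sy] ->]]; rewrite orbT.
  rewrite measureU//; last 2 first.
  - by apply: measurableI => //; apply: measurable_stopped; exact: leqW.
  - by apply/seteqP; split => // y [[_ ?] [[]]].
  have -> : nu U = nu (U `&` S) + nu (U `\` S).
    rewrite -measureU//; first by rewrite setUIDK.
    by apply/seteqP; split => // y [[_ ?] []].
  rewrite ge0_muleDr// [leRHS]addeACA; apply: leeD.
    apply: (@le_trans _ _ ((C * mu)%:E * nu (U `&` S))); last first.
      by rewrite leeDr.
    rewrite -(integral_cst nu mUS).
    apply: (@le_integral_cells nu j) => //.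
    - exact: saturatedI.
    - exact: mcount.
    - by move=> y; rewrite lee_fin exprn_ge0.
    - by move=> y; rewrite lee_fin mulr_ge0.
    move=> y [Uy Sy].
    rewrite (eq_integral (fun z => mu%:E * (mu ^+ stop_count f j j.+1 z)%:E)); last first.
      move=> z; rewrite inE => zy /=.
      by rewrite (stop_cell pj zy) (Sy : stop _ _ _) exprS EFinM.
    rewrite ge0_integralZl//; last 3 first.
    - exact: measurable_cell.
    - exact/measurable_funTS/mcount.
    - by move=> z _; rewrite lee_fin exprn_ge0.
    rewrite integral_cst; last exact: measurable_cell.
    rewrite mulrC EFinM -muleA lee_wpmul2l ?lee_fin//.
    by apply: IH; exact: leq_trans ff0.
  have H : U `\` S `<=` [set y | stop p j y = false].
    by move=> y [_ /negP/negbTE].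
  rewrite (eq_integral (fun y => (mu ^+ stop_count f p j.+1 y)%:E)); last first.
    by move=> y; rewrite inE => /H /= ->.
  apply: IHf; [exact: ltnW|exact: leqW|].
  apply: (saturated_le (leqnSn j)).
  by rewrite setDE; apply: saturatedI => //; exact: saturatedC.
have cpS : saturated p.+1 (cell p x) by exact: saturated_cell.
apply: le_trans (aux f0 (leqnn _) p.+1 _ (ltnSn p) cpS) _.
have nuE : nu (cell p x) = (fine (nu (cell p x)))%:E.
  by rewrite fineK// ge0_fin_numE.
apply: (@le_trans _ _ (nu (cell p x) + (C * mu)%:E * (theta%:E * nu (cell p x)))).
  by rewrite leeD2l// lee_wpmul2l// lee_fin mulr_ge0.
rewrite nuE -!EFinM -EFinD lee_fin.
rewrite -{1}[fine _]mul1r mulrA -mulrDl ler_wpM2r ?fine_ge0//.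
have h : (0 < 1 - theta * mu)%R by rewrite subr_gt0.
by rewrite /C le_eqVlt; apply/orP; left; apply/eqP; field; rewrite gt_eqF.
Qed.

End stopping.

End grid_theory.

(** * The sparse bound *)

Definition sparse_const (R : realType) (r A theta mu D : R) : R :=
  ((1 - (mu `^ r^-1)^-1)^-1) `^ r *
  (2^-1 * A `^ r * (D + (1 - theta * mu ^+ 2)^-1) / (1 - theta)).

Section sparse.
Context d (T : measurableType d) (R : realType).
Variables (q : grid T) (nu : {measure set T -> \bar R}).
Variables (r A theta mu D : R) (K : nat).
Variables (a : nat -> R) (G beta : nat -> T -> R).
Hypothesis r1 : 1 <= r.
Hypothesis A1 : 1 <= A.
Hypothesis theta01 : 0 <= theta < 1.
Hypothesis mu1 : 1 < mu.
Hypothesis thetamu : theta * mu ^+ 2 < 1.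
Hypothesis D0 : 0 <= D.
Hypothesis a0 : forall l, 0 <= a l.
Hypothesis G0 : forall l x, 0 <= G l x.
Hypothesis beta0 : forall l x, 0 <= beta l x.
Hypothesis G_cell : forall l x y, q l x = q l y -> G l x = G l y.
Hypothesis mbeta : forall l, measurable_fun setT (beta l).
Hypothesis nu_fin : forall k x, (nu (cell q k x) < +oo)%E.
Hypothesis beta_moment : forall l x,
  (\int[nu]_(y in cell q l x) (beta l y `^ (2 * r))%:E
     <= D%:E * nu (cell q l x))%E.

Definition jump p j x := A * G p x < G j x.

Hypothesis sparse : forall f p x,
  (nu (cell q p x `&` [set y | stopped jump f p p.+1 y])
     <= theta%:E * nu (cell q p x))%E.

Let r0 : 0 < r. Proof. exact: lt_le_trans r1. Qed.
Let A0 : 0 <= A. Proof. exact: le_trans A1. Qed.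
Let mu0 : 0 < mu. Proof. exact: lt_trans mu1. Qed.

Let jump_cell p j x y : (p < j)%N -> q j x = q j y -> jump p j x = jump p j y.
Proof.
by move=> pj xy; rewrite /jump (G_cell xy) (G_cell (idx_le (ltnW pj) xy)).
Qed.

Let count := stop_count jump.

Let tail p := \sum_(p <= l < K.+1) a l.
Let B p x := \sum_(p <= l < K.+1) a l * beta l x.
Let S p x := \sum_(p <= l < K.+1) a l * G l x * beta l x.
Let u p x := A * G p x * B p x.

Let BE p x : (p < K.+1)%N -> B p x = a p * beta p x + B p.+1 x.
Proof. by move=> pK; rewrite /B big_ltn. Qed.

Let SE p x : (p < K.+1)%N -> S p x = a p * G p x * beta p x + S p.+1 x.
Proof. by move=> pK; rewrite /S big_ltn. Qed.

(** The contribution of the principal cells below the current one, each weighted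
    by a power of mu with exponent the number of principal cells under it. *)
Fixpoint below f p j x : R :=
  if f is f'.+1 then
    if jump p j x then mu ^+ count f' j j.+1 x * u j x `^ r + below f' j j.+1 x
    else below f' p j.+1 x
  else 0.

Let total f p x := mu ^+ count f p p.+1 x * u p x `^ r + below f p p.+1 x.

Let tail0 p : 0 <= tail p. Proof. exact: sumr_ge0. Qed.

Let B0 p x : 0 <= B p x.
Proof. by apply: sumr_ge0 => i _; rewrite mulr_ge0. Qed.

Let u0 p x : 0 <= u p x. Proof. by rewrite !mulr_ge0. Qed.

Let below0 f p j x : 0 <= below f p j x.
Proof.
elim: f p j => [//|f IH] p j /=; case: ifP => _ //.
by rewrite addr_ge0// mulr_ge0 ?powR_ge0// exprn_ge0// ltW.
Qed.

Let total0 f p x : 0 <= total f p x.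
Proof. by rewrite addr_ge0// mulr_ge0 ?powR_ge0// exprn_ge0// ltW. Qed.

Let delta := (mu `^ r^-1)^-1.

Let delta01 : 0 < delta < 1.
Proof.
have h : 1 < mu `^ r^-1.
  rewrite (_ : 1 = 1 `^ r^-1); last by rewrite powR1.
  apply: gt0_ltr_powR => //.
  - by rewrite invr_gt0.
  - by rewrite nnegrE.
  - by rewrite nnegrE ltW.
by rewrite /delta invr_gt0 (lt_trans _ h)//= invf_lt1// (lt_trans _ h).
Qed.

Let delta_pow n : (delta ^+ n) `^ r = (mu ^+ n)^-1.
Proof.
case/andP: delta01 => d0 _.
elim: n => [|n IH]; first by rewrite !expr0 powR1 invr1.
rewrite !exprS powRM ?exprn_ge0 ?ltW// IH invfM; congr (_ * _).
rewrite /delta -powR_inv1 ?powR_ge0// -!powRrM.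
rewrite (_ : r^-1 * (-1 * r) = -1) ?powR_inv1 ?ltW//.
by rewrite mulN1r mulrN mulVf// gt_eqF.
Qed.

(** The principal cells that contain a given point form a chain, and a sum along
    the chain is dominated by a geometric series once every term is at most
    W delta^i, i being the number of cells of the chain below. *)
Let sum_le_chain f p j x W : (j + f)%N = K.+1 -> 0 <= W ->
  below f p j x <= W `^ r ->
  S j x <= A * G p x * B j x +
  (\sum_(i < count f p j x) delta ^+ i) * W.
Proof.
move=> jf W0; elim: f p j jf => [|f IH] p j.
  rewrite addn0 => -> _; rewrite /S /B !big_geq// mulr0 add0r mulr_ge0//.
  apply: sumr_ge0 => i _; rewrite exprn_ge0// ltW//; by case/andP: delta01.
move=> jf /=.
have jK : (j < K.+1)%N by rewrite -jf addnS ltnS leq_addr.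
have jf' : (j.+1 + f)%N = K.+1 by rewrite addSn -addnS.
rewrite /count/=; case: ifPn => [jmp|njmp] hW; last first.
  rewrite (SE x jK) (BE x jK).
  have := IH p j.+1 jf' hW; rewrite /count.
  set Z := \sum_(_ < _) _ => h.
  have : a j * G j x * beta j x <= A * G p x * (a j * beta j x).
    rewrite [leRHS](_ : _ = a j * (A * G p x) * beta j x); last by ring.
    by rewrite ler_wpM2r// ler_wpM2l// leNgt.
  rewrite mulrDr; lra.
have hb : below f j j.+1 x <= W `^ r.
  apply: le_trans hW; rewrite lerDr mulr_ge0 ?powR_ge0// exprn_ge0// ltW//.
have := IH j j.+1 jf' hb.
rewrite -/(count f j j.+1 x); set n := count f j j.+1 x.
have hu : u j x <= delta ^+ n * W.
  case/andP: delta01 => d0 _.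
  have dn0 : 0 <= delta ^+ n by rewrite exprn_ge0// ltW.
  apply: (@ler_powR_cancel _ r) => //; first by rewrite mulr_ge0.
  rewrite [leRHS]powRM// delta_pow mulrC ler_pdivlMr ?exprn_gt0// mulrC.
  by apply: le_trans hW; rewrite lerDl.
rewrite big_ord_recr/= mulrDl.
move: hu; rewrite /u (SE x jK) (BE x jK).
set Z := \sum_(_ < _) _ => hu h.
have h1 : a j * G j x * beta j x <= A * G j x * (a j * beta j x).
  rewrite [leRHS](_ : _ = A * (a j * G j x * beta j x)); last by ring.
  by rewrite ler_peMl// !mulr_ge0.
have h2 : 0 <= A * G p x * (a j * beta j x + B j.+1 x).
  by rewrite mulr_ge0// ?addr_ge0// mulr_ge0.
rewrite mulrDr in hu; lra.
Qed.

Let sum_le_total f p x : (p + f)%N = K ->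
  S p x `^ r <= ((1 - delta)^-1) `^ r * total f p x.
Proof.
move=> pf; case/andP: delta01 => d0 d1.
pose W := total f p x `^ r^-1.
have W0 : 0 <= W by exact: powR_ge0.
have WE : W `^ r = total f p x by rewrite /W -powRrM mulVf ?gt_eqF// powRr1.
have pK : (p < K.+1)%N by rewrite ltnS -pf leq_addr.
have pf' : (p.+1 + f)%N = K.+1 by rewrite addSn pf.
have S0 : 0 <= S p x.
  by apply: sumr_ge0 => i _; rewrite !mulr_ge0.
have iD0 : 0 <= (1 - delta)^-1 by rewrite invr_ge0 subr_ge0 ltW.
suff h : S p x <= (1 - delta)^-1 * W.
  by rewrite -WE -powRM//; apply: ler_powR_base => //; exact: ltW.
have hb : below f p p.+1 x <= W `^ r.
  by rewrite WE /total lerDr mulr_ge0 ?powR_ge0// exprn_ge0// ltW.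
have := sum_le_chain pf' W0 hb.
set n := count f p p.+1 x.
have hu : u p x <= delta ^+ n * W.
  have dn0 : 0 <= delta ^+ n by rewrite exprn_ge0// ltW.
  apply: (@ler_powR_cancel _ r) => //; first by rewrite mulr_ge0.
  rewrite [leRHS]powRM// delta_pow mulrC ler_pdivlMr ?exprn_gt0// mulrC WE.
  by rewrite lerDl.
have geo : \sum_(i < n.+1) delta ^+ i <= (1 - delta)^-1.
  rewrite -[leRHS]mul1r ler_pdivlMr ?subr_gt0//.
  have := subrX1 delta n.+1; have := exprn_ge0 n.+1 (ltW d0); lra.
move=> h; apply: le_trans (ler_wpM2r W0 geo).
rewrite big_ord_recr/= mulrDl.
move: hu h; rewrite /u (SE x pK) (BE x pK).
set Z := \sum_(_ < _) _ => hu h.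
have h1 : a p * G p x * beta p x <= A * G p x * (a p * beta p x).
  rewrite [leRHS](_ : _ = A * (a p * G p x * beta p x)); last by ring.
  by rewrite ler_peMl// !mulr_ge0.
rewrite mulrDr in hu; lra.
Qed.

Let mG l : measurable_fun setT (G l).
Proof. by apply: (@measurable_cellwise _ _ q l) => x y /G_cell. Qed.

Let mB p : measurable_fun setT (B p).
Proof.
by apply: measurable_sum => i; apply: measurable_funM.
Qed.

Let mu_ p : measurable_fun setT (fun x => u p x `^ r).
Proof.
apply: (measurableT_comp (measurable_powR r)).
by apply: measurable_funM => //; apply: measurable_funM.
Qed.

Let mmu f p j : (p < j)%N -> measurable_fun setT (fun x => mu ^+ count f p j x).
Proof.
move=> pj; apply: (@measurable_cellwise _ _ q (j + f)) => x y xy.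
by rewrite /count (stop_count_cellwise jump_cell (k := (j + f)%N) _ _ xy)//; exact: leqW.
Qed.

Let mbelow f p j : (p < j)%N -> measurable_fun setT (below f p j).
Proof.
elim: f p j => [|f IH] p j pj /=; first exact: measurable_cst.
apply: measurable_fun_ifT.
- by apply: (@measurable_cellwise _ _ q j) => x y; exact: jump_cell.
- apply: measurable_funD; last exact: IH.
  by apply: measurable_funM => //; exact: mmu.
- by apply: IH; exact: leqW.
Qed.

Let mtotal f p : measurable_fun setT (total f p).
Proof.
apply: measurable_funD; last exact: mbelow.
by apply: measurable_funM => //; exact: mmu.
Qed.

Variable m : T -> R.
Hypothesis mm : measurable_fun setT m.
Hypothesis m_ge : forall l x, (l <= K)%N -> tail l * G l x <= m x.

Let m0 x : 0 <= m x.
Proof. by apply: le_trans (m_ge x (leq0n K)); rewrite mulr_ge0. Qed.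

Let Cexp := (1 - theta * mu ^+ 2)^-1.
Let K2 := 2^-1 * A `^ r * (D + Cexp).
Let K1 := K2 / (1 - theta).

Let Cexp0 : 0 <= Cexp. Proof. by rewrite invr_ge0 subr_ge0 ltW. Qed.
Let K20 : 0 <= K2.
Proof. by rewrite !mulr_ge0 ?powR_ge0 ?invr_ge0// addr_ge0. Qed.
Let K10 : 0 <= K1.
Proof. by rewrite divr_ge0// subr_ge0 ltW//; case/andP: theta01. Qed.

Local Open Scope ereal_scope.

Let B_moment p x :
  \int[nu]_(y in cell q p x) (B p y `^ (2 * r))%:E
    <= (tail p `^ (2 * r) * D)%:E * nu (cell q p x).
Proof.
have r21 : (1 < 2 * r)%R by rewrite -ltr_pdivrMl// mulr1 (lt_le_trans _ r1)// invf_lt1// ltr1n.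
pose F y := (tail p `^ (2 * r - 1))%:E *
  \sum_(p <= l < K.+1) (a l)%:E * (beta l y `^ (2 * r))%:E.
have mF l : measurable_fun (cell q p x) (fun y => (a l)%:E * (beta l y `^ (2 * r))%:E).
  apply: measurable_funTS; apply/measurable_funeM/measurable_EFinP.
  exact: measurableT_comp (measurable_powR _) (mbeta l).
apply: (@le_trans _ _ (\int[nu]_(y in cell q p x) F y)).
  apply: le_integral_raw => [y _|y _]; first by rewrite lee_fin powR_ge0.
  rewrite /F; under eq_bigr do rewrite -EFinM.
  rewrite sumEFin -EFinM lee_fin.
  exact: powR_sum_jensen.
rewrite /F ge0_integralZl//; last 4 first.
- exact: measurable_cell.
- exact: emeasurable_sum.
- by move=> y _; apply: sume_ge0 => l _; rewrite -EFinM lee_fin mulr_ge0// powR_ge0.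
- by rewrite lee_fin powR_ge0.
rewrite ge0_integral_sum//; last 2 first.
- exact: measurable_cell.
- by move=> l y _; rewrite -EFinM lee_fin mulr_ge0// powR_ge0.
apply: (@le_trans _ _ ((tail p `^ (2 * r - 1))%:E *
   \sum_(p <= l < K.+1) ((a l * D)%:E * nu (cell q p x)))).
  rewrite lee_wpmul2l ?lee_fin ?powR_ge0//.
  rewrite big_nat_cond [leRHS]big_nat_cond.
  apply: lee_sum => l; rewrite andbT => /andP[pl _].
  rewrite ge0_integralZl//; last 4 first.
  - exact: measurable_cell.
  - apply/measurable_funTS/measurable_EFinP.
    exact: measurableT_comp (measurable_powR _) (mbeta l).
  - by move=> y _; rewrite lee_fin powR_ge0.
  - by rewrite lee_fin.
  rewrite EFinM -muleA lee_wpmul2l ?lee_fin//.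
  rewrite -integral_cst; last exact: measurable_cell.
  apply: (@le_integral_cells _ _ _ q nu l) => //.
  - exact: saturated_cell.
  - apply/measurable_EFinP.
    exact: measurableT_comp (measurable_powR _) (mbeta l).
  - by move=> y; rewrite lee_fin powR_ge0.
  move=> y _; rewrite integral_cst; last exact: measurable_cell.
  exact: beta_moment.
have nuE : nu (cell q p x) = (fine (nu (cell q p x)))%:E.
  by rewrite fineK// ge0_fin_numE.
rewrite nuE; under eq_bigr do rewrite -EFinM.
rewrite sumEFin -!EFinM lee_fin -mulr_suml -mulr_suml -/(tail p).
rewrite !mulrA ler_wpM2r ?fine_ge0// ler_wpM2r//.
have [->|tN0] := eqVneq (tail p) 0%R; first by rewrite mulr0 powR_ge0.
by rewrite -{2}(powRr1 (tail0 p)) -powRD ?tN0 ?implybT// subrK.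
Qed.

(** The principal cell itself: the square of the product of B^r and mu^count is
    split by the inequality between the arithmetic and geometric means, which
    uses the 2r-th moment of beta and the exponential moment of the count. *)
Let top_moment f p x :
  \int[nu]_(y in cell q p x) (mu ^+ count f p p.+1 y * u p y `^ r)%:E
  <= (K2 * (tail p * G p x) `^ r)%:E * nu (cell q p x).
Proof.
set t := tail p.
have GE y : cell q p x y -> G p y = G p x by move=> yx; exact: G_cell.
have nuE : nu (cell q p x) = (fine (nu (cell q p x)))%:E.
  by rewrite fineK// ge0_fin_numE.
have [t_0|tN0] := eqVneq t 0%R.
  rewrite (_ : integral _ _ _ = 0).
    by rewrite nuE -EFinM lee_fin mulr_ge0 ?fine_ge0// mulr_ge0 ?powR_ge0.
  apply: integral0_eq => y _.
  suff Bz : B p y = 0%R by rewrite /u Bz mulr0 powR0 ?mulr0// gt_eqF.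
  move: t_0; rewrite /t /tail /B; elim: (index_iota p K.+1) => [|i s IH].
    by rewrite !big_nil.
  rewrite !big_cons => /eqP; rewrite paddr_eq0 ?sumr_ge0// => /andP[/eqP-> /eqP s0].
  by rewrite mul0r add0r IH.
have tp : (0 < t)%R by rewrite lt_def tN0 tail0.
have trp : (0 < t `^ r)%R by rewrite powR_gt0.
set c := (2^-1 * A `^ r * G p x `^ r)%R.
have c0 : (0 <= c)%R by rewrite !mulr_ge0 ?powR_ge0 ?invr_ge0.
pose F1 y := ((t `^ r)^-1)%:E * (B p y `^ (2 * r))%:E.
pose F2 y := (t `^ r)%:E * ((mu ^+ 2) ^+ count f p p.+1 y)%:E.
have mF1 : measurable_fun setT F1.
  apply/measurable_funeM/measurable_EFinP.
  exact: measurableT_comp (measurable_powR _) (mB p).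
have mF2' : measurable_fun setT (fun y => ((mu ^+ 2) ^+ count f p p.+1 y)%:E).
  apply/measurable_EFinP; rewrite (_ : (fun _ => _) =
    (fun y => (mu ^+ count f p p.+1 y) ^+ 2)%R).
    by apply: measurable_funX; exact: mmu.
  by apply/funext => y; rewrite exprAC.
have mF2 : measurable_fun setT F2 by exact/measurable_funeM.
have F10 y : 0 <= F1 y by rewrite /F1 -EFinM lee_fin mulr_ge0 ?invr_ge0 ?powR_ge0.
have F20 y : 0 <= F2 y.
  by rewrite /F2 -EFinM lee_fin mulr_ge0 ?powR_ge0// !exprn_ge0// ltW.
apply: (@le_trans _ _ (\int[nu]_(y in cell q p x) (c%:E * (F1 y + F2 y)))).
  apply: le_integral_raw => [y _|y yx].
    by rewrite lee_fin mulr_ge0 ?powR_ge0// exprn_ge0// ltW.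
  rewrite /F1 /F2 -!EFinM lee_fin.
  rewrite /u (GE _ yx) !powRM// ?mulr_ge0// /c.
  set b := (B p y `^ r)%R; set n := (mu ^+ count _ _ _ _)%R.
  have -> : (B p y `^ (2 * r) = b ^+ 2)%R.
    by rewrite mulrC powRrM powR_mulrn// powR_ge0.
  have -> : ((mu ^+ 2) ^+ count f p p.+1 y = n ^+ 2)%R by rewrite exprAC.
  set s := (t `^ r)%R.
  have : (n * b <= 2^-1 * (s^-1 * b ^+ 2 + s * n ^+ 2))%R.
    rewrite -subr_ge0 (_ : _ - _ = 2^-1 * s^-1 * (b - s * n) ^+ 2)%R.
      by rewrite mulr_ge0 ?sqr_ge0// mulr_ge0 ?invr_ge0 ?powR_ge0.
    by field; rewrite gt_eqF.
  have AG : (0 <= A `^ r * G p x `^ r)%R by rewrite mulr_ge0 ?powR_ge0.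
  move=> /(ler_wpM2l AG).
  rewrite [leLHS](_ : _ = n * (A `^ r * G p x `^ r * b))%R; last by ring.
  move=> h; apply: (le_trans h); rewrite le_eqVlt; apply/orP; left; apply/eqP.
  by ring.
rewrite ge0_integralZl//; last 3 first.
- exact: measurable_cell.
- by apply: measurable_funTS; exact: emeasurable_funD.
- by move=> y _; rewrite adde_ge0.
rewrite ge0_integralD//; last 3 first.
- exact: measurable_cell.
- exact: measurable_funTS.
- exact: measurable_funTS.
rewrite /F1 /F2 ge0_integralZl//; last 4 first.
- exact: measurable_cell.
- apply/measurable_funTS/measurable_EFinP.
  exact: measurableT_comp (measurable_powR _) (mB p).
- by move=> y _; rewrite lee_fin powR_ge0.
- by rewrite lee_fin invr_ge0 powR_ge0.
rewrite ge0_integralZl//; last 4 first.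
- exact: measurable_cell.
- exact: measurable_funTS.
- by move=> y _; rewrite lee_fin !exprn_ge0// ltW.
- by rewrite lee_fin powR_ge0.
have mu21 : (1 <= mu ^+ 2)%R by rewrite exprn_ege1// ltW.
have h2 := @stop_count_exp_integrable _ _ _ q jump jump_cell nu theta (mu ^+ 2)
  mu21 thetamu nu_fin sparse f p x.
apply: (@le_trans _ _ (c%:E * (((t `^ r)^-1)%:E * ((t `^ (2 * r) * D)%:E * nu (cell q p x))
    + (t `^ r)%:E * (Cexp%:E * nu (cell q p x))))).
  rewrite lee_wpmul2l ?lee_fin// leeD//.
    by rewrite lee_wpmul2l ?lee_fin ?invr_ge0 ?powR_ge0//; exact: B_moment.
  by rewrite lee_wpmul2l ?lee_fin ?powR_ge0.
rewrite nuE -!EFinM lee_fin le_eqVlt; apply/orP; left; apply/eqP.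
have -> : (t `^ (2 * r) = (t `^ r) ^+ 2)%R.
  by rewrite mulrC powRrM powR_mulrn// powR_ge0.
rewrite /c /K2 (@powRM _ t (G p x)) ?(ltW tp)//.
by field; rewrite gt_eqF.
Qed.

Let total_le f p x : (p + f)%N = K ->
  \int[nu]_(y in cell q p x) (total f p y)%:E <=
  K1%:E * \int[nu]_(y in cell q p x) (m y `^ r)%:E.
Proof.
have mmr : measurable_fun setT (fun y => (m y `^ r)%:E).
  by apply/measurable_EFinP; exact: measurableT_comp (measurable_powR _) mm.
have mr0 y : 0 <= (m y `^ r)%:E by rewrite lee_fin powR_ge0.
elim/ltn_ind: f p x => f0 IH p x pf.
have aux f : (f <= f0)%N -> forall j U, (j + f)%N = K.+1 -> (p < j)%N ->
    saturated q j U ->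
    \int[nu]_(y in U) (below f p j y)%:E <=
    K1%:E * \int[nu]_(y in U `&` [set y | stopped jump f p j y]) (m y `^ r)%:E.
  elim: f => [|f IHf] ff0 j U jf pj sU.
    rewrite [leLHS](_ : _ = 0); last exact: integral0_eq.
    by rewrite mule_ge0 ?lee_fin// integral_ge0.
  have jf' : (j.+1 + f)%N = K.+1 by rewrite addSn -addnS.
  have jf'' : (j + f)%N = K by apply/eqP; rewrite -eqSS -addnS jf.
  have mU : measurable U by exact: saturated_measurable sU.
  pose J := [set y | jump p j y].
  have sJ : saturated q j J by move=> y z yz; rewrite /J/= (jump_cell pj yz).
  have mJ : measurable J by exact: saturated_measurable sJ.
  have mUJ : measurable (U `&` J) by exact: measurableI.
  have mUJC : measurable (U `\` J) by exact: measurableD.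
  have mst : measurable [set y | stopped jump f p j.+1 y].
    by apply: (measurable_stopped jump_cell); exact: leqW.
  rewrite -[in leLHS](setUIDK U J) ge0_integral_setU//; last 3 first.
  - exact/measurable_funTS/measurable_EFinP/(mbelow f.+1).
  - by move=> y _; rewrite lee_fin (below0 f.+1).
  - by apply/disj_setPS => y [[_ ?] []].
  have -> : U `&` [set y | stopped jump f.+1 p j y] =
      (U `&` J) `|` ((U `\` J) `&` [set y | stopped jump f p j.+1 y]).
    apply/seteqP; split => y /=.
      case=> Uy; have [sy _|/negP sy] := boolP (jump p j y); first by left.
      by move=> /= s; right.
    by case=> [[Uy ->]//|[[Uy sy] ->]]; rewrite orbT.
  rewrite ge0_integral_setU//; last 3 first.
  - exact: measurableI.
  - exact: measurable_funTS.
  - by apply/disj_setPS => y [[_ ?] [[]]].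
  rewrite ge0_muleDr ?integral_ge0//; apply: leeD.
    rewrite -ge0_integralZl//; last exact: measurable_funTS.
    apply: (@le_integral_cells _ _ _ q nu j) => //.
    - exact: saturatedI.
    - exact/measurable_EFinP/(mbelow f.+1).
    - exact/measurable_funeM.
    - by move=> y; rewrite lee_fin (below0 f.+1).
    - by move=> y; rewrite mule_ge0// lee_fin.
    move=> y [Uy Jy].
    rewrite (eq_integral (fun z => (total f j z)%:E)); last first.
      move=> z; rewrite inE => zy /=.
      by rewrite (jump_cell pj zy) (Jy : jump _ _ _).
    rewrite ge0_integralZl//; last 2 first.
    - exact: measurable_cell.
    - exact: measurable_funTS.
    by apply: IH => //; exact: leq_trans ff0.
  have H : U `\` J `<=` [set y | jump p j y = false].
    by move=> y [_ /negP/negbTE].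
  rewrite (eq_integral (fun y => (below f p j.+1 y)%:E)); last first.
    by move=> y; rewrite inE => /H /= ->.
  apply: IHf => //; [exact: ltnW|exact: leqW|].
  apply: (saturated_le (leqnSn j)).
  by rewrite setDE; apply: saturatedI => //; exact: saturatedC.
have mQ : measurable (cell q p x) by exact: measurable_cell.
pose E := [set y | stopped jump f0 p p.+1 y].
have mE : measurable E by exact: (measurable_stopped jump_cell).
have -> : \int[nu]_(y in cell q p x) (total f0 p y)%:E =
    \int[nu]_(y in cell q p x) (mu ^+ count f0 p p.+1 y * u p y `^ r)%:E +
    \int[nu]_(y in cell q p x) (below f0 p p.+1 y)%:E.
  under eq_integral do rewrite EFinD.
  rewrite ge0_integralD//.
  - by move=> y _; rewrite lee_fin mulr_ge0 ?powR_ge0// exprn_ge0// ltW.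
  - apply/measurable_funTS/measurable_EFinP.
    by apply: measurable_funM => //; exact: mmu.
  - by move=> y _; rewrite lee_fin.
  - exact/measurable_funTS/measurable_EFinP/mbelow.
rewrite -[in leRHS](setUIDK (cell q p x) E) ge0_integral_setU//; last 4 first.
- exact: measurableI.
- exact: measurableD.
- exact: measurable_funTS.
- by apply/disj_setPS => y [[_ ?] []].
rewrite ge0_muleDr ?integral_ge0// addeC; apply: leeD.
  apply: aux => //; first by rewrite addSn pf.
  exact: saturated_cell.
apply: le_trans (top_moment f0 p x) _.
set g := (tail p * G p x)%R.
have g0 : (0 <= g)%R by rewrite mulr_ge0.
apply: (@le_trans _ _ (K1%:E * \int[nu]_(y in cell q p x `\` E) cst (g `^ r)%:E y)); last first.
  rewrite lee_wpmul2l ?lee_fin//; apply: le_integral_raw => y.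
    by rewrite lee_fin powR_ge0.
  move=> [yx _]; rewrite lee_fin; apply: ler_powR_base => //; first exact: ltW.
  by rewrite /g -(G_cell yx); apply: m_ge; rewrite -pf leq_addr.
rewrite integral_cst; last exact: measurableD.
have fin J : measurable J -> nu (cell q p x `&` J) \is a fin_num.
  move=> mJ; rewrite ge0_fin_numE//; apply: le_lt_trans (nu_fin p x).
  by apply: le_measure; rewrite ?inE//; exact: measurableI.
have e : nu (cell q p x) = nu (cell q p x `&` E) + nu (cell q p x `\` E).
  rewrite -measureU//; first by rewrite setUIDK.
  - exact: measurableI.
  - exact: measurableD.
  - by apply/seteqP; split => // y [[_ ?] []].
have := sparse f0 p x; rewrite -/E.
move: e; rewrite setDE -(fineK (fin _ mE)) -(fineK (fin _ (measurableC mE))) => ->.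
rewrite -EFinD -!EFinM !lee_fin.
set v1 := fine _; set v2 := fine _ => h.
have /andP[t0 t1] := theta01.
have h' : ((v1 + v2) * (1 - theta) <= v2)%R by lra.
rewrite [leRHS](_ : _ = K2 * g `^ r * (v2 / (1 - theta)))%R; last by rewrite /K1; ring.
rewrite ler_wpM2l ?(mulr_ge0 K20) ?powR_ge0//.
by rewrite ler_pdivlMr// subr_gt0.
Qed.

Lemma sparse_bound_cell x :
  \int[nu]_(y in cell q 0 x) ((\sum_(l < K.+1) a l * G l y * beta l y) `^ r)%:E
  <= (sparse_const r A theta mu D)%:E * \int[nu]_(y in cell q 0 x) (m y `^ r)%:E.
Proof.
rewrite (_ : sparse_const _ _ _ _ _ = ((1 - delta)^-1) `^ r * K1)%R//.
have c0 : (0 <= ((1 - delta)^-1) `^ r)%R by exact: powR_ge0.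
rewrite EFinM -muleA.
apply: le_trans (lee_wpmul2l _ (total_le x (add0n K))); last by rewrite lee_fin.
rewrite -ge0_integralZl//; last 3 first.
- exact: measurable_cell.
- exact/measurable_funTS/measurable_EFinP.
- by move=> y _; rewrite lee_fin.
apply: le_integral_raw => y _; first by rewrite lee_fin powR_ge0.
by rewrite -EFinM lee_fin -(big_mkord xpredT (fun l => a l * G l y * beta l y)%R); exact: sum_le_total.
Qed.

End sparse.

Lemma sparse_bound (R : realType) (r A theta D : R) :
  1 <= r -> 1 <= A -> 0 <= theta < 1 -> 0 <= D ->
  exists2 C : R, 0 <= C &
  forall d (T : measurableType d) (q : grid T) (nu : {measure set T -> \bar R})
    (K : nat) (a : nat -> R) (G beta : nat -> T -> R) (m : T -> R),
  (forall l, 0 <= a l) -> (forall l x, 0 <= G l x) ->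
  (forall l x, 0 <= beta l x) ->
  (forall l x y, q l x = q l y -> G l x = G l y) ->
  (forall l, measurable_fun setT (beta l)) ->
  (forall k x, (nu (cell q k x) < +oo)%E) ->
  (forall l x, (\int[nu]_(y in cell q l x) (beta l y `^ (2 * r))%:E
     <= D%:E * nu (cell q l x))%E) ->
  (forall f p x, (nu (cell q p x `&` [set y | stopped (jump A G) f p p.+1 y])
     <= theta%:E * nu (cell q p x))%E) ->
  measurable_fun setT m ->
  (forall l x, (l <= K)%N -> (\sum_(l <= i < K.+1) a i) * G l x <= m x) ->
  (\int[nu]_y ((\sum_(l < K.+1) a l * G l y * beta l y) `^ r)%:E
     <= C%:E * \int[nu]_y (m y `^ r)%:E)%E.
Proof.
move=> r1 A1 theta01 D0.
have /andP[t0 t1] := theta01.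
have t1p : 0 < 1 + theta by rewrite ltr_wpDr.
(* the stopping estimate is used with base mu^2, which must lie strictly between 1
   and the inverse of theta *)
pose mu := Num.sqrt (2 / (1 + theta)).
have mu2 : mu ^+ 2 = 2 / (1 + theta).
  by rewrite sqr_sqrtr// divr_ge0// ltW.
have mu1 : 1 < mu.
  rewrite -[X in X < _]sqrtr1 ltr_sqrt ?divr_gt0// ltr_pdivlMr// mul1r.
  lra.
have tm : theta * mu ^+ 2 < 1.
  by rewrite mu2 mulrA ltr_pdivrMr// mul1r; lra.
have r0 : 0 < r by exact: lt_le_trans r1.
have C0 : 0 <= sparse_const r A theta mu D.
  apply: mulr_ge0; first exact: powR_ge0.
  apply: divr_ge0; last by rewrite subr_ge0 ltW.
  rewrite mulr_ge0// ?mulr_ge0 ?powR_ge0// addr_ge0// invr_ge0 subr_ge0 ltW//.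
exists (sparse_const r A theta mu D) => //.
move=> d T q nu K a G beta m a0 G0 b0 Gq mb nufin bD sp mm mge.
have mr0 y : (0 <= (m y `^ r)%:E)%E by rewrite lee_fin powR_ge0.
have mmr : measurable_fun setT (fun y => (m y `^ r)%:E).
  by apply/measurable_EFinP; exact: measurableT_comp (measurable_powR _) mm.
have mS : measurable_fun setT
    (fun y => ((\sum_(l < K.+1) a l * G l y * beta l y) `^ r)%:E).
  apply/measurable_EFinP; apply: (measurableT_comp (measurable_powR _)).
  apply: measurable_sum => l; apply: measurable_funM => //.
  apply: measurable_funM => //.
  by apply: (@measurable_cellwise _ _ q l) => x y /Gq.
rewrite -ge0_integralZl//.
apply: (@le_integral_cells _ _ _ q nu 0) => //.
- exact/measurable_funeM.
- by move=> y; rewrite lee_fin powR_ge0.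
- by move=> y; rewrite mule_ge0.
move=> x _; rewrite ge0_integralZl//; last 2 first.
- exact: measurable_cell.
- exact: measurable_funTS.
exact: (@sparse_bound_cell _ _ _ q nu r A theta mu D K a G beta r1 A1 theta01
  mu1 tm D0 a0 G0 b0 Gq mb nufin bD sp m mm mge).
Qed.

(** * Differentiation along a grid *)

(** The hypothesis under which averages over the cells that shrink to a point recover
    the function there. *)
Definition generating d (T : measurableType d) (q : grid T) :=
  forall A : set T, measurable A -> <<s [set S | exists k, saturated q k S] >> A.

Section differentiation.
Context d (T : measurableType d) (R : realType).
Variables (q : grid T) (mu : {measure set T -> \bar R}).
Hypothesis gen : generating q.
Hypothesis mu_fin : forall k x, (mu (cell q k x) < +oo)%E.
Local Open Scope ereal_scope.

Let symdiff (A B : set T) := (A `\` B) `|` (B `\` A).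

Let msymdiff A B : measurable A -> measurable B -> measurable (symdiff A B).
Proof. by move=> mA mB; apply: measurableU; exact: measurableD. Qed.

Let approximable (Q : set T) : set (set T) := [set A | measurable A /\
  forall e : R, (0 < e)%R -> exists k S, saturated q k S /\
    mu (Q `&` symdiff A S) <= e%:E].

Let le_measureI (A B : set T) : measurable A -> measurable B -> A `<=` B -> mu A <= mu B.
Proof. by move=> mA mB AB; apply: le_measure; rewrite ?inE. Qed.

Let approximableU Q A B : measurable Q ->
  approximable Q A -> approximable Q B -> approximable Q (A `|` B).
Proof.
move=> mQ [mA hA] [mB hB]; split; first exact: measurableU.
move=> e e0; have e2 : (0 < e / 2)%R by rewrite divr_gt0.
have [k [S [sS hS]]] := hA _ e2; have [l [S' [sS' hS']]] := hB _ e2.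
have s1 : saturated q (maxn k l) S by apply: saturated_le sS; exact: leq_maxl.
have s2 : saturated q (maxn k l) S' by apply: saturated_le sS'; exact: leq_maxr.
have mS : measurable S by exact: saturated_measurable sS.
have mS' : measurable S' by exact: saturated_measurable sS'.
exists (maxn k l), (S `|` S'); split.
  by move=> x y xy [Sx|Sx]; [left; exact: s1 Sx|right; exact: s2 Sx].
apply: (@le_trans _ _ (mu ((Q `&` symdiff A S) `|` (Q `&` symdiff B S')))).
  apply: le_measureI.
  - by apply: measurableI => //; apply: msymdiff; exact: measurableU.
  - by apply: measurableU; apply: measurableI => //; exact: msymdiff.
  move=> x [Qx]; rewrite /symdiff => -[[[Ax|Bx] /not_orP[nS nS']]|[[Sx|Sx] /not_orP[nA nB]]].
  - by left; split => //; left.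
  - by right; split => //; left.
  - by left; split => //; right.
  - by right; split => //; right.
apply: le_trans (measureU2 _ _ _) _.
- by apply: measurableI => //; exact: msymdiff.
- by apply: measurableI => //; exact: msymdiff.
by rewrite [e]splitr EFinD leeD.
Qed.

(** Sets that differ little from a union of cells form a sigma-algebra. *)
Lemma measurable_approx_cells p x A (e : R) : measurable A -> (0 < e)%R ->
  exists k S, saturated q k S /\
    mu (cell q p x `&` ((A `\` S) `|` (S `\` A))) <= e%:E.
Proof.
set Q := cell q p x; move=> mA e0.
have mQ : measurable Q by exact: measurable_cell.
have fQ B : measurable B -> mu (Q `&` B) < +oo.
  move=> mB; apply: le_lt_trans (mu_fin p x).
  by apply: le_measureI => //; exact: measurableI.
suff H : <<s [set S | exists k, saturated q k S] >> `<=` approximable Q.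
  by have [_ /(_ e e0)] := H _ (gen mA).
apply: smallest_sub; last first.
  move=> S [k sS]; split; first exact: saturated_measurable sS.
  move=> {}e {}e0; exists k, S; split => //.
  by rewrite /symdiff setDv setU0 setI0 measure0 lee_fin ltW.
split.
- split => // {}e {}e0; exists 0%N, set0; split => //.
  by rewrite /symdiff setDv setU0 setI0 measure0 lee_fin ltW.
- move=> B [mB hB]; rewrite setTD; split; first exact: measurableC.
  move=> e' /hB[k [S [sS hS]]]; exists k, (~` S).
  split; first exact: saturatedC.
  suff -> : symdiff (~` B) (~` S) = symdiff B S by [].
  by rewrite /symdiff !setDE !setCK setUC (setIC _ B) (setIC _ S).
- move=> F hF.
  have mF i : measurable (F i) by have [] := hF i.
  have mUF : measurable (\bigcup_i F i) by exact: bigcupT_measurable.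
  split => // {}e {}e0; have e2 : (0 < e / 2)%R by rewrite divr_gt0.
  pose P n := \big[setU/set0]_(i < n) F i.
  have mP n : measurable (P n) by exact: bigsetU_measurable.
  have aP n : approximable Q (P n).
    rewrite /P; elim/big_ind: _ => [|U V|i _]; last exact: hF.
      split => // e' e0'; exists 0%N, set0; split => //.
      by rewrite /symdiff setDv setU0 setI0 measure0 lee_fin ltW.
    exact: approximableU.
  have [n hn] : exists n, mu (Q `&` (\bigcup_i F i `\` P n)) <= (e / 2)%:E.
    pose V n := Q `&` (\bigcup_i F i `\` P n).
    have mV n : measurable (V n) by apply: measurableI => //; exact: measurableD.
    have : mu (V n) @[n --> \oo] --> mu (\bigcap_n V n).
      apply: nonincreasing_cvg_mu => //.
      - by apply: fQ; exact: measurableD.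
      - exact: bigcapT_measurable.
      - move=> i j ij; apply/subsetPset => y [Qy [Uy nPy]]; split => //; split => //.
        by apply: contra_not nPy; exact: subset_bigsetU.
    rewrite (_ : \bigcap_n V n = set0) ?measure0; last first.
      apply/seteqP; split => // y Vy.
      have [_ [[i _ Fy] _]] := Vy 0%N I; have [_ [_ ]] := Vy i.+1 I.
      by apply; rewrite /P big_ord_recr/=; right.
    move/fine_cvgP => [_ /cvgrPdist_le /(_ _ e2) [n _ hn]].
    exists n; have := hn n (leqnn n); rewrite /= sub0r normrN ger0_norm ?fine_ge0//.
    rewrite -lee_fin fineK// ge0_fin_numE//.
    by apply: fQ; exact: measurableD.
  have [_ /(_ _ e2)[k [S [sS hS]]]] := aP n; exists k, S; split => //.
  have mS : measurable S by exact: saturated_measurable sS.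
  apply: (@le_trans _ _ (mu ((Q `&` (\bigcup_i F i `\` P n)) `|`
                             (Q `&` symdiff (P n) S)))).
    apply: le_measureI.
    - by apply: measurableI => //; apply: msymdiff.
    - apply: measurableU; apply: measurableI => //; last exact: msymdiff.
      exact: measurableD.
    move=> y [Qy [[Fy nSy]|[Sy nFy]]].
      have [Py|nPy] := pselect (P n y); last by left.
      by right; split => //; left.
    right; split => //; right; split => // Py; apply: nFy.
    by move: Py; apply: (@bigsetU_bigcup _ F).
  apply: le_trans (measureU2 _ _ _) _.
  - by apply: measurableI => //; exact: measurableD.
  - by apply: measurableI => //; exact: msymdiff.
  by rewrite [e]splitr EFinD leeD.
Qed.

Variable h : T -> R.
Hypothesis h0 : forall x, (0 <= h x)%R.
Hypothesis mh : measurable_fun setT h.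

Let mhE : measurable_fun setT (fun x => (h x)%:E).
Proof. exact/measurable_EFinP. Qed.

Let low lam k : set T :=
  [set y | \int[mu]_(z in cell q k y) (h z)%:E <= lam%:E * mu (cell q k y)].

Let sat_low lam k : saturated q k (low lam k).
Proof. by move=> y z yz; rewrite /low/= (eq_cell yz). Qed.

(** If h exceeded lam on a set F of positive measure where all cell averages are
    at most lam, this would contradict the bound of the averages on a union of
    cells that approximates F. *)
Lemma le_of_averages_le (lam : R) p x : (0 <= lam)%R ->
  exists N, [/\ measurable N, mu N = 0 & forall y, cell q p x y -> ~ N y ->
    (forall f, \int[mu]_(z in cell q (p + f) y) (h z)%:E
       <= lam%:E * mu (cell q (p + f) y)) -> (h y <= lam)%R].
Proof.
move=> lam0; set Q := cell q p x.
have mQ : measurable Q by exact: measurable_cell.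
have mlow k : measurable (low lam k) by exact: saturated_measurable (@sat_low lam k).
pose E := Q `&` \bigcap_f low lam (p + f).
have mE : measurable E by apply: measurableI => //; exact: bigcapT_measurable.
pose F i := E `&` [set y | (lam + i.+1%:R^-1 <= h y)%R /\ (h y <= i%:R)%R].
have mset (u v : R) : measurable [set y | (u <= h y)%R /\ (h y <= v)%R].
  have := mh measurableT (measurable_itv `[u, v]); rewrite setTI.
  rewrite (_ : _ @^-1` _ = [set y | (u <= h y)%R /\ (h y <= v)%R])//.
  by apply/seteqP; split => y; rewrite /preimage/= in_itv/= => /andP.
have mF i : measurable (F i) by exact: measurableI.
have fQ B : measurable B -> mu (Q `&` B) < +oo.
  move=> mB; apply: le_lt_trans (mu_fin p x).
  by apply: le_measureI => //; exact: measurableI.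
suff F0 i : mu (F i) = 0.
  exists (\bigcup_i F i); split => //; first exact: bigcupT_measurable.
    exact: null_bigcup.
  move=> y Qy nFy hy; rewrite leNgt; apply/negP => lamh; apply: nFy.
  have [i hi] : exists i : nat, (lam + i.+1%:R^-1 <= h y)%R /\ (h y <= i%:R)%R.
    have hl : (0 < h y - lam)%R by rewrite subr_gt0.
    pose i := maxn (Num.truncn (h y)).+1 (Num.truncn (h y - lam)^-1).+1.
    exists i; split.
      rewrite -lerBrDl -[leRHS]invrK lef_pV2 ?posrE ?invr_gt0// ltW//.
      apply: lt_le_trans (truncnS_gt _) _; rewrite ler_nat.
      by rewrite leqW// leq_maxr.
    apply: ltW; apply: lt_le_trans (truncnS_gt _) _; rewrite ler_nat.
    exact: leq_maxl.
  exists i => //; split => //; split => // f _; exact: hy.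
have FQ : F i `<=` Q by move=> y [[]].
have FE : F i = Q `&` F i by rewrite setIidr.
have Ffin : mu (F i) \is a fin_num by rewrite ge0_fin_numE// FE fQ.
have key (e : R) : (0 < e)%R ->
    (fine (mu (F i)) * i.+1%:R^-1 <= (lam + i%:R) * e)%R.
  move=> e0; have [k [S [sS hS]]] := @measurable_approx_cells p x (F i) e (mF i) e0.
  rewrite -/Q in hS.
  pose l := maxn p k.
  have sS' : saturated q l S by apply: saturated_le sS; exact: leq_maxr.
  have mS : measurable S by exact: saturated_measurable sS.
  pose S' := (S `&` Q) `&` low lam l.
  have sat' : saturated q l S'.
    apply: saturatedI; last exact: sat_low.
    by apply: saturatedI => //; apply: saturated_cell; exact: leq_maxl.
  have mS' : measurable S' by exact: saturated_measurable sat'.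
  have FSS' : F i `&` S `<=` S'.
    move=> y [Fy Sy]; split; first by split => //; exact: FQ.
    have [[_ Elow] _] := Fy; have := Elow (l - p)%N I.
    by rewrite subnKC// leq_maxl.
  have mFD : measurable (F i `\` S) by exact: measurableD.
  have mSF : measurable (S' `\` F i) by exact: measurableD.
  have mD : measurable (Q `&` (F i `\` S `|` S `\` F i)).
    by apply: measurableI => //; apply: measurableU; exact: measurableD.
  have h1 : mu (F i `\` S) <= e%:E.
    apply: le_trans hS; apply: le_measureI => // y [Fy nSy].
    by split; [exact: FQ|left].
  have h2 : mu (S' `\` F i) <= e%:E.
    apply: le_trans hS; apply: le_measureI => // y [[[Sy Qy] _] nFy].
    by split => //; right.
  have S'fin : mu S' \is a fin_num.
    rewrite ge0_fin_numE// (_ : S' = Q `&` S'); first exact: fQ.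
    by rewrite setIidr// => y [[]].
  have I1 : \int[mu]_(y in S') (h y)%:E <= lam%:E * mu S'.
    rewrite -integral_cst//; apply: (@le_integral_cells _ _ _ q mu l) => // y [_ Sy].
    by rewrite integral_cst//; exact: measurable_cell.
  have I2 : (lam + i.+1%:R^-1)%:E * mu (F i) <= \int[mu]_(y in F i) (h y)%:E.
    rewrite -integral_cst//; apply: le_integral_raw => y; last first.
      by move=> [_ [hy _]]; rewrite lee_fin.
    by rewrite lee_fin addr_ge0.
  have I3 : \int[mu]_(y in F i) (h y)%:E <= lam%:E * mu S' + (i%:R * e)%:E.
    rewrite -[in leLHS](setUIDK (F i) S) ge0_integral_setU//; last 4 first.
    - exact: measurableI.
    - exact: measurable_funTS.
    - by move=> y _; rewrite lee_fin.
    - by apply/disj_setPS => y [[_ ?] []].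
    apply: leeD.
      apply: le_trans I1; apply: ge0_subset_integral => //.
      - exact: measurableI.
      - exact: measurable_funTS.
      - by move=> y _; rewrite lee_fin.
    apply: (@le_trans _ _ (\int[mu]_(y in F i `\` S) (cst i%:R%:E) y)).
      apply: le_integral_raw => y; first by rewrite lee_fin.
      by move=> [[_ [_ hy]] _]; rewrite lee_fin.
    by rewrite integral_cst// EFinM lee_wpmul2l// lee_fin.
  have I4 : mu S' <= mu (F i) + e%:E.
    apply: (@le_trans _ _ (mu (F i `|` S' `\` F i))).
      apply: le_measureI => //; first exact: measurableU.
      move=> y Sy; have [Fy|nFy] := pselect (F i y); [by left|by right].
    apply: le_trans (measureU2 _ _ _) _ => //.
    by rewrite leeD2l.
  have := le_trans I2 I3.
  move: I4; rewrite -(fineK Ffin) -(fineK S'fin) -EFinD -!EFinM -EFinD !lee_fin.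
  set v := fine _; set v' := fine _ => I4.
  move/(ler_wpM2l lam0) : I4; move: (i.+1%:R^-1)%R => t {}I4 {}I3 /=.
  lra.
have v0 : (0 <= fine (mu (F i)))%R by exact: fine_ge0.
apply/eqP; rewrite -(fineK Ffin) eqe eq_le v0 andbT.
rewrite leNgt; apply/negP => vp.
pose c := (lam + i%:R + 1)%R.
have c0 : (0 < c)%R by rewrite ltr_wpDl// addr_ge0.
have i0 : (0 < i.+1%:R^-1 :> R)%R by rewrite invr_gt0.
have := key (fine (mu (F i)) * i.+1%:R^-1 / (2 * c))%R.
rewrite divr_gt0 ?mulr_gt0// => /(_ isT).
apply/negP; rewrite -ltNge.
set w := (fine _ * _)%R.
have w0 : (0 < w)%R by rewrite mulr_gt0.
rewrite mulrCA -[ltRHS]mulr1 ltr_pM2l// ltr_pdivrMr ?mulr_gt0// mul1r.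
have : (0 <= lam + i%:R)%R by rewrite addr_ge0.
rewrite /c; lra.
Qed.

End differentiation.

(** * The John-Nirenberg inequality for a weighted measure *)

Section john_nirenberg.
Context d (T : measurableType d) (R : realType).
Variables (q : grid T) (mu nu : {measure set T -> \bar R}).
Variables (M alpha theta N eta : R) (b : T -> R).
Hypothesis gen : generating q.
Local Open Scope ereal_scope.
Hypothesis mu_fin : forall k x, mu (cell q k x) < +oo.
Hypothesis mu_gt0 : forall k x, 0 < mu (cell q k x).
Hypothesis nu_fin : forall k x, nu (cell q k x) < +oo.
Hypothesis nu_mu : forall E, measurable E -> mu E = 0 -> nu E = 0.
Hypothesis M1 : (1 <= M)%R.
Hypothesis doubling : forall k x,
  mu (cell q k x) <= M%:E * mu (cell q k.+1 x).
Hypothesis alpha01 : (0 < alpha <= 1)%R.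
Hypothesis small : forall k x E, measurable E -> E `<=` cell q k x ->
  mu E <= alpha%:E * mu (cell q k x) -> nu E <= theta%:E * nu (cell q k x).
Hypothesis eta1 : (1 < eta)%R.
Hypothesis theta_eta : (theta * eta < 1)%R.
Hypothesis N0 : (0 < N)%R.
Hypothesis mb : measurable_fun setT b.
Hypothesis ib : forall k x, \int[mu]_(y in cell q k x) `|(b y)%:E| < +oo.

Definition average k x : R :=
  fine (\int[mu]_(y in cell q k x) (b y)%:E) / fine (mu (cell q k x)).

Hypothesis osc : forall k x,
  \int[mu]_(y in cell q k x) (`|b y - average k x|)%:E <= N%:E * mu (cell q k x).

Let muE k x : mu (cell q k x) = (fine (mu (cell q k x)))%:E.
Proof. by rewrite fineK// ge0_fin_numE. Qed.

Let fmu0 k x : (0 < fine (mu (cell q k x)))%R.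
Proof. by rewrite -lte_fin -muE. Qed.

Let average_cell k x y : q k x = q k y -> average k x = average k y.
Proof. by move=> xy; rewrite /average (eq_cell xy). Qed.

Let mdev c : measurable_fun setT (fun y => (`|b y - c|)%:E).
Proof.
apply/measurable_EFinP; apply: (measurableT_comp (@normr_measurable R setT)).
exact: measurable_funB.
Qed.

Let average_close k x (c e : R) :
  \int[mu]_(y in cell q k x) (`|b y - c|)%:E <= e%:E * mu (cell q k x) ->
  (`|average k x - c| <= e)%R.
Proof.
move=> H; have mQ : measurable (cell q k x) by exact: measurable_cell.
have ibE : mu.-integrable (cell q k x) (EFin \o b).
  apply/integrableP; split; last exact: ib.
  by apply/measurable_funTS/measurable_EFinP.
have icE : mu.-integrable (cell q k x) (EFin \o cst c).
  apply/integrableP; split; first by apply/measurable_EFinP; exact: measurable_cst.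
  by rewrite /= integral_cst// muE ltry.
have e1 : \int[mu]_(y in cell q k x) (b y - c)%:E =
    \int[mu]_(y in cell q k x) (b y)%:E - c%:E * mu (cell q k x).
  rewrite -integral_cst// -integralB_EFin//.
have fb : \int[mu]_(y in cell q k x) (b y)%:E \is a fin_num.
  exact: integrable_fin_num.
have := le_trans (le_trans (@abse_integral_le_raw _ _ _ mu (cell q k x)
  (fun y => (b y - c)%:E)) (lexx _)) H.
rewrite e1 -(fineK fb) muE -!EFinM -EFinB lee_fin.
rewrite /average; set i := fine _; set m := fine _.
have m0 : (0 < m)%R by exact: fmu0.
have -> : (i - c * m = (i / m - c) * m)%R by rewrite mulrBl divfK// gt_eqF.
by rewrite normrM (gtr0_norm m0) ler_pM2r.
Qed.

Let kappa := (M * (alpha^-1 * N))%R.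

Let lam0 : (0 < alpha^-1 * N)%R.
Proof. by rewrite mulr_gt0// invr_gt0; case/andP: alpha01. Qed.

Let kappa_ge : (alpha^-1 * N <= kappa)%R.
Proof. by rewrite /kappa ler_peMl// ltW. Qed.

Let N_le : (N <= alpha^-1 * N)%R.
Proof.
by case/andP: alpha01 => a0 a1; rewrite ler_peMl ?(ltW N0)// invf_ge1.
Qed.

Let kappa0 : (0 < kappa)%R. Proof. exact: lt_le_trans kappa_ge. Qed.

Let stop p j x : bool :=
  (alpha^-1 * N)%:E * mu (cell q j x) <
  \int[mu]_(y in cell q j x) (`|b y - average p x|)%:E.

Let stop_cell p j x y : (p < j)%N -> q j x = q j y -> stop p j x = stop p j y.
Proof.
by move=> pj xy; rewrite /stop (eq_cell xy) (average_cell (idx_le (ltnW pj) xy)).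
Qed.

Let sub_dev j k x c : (j <= k)%N ->
  \int[mu]_(y in cell q k x) (`|b y - c|)%:E <=
  \int[mu]_(y in cell q j x) (`|b y - c|)%:E.
Proof.
move=> jk; apply: ge0_subset_integral => //; try exact: measurable_cell.
- exact: measurable_funTS.
- exact: cellS.
Qed.

(** The deviation from the average over a principal cell changes by at most
    kappa when the principal cell is replaced by the next one. *)
Let dev_le_count f p j x : (p <= j)%N ->
  \int[mu]_(y in cell q j x) (`|b y - average p x|)%:E
    <= (alpha^-1 * N)%:E * mu (cell q j x) ->
  \int[mu]_(y in cell q (j + f) x) (`|b y - average p x|)%:E
    <= (kappa * (1 + stop_count stop f p j.+1 x)%:R)%:E * mu (cell q (j + f) x).
Proof.
elim: f p j => [|f IH] p j pj H.
  rewrite addn0 in H *; apply: le_trans H _.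
  by rewrite lee_wpmul2r// lee_fin /= addn0 mulr1.
rewrite addnS -addSn /=; case: ifPn => [|]; last first.
  by rewrite /stop -leNgt => H'; apply: IH => //; exact: leqW.
move=> _.
have Hj : \int[mu]_(y in cell q j.+1 x) (`|b y - average p x|)%:E
    <= kappa%:E * mu (cell q j.+1 x).
  apply: le_trans (sub_dev _ _ (leqnSn j)) _; apply: le_trans H _.
  have -> : kappa = ((alpha^-1 * N) * M)%R by rewrite /kappa mulrC.
  rewrite (EFinM _ M) -muleA lee_wpmul2l//.
  by rewrite lee_fin ltW.
have close := average_close Hj.
have Hjj : \int[mu]_(y in cell q j.+1 x) (`|b y - average j.+1 x|)%:E
    <= (alpha^-1 * N)%:E * mu (cell q j.+1 x).
  by apply: le_trans (osc _ _) _; rewrite lee_wpmul2r// lee_fin.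
have := IH j.+1 j.+1 (leqnn _) Hjj.
set n := stop_count _ _ _ _ _ => H2.
have mQ : measurable (cell q (j.+1 + f) x) by exact: measurable_cell.
apply: (@le_trans _ _ (\int[mu]_(y in cell q (j.+1 + f) x)
    ((`|b y - average j.+1 x|)%:E + kappa%:E))).
  apply: le_integral_raw => y _; first by rewrite lee_fin.
  rewrite -EFinD lee_fin.
  rewrite (_ : b y - average p x =
    (b y - average j.+1 x) + (average j.+1 x - average p x))%R; last by ring.
  by apply: le_trans (ler_normD _ _) _; rewrite lerD2l.
rewrite ge0_integralD//; [|exact: measurable_funTS|by move=> y _; rewrite lee_fin ltW].
rewrite integral_cst//.
apply: le_trans (leeD H2 (lexx _)) _.
rewrite muE -!EFinM -EFinD lee_fin -mulrDl ler_wpM2r ?(ltW (fmu0 _ _))//.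
by rewrite addnS -[(_.+1)%:R]natr1 mulrDr mulr1.
Qed.

Let sparse f p x :
  nu (cell q p x `&` [set y | stopped stop f p p.+1 y]) <= theta%:E * nu (cell q p x).
Proof.
have a0 : (0 < alpha)%R by case/andP: alpha01.
have mQ : measurable (cell q p x) by exact: measurable_cell.
have mst : measurable [set y | stopped stop f p p.+1 y].
  exact: (measurable_stopped stop_cell).
apply: small => //; first exact: measurableI.
have : (alpha^-1 * N)%:E * mu (cell q p x `&` [set y | stopped stop f p p.+1 y])
    <= N%:E * mu (cell q p x).
  apply: le_trans (osc p x).
  apply: (@stopped_weak_type _ _ _ q stop stop_cell mu) => //.
  - exact: ltW.
  - exact: saturated_cell.
  move=> i y pi yx; rewrite /stop => /ltW.
  by rewrite (average_cell yx).
have fin : mu (cell q p x `&` [set y | stopped stop f p p.+1 y]) \is a fin_num.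
  rewrite ge0_fin_numE//; apply: le_lt_trans (mu_fin p x).
  by apply: le_measure; rewrite ?inE//; exact: measurableI.
rewrite -(fineK fin) muE -!EFinM !lee_fin => h.
rewrite -(ler_pM2l lam0) (le_trans h)// mulrA.
by rewrite (_ : alpha^-1 * N * alpha = N)%R// mulrAC mulVf ?mul1r// gt_eqF.
Qed.

(** The averages of the deviation over finer and finer cells are controlled by the
    number of stops, which has exponential moments; by differentiation so is the
    deviation itself. *)
Lemma john_nirenberg p x :
  \int[nu]_(y in cell q p x)
     (eta `^ (`|b y - average p x| / kappa))%:E
  <= (eta / (1 - theta * eta))%:E * nu (cell q p x).
Proof.
have eta0 : (0 < eta)%R by exact: lt_trans eta1.
have mQ : measurable (cell q p x) by exact: measurable_cell.
pose c f y := stop_count stop f p p.+1 y.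
have mc f : measurable_fun setT (fun y => (eta ^+ (c f y).+1)%:E).
  apply: (@measurable_cellwise _ _ q (p.+1 + f)) => y z yz.
  by rewrite /c (stop_count_cellwise stop_cell (k := (p.+1 + f)%N) _ _ yz)//; exact: leqW.
pose L y := limn (fun f => (eta ^+ (c f y).+1)%:E).
have ndc y : {homo (fun f => (eta ^+ (c f y).+1)%:E) : a b / (a <= b)%N >-> a <= b}.
  move=> f f' ff'; rewrite lee_fin ler_weXn2l ?ltW// ltnS.
  exact: stop_count_le.
have c0 f y : 0 <= (eta ^+ (c f y).+1)%:E by rewrite lee_fin exprn_ge0// ltW.
have L0 y : 0 <= L y.
  apply: lime_ge; first exact: ereal_nondecreasing_is_cvgn.
  exact: nearW.
have LE f y : (eta ^+ (c f y).+1)%:E <= L y.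
  apply: lime_ge; first exact: ereal_nondecreasing_is_cvgn.
  by near=> g; apply: ndc; near: g; exists f.
have H n := @le_of_averages_le _ _ _ q mu gen mu_fin
  (fun y => `|b y - average p x|%R) (fun y => normr_ge0 _)
  (proj1 (measurable_EFinP _ _) (mdev _)) (kappa * (1 + n)%:R)%R p x
  (mulr_ge0 (ltW kappa0) (ler0n _ _)).
have /choice[Z HZ] := H.
have mUZ : measurable (\bigcup_n Z n).
  by apply: bigcupT_measurable => n; have [] := HZ n.
have UZ0 : mu (\bigcup_n Z n) = 0.
  by apply: null_bigcup => n; have [] := HZ n.
apply: (@le_trans _ _ (\int[nu]_(y in cell q p x) L y)).
  apply: (@le_integral_off_null _ _ _ _ _ (\bigcup_n Z n)) => //.
  - exact: nu_mu.
  - by move=> y _; rewrite lee_fin powR_ge0.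
  move=> y yx nZ.
  suff [f hf] : exists f, (`|b y - average p x| <= kappa * (1 + c f y)%:R)%R.
    apply: le_trans (LE f y); rewrite lee_fin -powR_mulrn ?(ltW eta0)//.
    by apply: ler_powR; [exact: ltW|rewrite ler_pdivrMr// mulrC -add1n].
  have osc' : \int[mu]_(z in cell q p y) (`|b z - average p y|)%:E
      <= (alpha^-1 * N)%:E * mu (cell q p y).
    by apply: le_trans (osc p y) _; rewrite lee_wpmul2r// lee_fin.
  have dev f := dev_le_count f (leqnn p) osc'.
  have [[f hf]|bnd] := pselect (exists f, (`|b y - average p x| <= kappa * (1 + c f y)%:R)%R).
    by exists f.
  have bc f : (c f y <= Num.truncn (`|b y - average p x| / kappa)%R)%N.
    rewrite truncn_ge_nat ?divr_ge0// ?(ltW kappa0)// ler_pdivlMr// mulrC.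
    have : (kappa * (1 + c f y)%:R < `|b y - average p x|)%R.
      by rewrite ltNge; apply/negP => h; apply: bnd; exists f.
    rewrite natrD mulrDr mulr1; have := kappa0; lra.
  set m := Num.truncn _ in bc.
  have [f fmax] : exists f, forall g, (c g y <= c f y)%N.
    pose P n := `[< exists f, c f y = n >].
    have eP : exists n, P n by exists (c 0%N y); apply/asboolP; exists 0%N.
    have uP n : P n -> (n <= m)%N by move=> /asboolP[f <-].
    have [n /asboolP[f fn] nmax] := @ex_maxnP P m eP uP.
    by exists f => g; rewrite fn; apply: nmax; apply/asboolP; exists g.
  exists f; have [_ _ /(_ y yx)] := HZ (c f y); apply.
    by move=> Zy; apply: nZ; exists (c f y).
  move=> g; rewrite -(average_cell yx).
  apply: le_trans (dev g) _; rewrite lee_wpmul2r// lee_fin.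
  by rewrite ler_wpM2l ?(ltW kappa0)// ler_nat leq_add2l; exact: fmax.
rewrite monotone_convergence//; last by move=> f; exact: measurable_funTS.
apply: lime_le.
  apply: ereal_nondecreasing_is_cvgn => f f' ff'.
  apply: le_integral_raw => y _ //; exact: ndc.
apply: nearW => f.
under eq_integral do rewrite exprS EFinM.
rewrite ge0_integralZl//; last 3 first.
- apply: measurable_funTS.
  apply: (@measurable_cellwise _ _ q (p.+1 + f)) => y z yz.
  by rewrite /c (stop_count_cellwise stop_cell (k := (p.+1 + f)%N) _ _ yz)//; exact: leqW.
- by move=> y _; rewrite lee_fin exprn_ge0// ltW.
- by rewrite lee_fin ltW.
rewrite EFinM -muleA lee_wpmul2l ?lee_fin ?(ltW eta0)//.
exact: (stop_count_exp_integrable stop_cell (ltW eta1) theta_eta nu_fin sparse).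
Unshelve. all: by end_near. Qed.

End john_nirenberg.

(** * Lebesgue measure on powers *)

Section product_power.
Context d (T : measurableType d) (R : realType).
Variable mu : {sigma_finite_measure set T -> \bar R}.
Local Open Scope ereal_scope.

Lemma emeasurable_prod d' (T' : measurableType d') (I : Type) (s : seq I)
    (F : I -> T' -> \bar R) : (forall i, measurable_fun setT (F i)) ->
  measurable_fun setT (fun x => \prod_(i <- s) F i x).
Proof.
move=> mF; elim: s => [|i s IH].
  rewrite (_ : (fun _ => _) = cst 1); first exact: measurable_cst.
  by apply/funext => x; rewrite big_nil.
rewrite (_ : (fun _ => _) = (fun x => F i x * \prod_(i <- s) F i x)).
  exact: emeasurable_funM.
by apply/funext => x; rewrite big_cons.
Qed.

(** Tonelli's theorem, one coordinate at a time. *)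
Lemma integral_product_power n (F : 'I_n -> T -> \bar R) :
  (forall j, measurable_fun setT (F j)) -> (forall j x, 0 <= F j x) ->
  \int[product_power mu n]_t (\prod_j F j (tnth t j)) = \prod_j \int[mu]_x F j x.
Proof.
elim: n F => [|n IH] F mF F0.
  rewrite big_ord0; under eq_integral do rewrite big_ord0.
  by rewrite integral_cst// mul1e/= diracT.
have mP k (G : 'I_k -> T -> \bar R) : (forall j, measurable_fun setT (G j)) ->
    measurable_fun setT (fun t : k.-tuple T => \prod_j G j (tnth t j)).
  move=> mG; apply: emeasurable_prod => i.
  by apply: (measurableT_comp (mG i)); exact: measurable_tnth.
have P0 k (G : 'I_k -> T -> \bar R) : (forall j x, 0 <= G j x) ->
    forall t : k.-tuple T, 0 <= \prod_j G j (tnth t j).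
  by move=> G0 t; exact: prode_ge0.
rewrite [LHS](_ : _ = \int[pushforward (mu \x product_power mu n)
    (@tuple_cons _ T n)]_t (\prod_j F j (tnth t j)))//.
rewrite ge0_integral_pushforward//; last 3 first.
- exact: measurable_tuple_cons.
- exact: mP.
- by move=> t _; exact: P0.
rewrite preimage_setT fubini_tonelli1; last 2 first.
- by apply: measurableT_comp; [exact: mP|exact: measurable_tuple_cons].
- by move=> z; exact: P0.
rewrite big_ord_recl /fubini_F /=.
set I := \prod_(i < n) _.
transitivity (\int[mu]_x (F ord0 x * I)); last first.
  rewrite ge0_integralZr// /I.
  by apply: prode_ge0 => i _; exact: integral_ge0.
apply: eq_integral => x _; rewrite /I.
rewrite -(IH (fun j => F (lift ord0 j)))// -ge0_integralZl//; last 2 first.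
- exact: (mP _ (fun j => F (lift ord0 j))).
- by move=> t _; exact: (P0 _ (fun j => F (lift ord0 j))).
apply: eq_integral => t _; rewrite big_ord_recl; congr (_ * _).
by apply: eq_bigr => j _; rewrite !(tnth_nth x).
Qed.

Lemma tnth_tuple_cons_lift n (x : T) (t : n.-tuple T) (k : 'I_n) :
  tnth (tuple_cons (x, t)) (lift ord0 k) = tnth t k.
Proof. by rewrite !(tnth_nth x). Qed.

(** By induction on the number of coordinates, slicing along the first one. It is used
    for y |-> x - y, first on the line and then on the rows of a matrix. *)
Lemma product_power_preserving n (g : 'I_n -> T -> T) :
  (forall j, measurable_fun setT (g j)) ->
  (forall j A, measurable A -> mu (g j @^-1` A) = mu A) ->
  let G := fun t : n.-tuple T => [tuple g j (tnth t j) | j < n] in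
  measurable_fun setT G /\
  (forall A, measurable A ->
     product_power mu n (G @^-1` A) = product_power mu n A).
Proof.
move=> mg mug G; split.
  apply/measurable_fun_tnthP => j.
  rewrite (_ : _ \o _ = fun t : n.-tuple T => g j (tnth t j)).
    by apply: (measurableT_comp (mg j)); exact: measurable_tnth.
  by apply/funext => t /=; rewrite tnth_mktuple.
elim: n g mg mug @G => [|n IH] g mg mug G A mA.
  rewrite (_ : G @^-1` A = A)//; apply/seteqP; split => t; rewrite /preimage/=;
  by rewrite (tuple0 (G t)) (tuple0 t).
pose g' j := g (lift ord0 j).
have {}IH := IH g' (fun j => mg _) (fun j => mug _).
pose G' := fun t : n.-tuple T => [tuple g' j (tnth t j) | j < n].
have mC : measurable (@tuple_cons _ T n @^-1` A).
  by rewrite -[X in measurable X]setTI; exact: measurable_tuple_cons.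
rewrite [LHS](_ : _ = (mu \x product_power mu n)
  (@tuple_cons _ T n @^-1` (G @^-1` A)))//.
rewrite [RHS](_ : _ = (mu \x product_power mu n) (@tuple_cons _ T n @^-1` A))//.
rewrite /product_measure1.
set B := @tuple_cons _ T n @^-1` A.
pose psi x := product_power mu n (xsection B x).
have mpsi : measurable_fun setT psi by exact: measurable_fun_xsection.
transitivity (\int[mu]_x psi (g ord0 x)).
  apply: eq_integral => x _; rewrite /= /psi.
  rewrite -(IH (xsection B (g ord0 x))); last exact: measurable_xsection.
  congr (product_power mu n _); apply/seteqP.
  have e t : G (tuple_cons (x, t)) = tuple_cons (g ord0 x, G' t).
    apply: eq_from_tnth => j; rewrite tnth_mktuple.
    have [k ->|->] := unliftP ord0 j.
      rewrite !tnth_tuple_cons_lift tnth_mktuple.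
      by [].
    by rewrite !(tnth_nth x)/=.
  split => t; rewrite /xsection/= !inE /B /preimage/= e.
    by [].
  by [].
rewrite [LHS](_ : _ = \int[pushforward mu (g ord0)]_x psi x).
  apply: eq_measure_integral => C mC' _; exact: mug.
by rewrite ge0_integral_pushforward// => x _; exact: measure_ge0.
Qed.

End product_power.

(** * Lebesgue measure on Euclidean space *)

Section lebesgue_euclidean.
Context (R : realType).
Local Open Scope ereal_scope.

Lemma lebesgue_measure_reflect (c : R) (A : set (measurableTypeR R)) : measurable A ->
  @lebesgue_measure R ((fun t => c - t)%R @^-1` A) = lebesgue_measure A.
Proof.
move=> mA.
pose f := (fun t : measurableTypeR R => (c - t)%R : measurableTypeR R).
have mf : measurable_fun setT f by exact: measurable_funB.
pose F : {mfun measurableTypeR R >-> measurableTypeR R} :=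
  HB.pack f (isMeasurableFun.Build _ _ _ _ _ mf).
suff H : forall X, ocitv X -> lebesgue_measure X = pushforward (@lebesgue_measure R) F X.
  exact/esym/(lebesgue_measure_unique H).
move=> _ [[a b]] _ <-; rewrite /pushforward.
rewrite -[F @^-1` _]/((fun t => c - t)%R @^-1` `]a, b]%classic).
have -> : (fun t => c - t)%R @^-1` `]a, b]%classic = `[(c - b)%R, (c - a)%R[%classic.
  apply/seteqP; split => t; rewrite /preimage/= !in_itv/= => /andP[h1 h2];
  by apply/andP; split; lra.
rewrite !lebesgue_measure_itv/= !lte_fin.
rewrite ltrD2l ltrN2; case: ifP => // _.
by rewrite -!EFinB; congr EFin; ring.
Qed.

Variable n : nat.
Implicit Types x y : 'rV[R]_n.

Lemma integral_rV_prod (F : 'I_n -> measurableTypeR R -> \bar R) :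
  (forall j, measurable_fun setT (F j)) -> (forall j t, 0 <= F j t) ->
  \int[lebesgue_rV R n]_x (\prod_j F j (x 0%R j)) =
  \prod_j \int[lebesgue_measure]_t F j t.
Proof.
move=> mF F0; rewrite -(integral_product_power (@lebesgue_measure R))//.
rewrite [LHS](_ : _ = \int[pushforward (product_power (@lebesgue_measure R) n)
  (@row_of_tuple R n)]_x (\prod_j F j (x 0%R j)))//.
rewrite ge0_integral_pushforward//; last 3 first.
- exact: measurable_row_of_tuple.
- apply: emeasurable_prod => j; apply: (measurableT_comp (mF j)).
  exact: measurable_coord.
- by move=> x _; exact: prode_ge0.
rewrite preimage_setT; apply: eq_integral => t _ /=.
by apply: eq_bigr => j _; rewrite mxE.
Qed.

Lemma measurable_box (A : 'I_n -> set (measurableTypeR R)) :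
  (forall j, measurable (A j)) -> measurable [set x : 'rV[R]_n | forall j, A j (x 0%R j)].
Proof.
move=> mA; rewrite (_ : [set x | _] =
    \big[setI/setT]_j ((fun x : 'rV[R]_n => x 0%R j : measurableTypeR R) @^-1` A j)).
  apply: bigsetI_measurable => j _.
  by rewrite -[X in measurable X]setTI; exact: measurable_coord.
apply/seteqP; split => x; rewrite -bigcap_seq => H.
  by move=> i /= _; exact: H.
by move=> j; apply: (H j); rewrite /= mem_index_enum.
Qed.

Lemma lebesgue_rV_box (A : 'I_n -> set (measurableTypeR R)) :
  (forall j, measurable (A j)) ->
  lebesgue_rV R n [set x : 'rV[R]_n | forall j, A j (x 0%R j)] =
  \prod_j lebesgue_measure (A j).
Proof.
move=> mA; rewrite -[LHS]mul1e -integral_cst; last exact: measurable_box.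
transitivity (\int[lebesgue_rV R n]_x (\prod_j (\1_(A j) (x 0%R j))%:E)).
  rewrite integral_mkcond; apply: eq_integral => x _; rewrite patchE.
  case: ifPn => [|/negP]; rewrite inE /= => Ax.
    by rewrite big1// => j _; rewrite indicE mem_set//; exact: Ax.
  have /existsNP[j nAj] := Ax.
  by rewrite (bigD1 j)//= indicE memNset// mul0e.
rewrite (integral_rV_prod (F := fun j t => (\1_(A j) t)%:E))//.
  by apply: eq_bigr => j _; rewrite integral_indic// setIT.
by move=> j; apply/measurable_EFinP.
Qed.

Lemma lebesgue_rV_set1 x : (0 < n)%N -> lebesgue_rV R n [set x] = 0.
Proof.
move=> n0; rewrite (_ : [set x] = [set y : 'rV[R]_n | forall j, [set x 0%R j] (y 0%R j)]).
  rewrite (lebesgue_rV_box (A := fun j => [set x 0%R j]))//.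
  case: n n0 x => // k _ x.
  by rewrite big_ord_recl lebesgue_measure_set1 mul0e.
apply/seteqP; split => [y -> //|y H]; apply/rowP => j; exact: H.
Qed.

Lemma measurable_reflect x : measurable_fun setT (fun y : 'rV[R]_n => x - y)%R.
Proof.
apply: measurable_fun_matrix => i j.
rewrite (_ : (fun _ => _) = (fun y : 'rV[R]_n => x i j - y i j)%R); last first.
  by apply/funext => y; rewrite !mxE.
apply: measurable_funB => //; exact: measurable_coord.
Qed.

Lemma lebesgue_rV_reflect x (A : set 'rV[R]_n) : measurable A ->
  lebesgue_rV R n ((fun y => x - y)%R @^-1` A) = lebesgue_rV R n A.
Proof.
move=> mA; rewrite /lebesgue_rV /pushforward.
pose g j (t : measurableTypeR R) : measurableTypeR R := (x 0%R j - t)%R.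
have mg j : measurable_fun setT (g j) by exact: measurable_funB.
have [_ H] := @product_power_preserving _ _ _ (@lebesgue_measure R) n g mg
  (fun j => @lebesgue_measure_reflect (x 0%R j)).
rewrite -[RHS]H; last first.
  by rewrite -[X in measurable X]setTI; exact: measurable_row_of_tuple.
congr (product_power _ _ _); apply/seteqP.
have e t : (x - row_of_tuple t)%R = row_of_tuple
    [tuple (x 0%R j - tnth t j)%R | j < n] :> 'rV[R]_n.
  by apply/rowP => j; rewrite !mxE tnth_mktuple.
by split => t; rewrite /preimage/= e.
Qed.

End lebesgue_euclidean.

Section lebesgue_matrix.
Context (R : realType) (m n : nat).
Local Open Scope ereal_scope.
Local Notation mum := (lebesgue_mx R m n).

Lemma measurable_row (i : 'I_m) : measurable_fun setT (fun y : 'M[R]_(m, n) => row i y).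
Proof.
apply: measurable_fun_matrix => k j.
rewrite (_ : (fun _ => _) = fun y : 'M[R]_(m, n) => y i j : measurableTypeR R).
  exact: measurable_coord.
by apply/funext => y; rewrite mxE.
Qed.

Lemma integral_mx_prod (F : 'I_m -> 'rV[R]_n -> \bar R) :
  (forall i, measurable_fun setT (F i)) -> (forall i x, 0 <= F i x) ->
  \int[mum]_y (\prod_i F i (row i y)) = \prod_i \int[lebesgue_rV R n]_x F i x.
Proof.
move=> mF F0; rewrite -(integral_product_power (lebesgue_rV R n))//.
rewrite [LHS](_ : _ = \int[pushforward (product_power (lebesgue_rV R n) m)
  (@matrix_of_tuple R m n)]_y (\prod_i F i (row i y)))//.
rewrite ge0_integral_pushforward//; last 3 first.
- exact: measurable_matrix_of_tuple.
- apply: emeasurable_prod => i; apply: (measurableT_comp (mF i)).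
  exact: measurable_row.
- by move=> x _; exact: prode_ge0.
rewrite preimage_setT; apply: eq_integral => t _ /=.
by apply: eq_bigr => j _; rewrite rowK.
Qed.

Lemma null_row (i : 'I_m) (N : set 'rV[R]_n) : measurable N -> lebesgue_rV R n N = 0 ->
  measurable ((@row R m n i) @^-1` N) /\ mum ((@row R m n i) @^-1` N) = 0.
Proof.
move=> mN N0; have mrN : measurable ((@row R m n i) @^-1` N).
  by rewrite -[X in measurable X]setTI; exact: measurable_row.
split => //.
rewrite -[LHS]mul1e -integral_cst//.
transitivity (\int[mum]_y (\prod_k (if k == i then (\1_N (row k y))%:E else 1))).
  rewrite integral_mkcond; apply: eq_integral => y _; rewrite patchE.
  rewrite (bigD1 i)//= eqxx big1 ?mule1; last by move=> k /negbTE->.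
  rewrite indicE; case: ifPn => [|/negP]; rewrite inE /preimage/= => Ny.
    by rewrite mem_set.
  by rewrite memNset.
rewrite (integral_mx_prod (F := fun k x => if k == i then (\1_N x)%:E else 1)).
- rewrite (bigD1 i)//= eqxx (_ : integral _ _ _ = 0) ?mul0e//.
  by rewrite integral_indic// setIT; exact: N0.
- by move=> k; case: eqP => _ //; exact/measurable_EFinP.
- by move=> k x; case: eqP.
Qed.

Lemma lebesgue_mx_reflect (x : 'rV[R]_n) :
  let S := fun y : 'M[R]_(m, n) => (\matrix_i (x - row i y))%R in
  measurable_fun setT S /\
  (forall A, measurable A -> mum (S @^-1` A) = mum A).
Proof.
move=> S; split.
  apply: measurable_fun_matrix => i j.
  rewrite (_ : (fun _ => _) = (fun y : 'M[R]_(m, n) => x 0 j - y i j)%R); last first.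
    by apply/funext => y; rewrite !mxE.
  by apply: measurable_funB => //; exact: measurable_coord.
move=> A mA; rewrite /lebesgue_mx /pushforward.
have [_ H] := @product_power_preserving _ _ _ (lebesgue_rV R n) m
  (fun j y => x - y)%R (fun j => measurable_reflect x)
  (fun j => @lebesgue_rV_reflect R n x).
rewrite -[RHS]H; last first.
  by rewrite -[X in measurable X]setTI; exact: measurable_matrix_of_tuple.
congr (product_power _ _ _); apply/seteqP.
have e t : S (matrix_of_tuple t) =
    matrix_of_tuple [tuple (x - tnth t j)%R | j < m] :> 'M[R]_(m, n).
  by apply/row_matrixP => i; rewrite !rowK tnth_mktuple.
by split => t; rewrite /preimage/= e.
Qed.

End lebesgue_matrix.

Section compact_boxes.
Context (R : realType).

Lemma compact_cube n (a : 'rV[R]_n) l : compact (cube a l).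
Proof.
rewrite (_ : cube a l = [set v : 'rV[R]_n |
    forall i, `[a 0 i, a 0 i + l]%classic (v ord0 i)]).
  by apply: (@rV_compact R n (fun i => `[a 0 i, a 0 i + l]%classic)) => i;
    exact: segment_compact.
by apply/seteqP; split => v /= H i; have := H i; rewrite in_itv/=.
Qed.

Lemma compact_mx_box m n (c : R) :
  compact [set y : 'M[R]_(m, n) | forall i j, `|y i j| <= c].
Proof.
pose g (u : 'rV[R]_(m * n)) : 'M[R]_(m, n) := vec_mx u.
have cg : continuous g.
  move=> u B [P hP PB].
  have : \forall v \near u, forall i : 'I_m, forall j : 'I_n, P i j (g v i j).
    apply: (@filter_forall _ _ (fun i v => forall j, P i j (g v i j)) (nbhs u)) => i.
    apply: (@filter_forall _ _ (fun j v => P i j (g v i j)) (nbhs u)) => j.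
    have := hP i j; rewrite /g mxE => hPij.
    have C := @coord_continuous R 1 (m * n) 0 (mxvec_index i j) u (P i j) hPij.
    suff E : [set v | P i j (g v i j)] =
        [set v : 'rV[R]_(m * n) | P i j (v 0 (mxvec_index i j))].
      by change (nbhs u [set v | P i j (g v i j)]); rewrite E.
    by apply/seteqP; split => v; rewrite /g /= mxE.
  by apply: filterS => v hv; exact: PB.
have -> : [set y : 'M[R]_(m, n) | forall i j, `|y i j| <= c] =
    g @` [set v : 'rV[R]_(m * n) | forall k, `[- c, c]%classic (v ord0 k)].
  apply/seteqP; split => y /=.
    move=> H; exists (mxvec y); last by rewrite /g mxvecK.
    move=> k; case/mxvec_indexP: k => i j.
    by rewrite mxvecE in_itv/= -ler_norml.
  move=> [v H <-] i j; rewrite /g mxE ler_norml.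
  by have := H (mxvec_index i j); rewrite in_itv.
apply: continuous_compact; first exact: continuous_subspaceT.
by apply: (@rV_compact R (m * n) (fun=> `[- c, c]%classic)) => i;
  exact: segment_compact.
Qed.

Lemma compactly_supported_bounded n (f : 'rV[R]_n -> R) :
  bounded_compactly_supported f ->
  exists c : R, 0 <= c /\ forall x, f x != 0 -> forall j, `|x 0 j| <= c.
Proof.
move=> [_ _ /compact_bounded[M [Mr hM]]].
exists (`|M| + 1); split; first by rewrite addr_ge0.
move=> x fx j; have : `|x| <= `|M| + 1.
  apply: hM; first by rewrite (le_lt_trans (ler_norm _))// ltrDl.
  exact: subset_closure.
apply: le_trans; rewrite [leRHS]mx_normrE.
by apply: le_trans (le_bigmax _ _ (0, j)).
Qed.

End compact_boxes.

(** * Shifted dyadic grids *)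

Section dyadic.
Context (R : realType) (n : nat).
Implicit Types (x y : 'rV[R]_n) (j L : int) (k : nat) (t : {ffun 'I_n -> bool}).

(** Three times the shift, in units of the side length, of the grid of side 2^j
    in a coordinate direction that is shifted. The alternating sign makes the
    grids of different side lengths nested. *)
Definition shift_sign j (s : bool) : int :=
  if s then (if odd `|j|%N then -1 else 1) else 0.

Lemma shift_signS j s : shift_sign (j + 1) s = - shift_sign j s.
Proof.
rewrite /shift_sign; case: s => //=.
have -> : odd `|(j + 1)%R|%N = ~~ odd `|j|%N.
  by lia.
by case: (odd _); rewrite ?opprK.
Qed.

Definition dyadic_coord j (s : bool) (u : R) : int :=
  Num.floor (u / 2 ^ j - (shift_sign j s)%:~R / 3).

Definition dyadic_code t j x : {ffun 'I_n -> int} :=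
  [ffun i => dyadic_coord j (t i) (x 0 i)].

Definition dyadic_corner t j x : 'rV[R]_n :=
  \row_i (2 ^ j * ((dyadic_code t j x i)%:~R + (shift_sign j (t i))%:~R / 3)).

Lemma expz2_gt0 j : 0 < 2 ^ j :> R. Proof. by rewrite exprz_gt0. Qed.

Lemma expz2S j : 2 ^ (j + 1) = 2 * 2 ^ j :> R.
Proof. by rewrite expfzDr// expr1z mulrC. Qed.

Lemma dyadic_coordP j s (u : R) (v : int) :
  (dyadic_coord j s u == v) =
  (2 ^ j * (v%:~R + (shift_sign j s)%:~R / 3) <= u <
   2 ^ j * (v%:~R + (shift_sign j s)%:~R / 3) + 2 ^ j).
Proof.
rewrite /dyadic_coord floor_eq intrD; have p := expz2_gt0 j.
set e := _ / 3.
rewrite lerBrDr ler_pdivlMr// mulrC ltrBlDr ltr_pdivrMr//.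
by congr (_ && (_ < _)); rewrite mulrC; ring.
Qed.

Lemma dyadic_code_eqP t j x y : dyadic_code t j y = dyadic_code t j x <->
  forall i, dyadic_corner t j x 0 i <= y 0 i < dyadic_corner t j x 0 i + 2 ^ j.
Proof.
split=> [/ffunP H i|H].
  by have /eqP := H i; rewrite ffunE dyadic_coordP mxE.
by apply/ffunP => i; apply/eqP; rewrite ffunE dyadic_coordP; have := H i; rewrite mxE.
Qed.

Lemma dyadic_code_nested t j x y :
  dyadic_code t j x = dyadic_code t j y ->
  dyadic_code t (j + 1) x = dyadic_code t (j + 1) y.
Proof.
move=> /ffunP H; apply/ffunP => i; have := H i; rewrite !ffunE /dyadic_coord.
rewrite shift_signS expz2S; set e := shift_sign j (t i).
have E (u : R) : u / (2 * 2 ^ j) - (- e)%:~R / 3 =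
    ((u / 2 ^ j - e%:~R / 3) + e%:~R) / 2.
  rewrite rmorphN/=; have := expz2_gt0 j; set p := 2 ^ j => p0.
  by field; rewrite gt_eqF.
rewrite !E; set u := _ / _ - _; set u' := _ / _ - _ => uu'.
apply/eqP; rewrite floor_eq.
set w := Num.floor ((u' + _) / 2).
have /andP[w1 w2] := floor_itv ((u' + e%:~R) / 2); rewrite -/w in w1 w2.
have h1 : ((2 * w - e)%:~R : R) <= u'.
  by rewrite intrB intrM; lra.
have h2 : u' < ((2 * (w + 1) - e)%:~R : R).
  by rewrite intrB intrM; lra.
rewrite -floor_ge_int -uu' floor_ge_int intrB intrM in h1.
rewrite -floor_lt_int -uu' floor_lt_int intrB intrM in h2.
by apply/andP; split; lra.
Qed.

Lemma measurable_code t j x :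
  measurable [set y : 'rV[R]_n | dyadic_code t j y = dyadic_code t j x].
Proof.
rewrite (_ : [set y | _] = [set y : 'rV[R]_n | forall i,
    `[dyadic_corner t j x 0 i, dyadic_corner t j x 0 i + 2 ^ j[%classic (y 0 i)]).
  by apply: (@measurable_box R n (fun i =>
    `[dyadic_corner t j x 0 i, dyadic_corner t j x 0 i + 2 ^ j[%classic)).
apply/seteqP; split => y /=.
  by move=> /dyadic_code_eqP H i; rewrite in_itv/=; exact: H.
by move=> H; apply/dyadic_code_eqP => i; have := H i; rewrite in_itv.
Qed.

Definition dyadic_idx L t k x : nat := choice.pickle (dyadic_code t (L - k%:Z) x).

Lemma dyadic_idxE L t k x y : dyadic_idx L t k x = dyadic_idx L t k y <->
  dyadic_code t (L - k%:Z) x = dyadic_code t (L - k%:Z) y.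
Proof.
split => [|e]; last by rewrite /dyadic_idx e.
by move/(pcan_inj choice.pickleK).
Qed.

Lemma measurable_dyadic_idx L t k : measurable_fun setT (dyadic_idx L t k).
Proof.
move=> _ Y _; rewrite setTI.
rewrite (_ : _ @^-1` Y = \bigcup_(i in Y) [set x | dyadic_idx L t k x = i]).
  apply: bigcup_measurable => i _.
  have [[x xi]|H] := pselect (exists x, dyadic_idx L t k x = i); last first.
    rewrite (_ : [set x | _] = set0)//; apply/seteqP; split => // x xi.
    by apply: H; exists x.
  rewrite (_ : [set x | _] =
    [set y | dyadic_code t (L - k%:Z) y = dyadic_code t (L - k%:Z) x]).
    exact: measurable_code.
  apply/seteqP; split => y /= h; last by rewrite -xi; apply/dyadic_idxE.
  by apply/dyadic_idxE; rewrite h.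
apply/seteqP; split => [x Yx|x [i Yi /= xi]]; first by exists (dyadic_idx L t k x).
by rewrite /preimage/= xi.
Qed.

Lemma dyadic_idx_nested L t k x y :
  dyadic_idx L t k.+1 x = dyadic_idx L t k.+1 y ->
  dyadic_idx L t k x = dyadic_idx L t k y.
Proof.
move=> /dyadic_idxE /dyadic_code_nested H; apply/dyadic_idxE.
suff -> : L - k%:Z = L - k.+1%:Z + 1 by [].
by lia.
Qed.

Definition dyadic L t : grid 'rV[R]_n :=
  Grid (@measurable_dyadic_idx L t) (@dyadic_idx_nested L t).

Definition dyadic_cube t j x : set 'rV[R]_n :=
  [set y | forall i, dyadic_corner t j x 0 i <= y 0 i < dyadic_corner t j x 0 i + 2 ^ j].

Lemma cell_dyadic L t k x : cell (dyadic L t) k x = dyadic_cube t (L - k%:Z) x.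
Proof.
apply/seteqP; split => y; first by move=> /dyadic_idxE /dyadic_code_eqP.
by move=> h; apply/dyadic_idxE/dyadic_code_eqP.
Qed.

Lemma dyadic_cube_self t j x : dyadic_cube t j x x.
Proof. exact/dyadic_code_eqP. Qed.

Lemma eq_dyadic_corner t j x y : dyadic_cube t j x y ->
  dyadic_corner t j y = dyadic_corner t j x.
Proof. by move=> /dyadic_code_eqP h; apply/rowP => i; rewrite !mxE h. Qed.

Lemma eq_dyadic_cube t j x y : dyadic_cube t j x y ->
  dyadic_cube t j y = dyadic_cube t j x.
Proof. by move=> /eq_dyadic_corner h; rewrite /dyadic_cube h. Qed.

Local Notation mu := (lebesgue_rV R n).

Lemma measurable_dyadic_cube t j x : measurable (dyadic_cube t j x).
Proof.
rewrite (_ : dyadic_cube t j x = cell (dyadic j t) 0 x).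
  exact: measurable_cell.
by rewrite cell_dyadic subr0.
Qed.

Lemma prode_const (c : R) : (\prod_(i < n) c%:E = (c ^+ n)%:E)%E.
Proof. by rewrite prodEFin prodr_const card_ord. Qed.

Lemma lebesgue_dyadic_cube t j x : mu (dyadic_cube t j x) = ((2 ^ j) ^+ n)%:E.
Proof.
rewrite (_ : dyadic_cube t j x = [set y : 'rV[R]_n | forall i,
    `[dyadic_corner t j x 0 i, dyadic_corner t j x 0 i + 2 ^ j[%classic (y 0 i)]).
  rewrite (lebesgue_rV_box (A := fun i =>
    `[dyadic_corner t j x 0 i, dyadic_corner t j x 0 i + 2 ^ j[%classic))//.
  rewrite -prode_const; apply: eq_bigr => i _.
  rewrite lebesgue_measure_itv/= lte_fin ltrDl expz2_gt0.
  by rewrite -EFinB addrAC subrr add0r.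
by apply/seteqP; split => y H i; have := H i; rewrite /= in_itv.
Qed.

Lemma measurable_cube (a : 'rV[R]_n) l : measurable (cube a l).
Proof.
rewrite (_ : cube a l = [set y : 'rV[R]_n | forall i,
    `[a 0 i, a 0 i + l]%classic (y 0 i)]).
  exact: (@measurable_box R n (fun i => `[a 0 i, a 0 i + l]%classic)).
by apply/seteqP; split => y H i; have := H i; rewrite /= in_itv.
Qed.

Lemma lebesgue_cube (a : 'rV[R]_n) l : 0 < l -> mu (cube a l) = (l ^+ n)%:E.
Proof.
move=> l0; rewrite (_ : cube a l = [set y : 'rV[R]_n | forall i,
    `[a 0 i, a 0 i + l]%classic (y 0 i)]).
  rewrite (lebesgue_rV_box (A := fun i => `[a 0 i, a 0 i + l]%classic))//.
  rewrite -prode_const; apply: eq_bigr => i _.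
  rewrite lebesgue_measure_itv/= lte_fin ltrDl l0.
  by rewrite -EFinB addrAC subrr add0r.
by apply/seteqP; split => y H i; have := H i; rewrite /= in_itv.
Qed.

Lemma dyadic_cube_sub t j x : dyadic_cube t j x `<=` cube (dyadic_corner t j x) (2 ^ j).
Proof. by move=> y H i; have /andP[-> /ltW ->] := H i. Qed.

(** Partitions need half-open cubes, whereas the maximal operator and the conditions
    on weights and oscillations are stated with closed ones. The volumes agree, so
    that integrals over the two can be exchanged. *)
Lemma dyadic_cube_boundary t j x :
  let D := cube (dyadic_corner t j x) (2 ^ j) `\` dyadic_cube t j x in
  measurable D /\ mu D = 0%E.
Proof.
move=> D; have mQ := measurable_dyadic_cube t j x.
have mC := @measurable_cube (dyadic_corner t j x) (2 ^ j).
split; first exact: measurableD.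
have C := lebesgue_cube (dyadic_corner t j x) (expz2_gt0 j).
rewrite measureD//; last by rewrite [X in (X < _)%E]C ltry.
rewrite setIidr; last exact: dyadic_cube_sub.
by rewrite [X in (X - _)%E]C [X in (_ - X)%E]lebesgue_dyadic_cube -EFinB subrr.
Qed.

Lemma integral_dyadic_cube t j x (f : 'rV[R]_n -> \bar R) :
  (\int[mu]_(y in dyadic_cube t j x) f y =
   \int[mu]_(y in cube (dyadic_corner t j x) (2 ^ j)) f y)%E.
Proof.
have [mD D0] := dyadic_cube_boundary t j x.
exact: eq_integral_null_domain (@dyadic_cube_sub t j x) mD D0.
Qed.

(** A coordinate interval whose length is a quarter of the side length avoids the
    boundary points of at least one of the two grids of that coordinate. *)
Lemma dyadic_cube_contains_ball j x : exists t : {ffun 'I_n -> bool},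
  forall y, (forall i, `|y 0 i - x 0 i| <= 2 ^ j / 8) -> dyadic_cube t j x y.
Proof.
have p := expz2_gt0 j.
have H i : exists s : bool, forall u : R, `|u - x 0 i| <= 2 ^ j / 8 ->
    dyadic_coord j s u = dyadic_coord j s (x 0 i).
  set v := Num.floor (x 0 i / 2 ^ j).
  have /andP[v1 v2] := floor_itv (x 0 i / 2 ^ j); rewrite -/v intrD in v1 v2.
  have near (u : R) : `|u - x 0 i| <= 2 ^ j / 8 ->
      x 0 i / 2 ^ j - 1 / 8 <= u / 2 ^ j <= x 0 i / 2 ^ j + 1 / 8.
    rewrite ler_norml => /andP[h1 h2].
    rewrite ler_pdivlMr// ler_pdivrMr// mulrBl mulrDl divfK ?gt_eqF//.
    by apply/andP; split; lra.
  have [c|c] := boolP (v%:~R + 1 / 8 <= x 0 i / 2 ^ j < v%:~R + 7 / 8).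
    exists false => u /near /andP[u1 u2]; rewrite /dyadic_coord /= mul0r !subr0 -/v.
    by apply/eqP; rewrite floor_eq intrD; apply/andP; case/andP: c => c1 c2; split; lra.
  exists true => u /near /andP[u1 u2]; rewrite /dyadic_coord.
  set e : R := (shift_sign j true)%:~R / 3.
  have e3 : e = 1 / 3 \/ e = - (1 / 3).
    rewrite /e /shift_sign; case: ifP => _; [right|left]; last by [].
    by rewrite rmorphN/= mulNr.
  have [w hw] : exists w : int, w%:~R + 1 / 8 <= x 0 i / 2 ^ j - e /\
      x 0 i / 2 ^ j - e < w%:~R + 7 / 8.
    have [lt8|ge8] := ltP (x 0 i / 2 ^ j) (v%:~R + 1 / 8).
      by case: e3 => ->; [exists (v - 1)|exists v]; rewrite ?intrB; split; lra.
    have lt7 : v%:~R + 7 / 8 <= x 0 i / 2 ^ j.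
      by move: c; rewrite ge8/= -leNgt.
    by case: e3 => ->; [exists v|exists (v + 1)]; rewrite ?intrD; split; lra.
  transitivity w.
    by apply/eqP; rewrite floor_eq intrD; apply/andP; split; lra.
  by apply/esym/eqP; rewrite floor_eq intrD; apply/andP; split; lra.
have /choice[s hs] := H.
exists [ffun i => s i] => y yx; apply/dyadic_code_eqP/ffunP => i.
by rewrite !ffunE; exact: hs.
Qed.

(** The lower corners of the cells that contain y lie below y and tend to y
    coordinatewise, so the half-spaces c < y_i, which generate the Borel sets, are
    countable unions of unions of cells. *)
Lemma dyadic_generating L t : generating (dyadic L t).
Proof.
move=> A mA; set Sat := [set S | exists k, saturated (dyadic L t) k S].
have satc i k (c : R) :
    saturated (dyadic L t) k [set y | c < dyadic_corner t (L - k%:Z) y 0 i].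
  move=> y z yz; rewrite /= !mxE.
  by have /dyadic_idxE -> := yz.
have hs i (c : R) : <<s Sat >> [set y : 'rV[R]_n | c < y 0 i].
  rewrite (_ : [set y | _] =
      \bigcup_k [set y | c < dyadic_corner t (L - k%:Z) y 0 i]).
    apply: sigma_algebra_bigcup => k; apply: sub_sigma_algebra.
    by exists k; exact: satc.
  apply/seteqP; split => y /=; last first.
    move=> [k _ /= ck]; apply: lt_le_trans ck _.
    by have /(_ i)/andP[] := dyadic_cube_self t (L - k%:Z) y.
  move=> cy; pose dl := y 0 i - c; have dl0 : 0 < dl by rewrite subr_gt0.
  pose k := (Num.truncn (2 ^ L / dl)).+1.
  exists k => //=.
  have /(_ i)/andP[_] := dyadic_cube_self t (L - k%:Z) y.
  suff : 2 ^ (L - k%:Z) <= dl.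
    by rewrite /dl; move: (2 ^ _) (dyadic_corner _ _ _ _ _) => P Cn h1 h2; lra.
  rewrite expfzDr// -invr_expz ler_pdivrMr ?exprz_gt0//.
  rewrite mulrC -ler_pdivrMr//; apply: ltW; apply: lt_le_trans (truncnS_gt _) _.
  rewrite -/k -exprnP -natrX ler_nat ltnW// ltn_expl//.
have cyl i (B : set (measurableTypeR R)) : measurable B ->
    <<s Sat >> [set y : 'rV[R]_n | B (y 0 i)].
  move=> mB; have mf : @measurable_fun _ _ (g_sigma_algebraType Sat) (measurableTypeR R)
      setT (fun y : 'rV[R]_n => y 0 i).
    apply: (measurability _ (RGenOInfty.measurableE R)) => _ [_ [c ->]] <-.
    rewrite setTI; have := hs i c.
    rewrite (_ : [set y | _] = (fun y : 'rV[R]_n => y 0 i) @^-1` `]c, +oo[)//.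
    by apply/seteqP; split => y; rewrite /preimage/= in_itv/= andbT.
  by have := mf measurableT _ mB; rewrite setTI.
suff H : <<s @matrix_cylinder R 1 n >> `<=` <<s Sat >> by exact: H.
apply: smallest_sub; first exact: smallest_sigma_algebra.
move=> _ [i [j [B [mB ->]]]]; rewrite (ord1 i); exact: cyl.
Qed.

End dyadic.

(** * Muckenhoupt weights *)

Section muckenhoupt_weights.
Context (R : realType) (n : nat).
Local Notation mu := (lebesgue_rV R n).
Implicit Types w : 'rV[R]_n -> R.

Lemma measurable_lebesgue_measurable (f : 'rV[R]_n -> R) :
  measurable_fun setT f -> lebesgue_measurable mu f.
Proof.
move=> mf Y mY; exists (f @^-1` Y).
  by rewrite -[X in measurable X]setTI; exact: mf.
exists set0; last by rewrite setU0.
exact: negligible_set0.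
Qed.

Lemma muckenhoupt_borel p w : muckenhoupt p w -> exists w' N,
  [/\ measurable_fun setT w', muckenhoupt p w', measurable N, mu N = 0%E &
      forall x, ~ N x -> w x = w' x].
Proof.
move=> [[w0 [mw iw]] [C hC]].
have [w' mw' [N [mN N0 ww' w'0]]] := borel_representative mw.
exists w', N; split => //; split.
  split.
    move=> x; have [Nx|nNx] := pselect (N x); first by rewrite w'0.
    by rewrite -ww'.
  split; first exact: measurable_lebesgue_measurable.
  move=> K cK; rewrite -(@eq_integral_off_null _ _ _ mu K N (fun x => `|(w x)%:E|%E))//.
    exact: iw.
  by move=> x _ /ww' ->.
exists C => a l l0.
have e1 : mean (cube a l) (EFin \o w') = mean (cube a l) (EFin \o w).
  congr (_ * _)%E; apply: (eq_integral_off_null (N := N)) => // x _ /ww' /= -> //.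
have e2 : mean (cube a l) (fun x => ((w' x)%:E^-1 `^ (p - 1)^-1)%E) =
    mean (cube a l) (fun x => ((w x)%:E^-1 `^ (p - 1)^-1)%E).
  congr (_ * _)%E; apply: (eq_integral_off_null (N := N)) => // x _ /ww' -> //.
by rewrite e1 e2; exact: hC.
Qed.

Local Open Scope ereal_scope.

Let one_le_dual (p t u : R) : (1 < p)%R -> (0 < t)%R -> (0 <= u)%R -> (t * u < 1)%R ->
  (t `^ (p - 1)^-1)%:E <= (u%:E^-1) `^ (p - 1)^-1.
Proof.
move=> p1 t0 u0 tu1; have q0 : (0 < (p - 1)^-1)%R by rewrite invr_gt0 subr_gt0.
rewrite inver; case: eqVneq => [_|uN0].
  by rewrite poweRyr ?leey// gt_eqF.
have up : (0 < u)%R by rewrite lt_def uN0.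
rewrite poweR_EFin lee_fin; apply: ler_powR_base; [exact: ltW|exact: ltW|].
by rewrite -[leRHS]mul1r ler_pdivlMr// ltW.
Qed.

(** On half of a cube either w or its dual weight is large; the A_p condition
    bounds the dual weight, so half of a cube carries a fixed fraction of the
    weight of the cube. *)
Lemma muckenhoupt_half (p : R) w : (1 < p)%R -> measurable_fun setT w ->
  muckenhoupt p w -> exists2 theta : R, (0 <= theta < 1)%R &
  forall a l E, (0 < l)%R -> measurable E -> E `<=` cube a l ->
    mu E <= 2^-1%:E * mu (cube a l) ->
    \int[mu]_(x in E) (w x)%:E <= theta%:E * \int[mu]_(x in cube a l) (w x)%:E.
Proof.
move=> p1 mw [[w0 [_ iw]] [C0 hC]].
have q0 : (0 < p - 1)%R by rewrite subr_gt0.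
pose C : R := (`|C0| + 1)%R.
have Cp : (0 < C)%R by rewrite ltr_wpDl.
have C0C : (C0 <= C)%R by rewrite (le_trans (ler_norm _))// lerDl.
pose B : R := (4 * 4 `^ (p - 1) * C + 2)%R.
have B2 : (2 <= B)%R by rewrite lerDr !mulr_ge0// ?powR_ge0// ltW.
have B0 : (0 < B)%R by exact: lt_le_trans B2.
exists (1 - B^-1)%R.
  rewrite subr_ge0 invf_le1//; apply/andP; split.
    by apply: le_trans B2; rewrite ler1n.
  by rewrite ltrBlDr ltrDl invr_gt0.
move=> a l E l0 mE EQ hE; set Q := cube a l.
have mwE : measurable_fun setT (fun x => (w x)%:E) by exact/measurable_EFinP.
have mQ : measurable Q by exact: measurable_cube.
have muQ : mu Q = (l ^+ n)%:E by exact: lebesgue_cube.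
have v0 : (0 < l ^+ n)%R by rewrite exprn_gt0.
set v := (l ^+ n)%R in muQ v0.
pose E' := Q `\` E; have mE' : measurable E' by exact: measurableD.
have E'Q : E' `<=` Q by move=> x [].
have WQfin : \int[mu]_(x in Q) (w x)%:E \is a fin_num.
  rewrite ge0_fin_numE; last by apply: integral_ge0 => x _; rewrite lee_fin.
  have := iw _ (@compact_cube R n a l).
  rewrite (eq_integral (fun x => (w x)%:E))// => x _.
  by rewrite gee0_abs// lee_fin.
have sub (F : set 'rV[R]_n) : F `<=` Q -> measurable F ->
    \int[mu]_(x in F) (w x)%:E \is a fin_num.
  move=> FQ mF; rewrite ge0_fin_numE; last by apply: integral_ge0 => x _; rewrite lee_fin.
  apply: (@le_lt_trans _ _ (\int[mu]_(x in Q) (w x)%:E)).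
    apply: ge0_subset_integral => //; first exact: measurable_funTS.
    by move=> x _; rewrite lee_fin.
  by rewrite ltey_eq WQfin.
have split : \int[mu]_(x in Q) (w x)%:E =
    \int[mu]_(x in E) (w x)%:E + \int[mu]_(x in E') (w x)%:E.
  rewrite -[in LHS](setUIDK Q E) (setIidr EQ) ge0_integral_setU//.
  - exact: measurable_funTS.
  - by move=> x _; rewrite lee_fin.
  - by apply/disj_setPS => x [? []].
suff key : \int[mu]_(x in Q) (w x)%:E <= B%:E * \int[mu]_(x in E') (w x)%:E.
  move: key split; rewrite -(fineK WQfin) -(fineK (sub _ EQ mE)) -(fineK (sub _ E'Q mE')).
  set W := fine _; set We := fine _; set We' := fine _.
  rewrite -!EFinM -EFinD !lee_fin => key [WE].
  have : (B^-1 * W <= We)%R by rewrite mulrC ler_pdivrMr// mulrC.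
  rewrite mulrBl mul1r; lra.
have hE' : (2^-1 * v)%:E <= mu E'.
  have dD : mu E' = mu Q - mu E.
    rewrite -{1}(setIidr EQ); apply: measureD => //.
    by rewrite [X in X < _]muQ ltry.
  have := hE; rewrite -/Q dD muQ.
  have fE : mu E \is a fin_num.
    rewrite ge0_fin_numE//; apply: (@le_lt_trans _ _ (mu Q)).
      by apply: le_measure; rewrite ?inE.
    by rewrite muQ ltry.
  rewrite -(fineK fE) -EFinM -EFinB !lee_fin; lra.
have [W0|WN0] := eqVneq (\int[mu]_(x in Q) (w x)%:E) 0.
  rewrite W0 mule_ge0// ?lee_fin ?(ltW B0)//.
  by apply: integral_ge0 => x _; rewrite lee_fin.
pose W := fine (\int[mu]_(x in Q) (w x)%:E).
have WE : \int[mu]_(x in Q) (w x)%:E = W%:E by rewrite fineK.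
have Wp : (0 < W)%R.
  rewrite -lte_fin -WE lt_neqAle eq_sym WN0.
  by apply: integral_ge0 => x _; rewrite lee_fin.
pose V := fine (\int[mu]_(x in E') (w x)%:E).
have VE : \int[mu]_(x in E') (w x)%:E = V%:E by rewrite fineK// sub.
have V0 : (0 <= V)%R by apply: fine_ge0; apply: integral_ge0 => x _; rewrite lee_fin.
pose sigma x := ((w x)%:E^-1) `^ (p - 1)^-1.
have sigma0 x : 0 <= sigma x by exact: poweR_ge0.
pose s := mean Q sigma.
have s0 : 0 <= s.
  by rewrite /s /mean mule_ge0 ?inve_ge0// ?integral_ge0// muQ lee_fin ltW.
have meanE (f : 'rV[R]_n -> \bar R) : mean Q f = v^-1%:E * \int[mu]_(x in Q) f x.
  by rewrite /mean muQ inver gt_eqF.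
have Ap : (v^-1 * W)%:E * s `^ (p - 1) <= C%:E.
  have := hC a l l0; rewrite -/Q meanE WE -EFinM => h.
  by apply: le_trans h _; rewrite lee_fin.
have vW : (0 < v^-1 * W)%R by rewrite mulr_gt0 ?invr_gt0.
have sfin : s \is a fin_num.
  rewrite ge0_fin_numE// ltNge leye_eq; apply/negP => /eqP sy.
  by move: Ap; rewrite sy poweRyr ?gt_eqF// gt0_muley ?lte_fin// leye_eq.
pose s1 := fine s; have sE : s = s1%:E by rewrite fineK.
have s10 : (0 <= s1)%R by exact: fine_ge0.
have sI : \int[mu]_(x in Q) sigma x = (v * s1)%:E.
  have := sE; rewrite /s meanE => /(congr1 (fun z => v%:E * z)).
  by rewrite muleA -!EFinM divff ?gt_eqF// mul1e.
have main (t : R) : (0 < t)%R ->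
    (2^-1 * v <= t * V + (t `^ (p - 1)^-1)^-1 * (v * s1))%R.
  move=> t0; set c := (t `^ (p - 1)^-1)%R.
  have c0 : (0 < c)%R by rewrite powR_gt0.
  pose A1 := E' `&` [set x | (1 <= t * w x)%R].
  pose A2 := E' `&` [set x | (t * w x < 1)%R].
  have mtw : measurable_fun setT (fun x => t * w x)%R by exact: measurable_funM.
  have m1 : measurable [set x | (1 <= t * w x)%R].
    have := mtw measurableT _ (measurable_itv `[1%R, +oo[); rewrite setTI.
    by congr measurable; apply/seteqP; split => x; rewrite /preimage/= in_itv/= andbT.
  have m2 : measurable [set x | (t * w x < 1)%R].
    have := measurableC m1; congr measurable.
    by apply/seteqP; split => x /=; [move/negP; rewrite -ltNge|move=> h; apply/negP; rewrite -ltNge].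
  have mA1 : measurable A1 by exact: measurableI.
  have mA2 : measurable A2 by exact: measurableI.
  have h1 : mu A1 <= (t * V)%:E.
    rewrite -[leLHS]mul1e -integral_cst// EFinM -VE.
    apply: (@le_trans _ _ (\int[mu]_(x in A1) (t%:E * (w x)%:E))).
      by apply: le_integral_raw => // x [_ /= h]; rewrite -EFinM lee_fin.
    rewrite ge0_integralZl//; last 3 first.
    - exact: measurable_funTS.
    - by move=> x _; rewrite lee_fin.
    - by rewrite lee_fin ltW.
    rewrite lee_wpmul2l ?lee_fin ?(ltW t0)//.
    apply: ge0_subset_integral => //; first exact: measurable_funTS.
      by move=> x _; rewrite lee_fin.
    by move=> x [].
  have h2 : mu A2 <= (c^-1 * (v * s1))%:E.
    rewrite EFinM -sI lee_pdivlMl// -integral_cst//.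
    apply: (@le_trans _ _ (\int[mu]_(x in A2) sigma x)).
      apply: le_integral_raw => x; first by rewrite lee_fin ltW.
      by move=> [_ /= h]; exact: one_le_dual.
    rewrite integral_mkcond [leRHS]integral_mkcond.
    apply: le_integral_raw => x _; rewrite !patchE; first by case: ifP.
    case: ifPn => [|_]; last by case: ifP.
    by rewrite inE => -[/E'Q Qx _]; rewrite mem_set.
  suff H : ((2^-1 * v)%:E <= (t * V + c^-1 * (v * s1))%:E)%E.
    by move: H; rewrite lee_fin.
  rewrite EFinD.
  apply: le_trans hE' _.
  apply: le_trans (leeD h1 h2).
  apply: le_trans (measureU2 _ mA1 mA2).
  apply: le_measure; rewrite ?inE//; first exact: measurableU.
  by move=> x Ex; have [h|h] := leP 1%R (t * w x)%R; [left|right].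
have [s1z|s1N] := eqVneq s1 0%R.
  exfalso; have t0 : (0 < v / (4 * (V + 1)))%R.
    by rewrite divr_gt0// mulr_gt0// ltr_wpDl.
  have := main _ t0; rewrite s1z !mulr0 addr0; apply/negP; rewrite -ltNge.
  have V1 : (0 < V + 1)%R by rewrite ltr_wpDl.
  rewrite invfM mulrA -[ltLHS]mulrA [(_ * V)%R]mulrC mulrA.
  rewrite ltr_pdivrMr//.
  have : (0 < v * V + v)%R by rewrite ltr_wpDl// mulr_ge0// ltW.
  have : (0 <= v * V)%R by rewrite mulr_ge0// ltW.
  lra.
have s1p : (0 < s1)%R by rewrite lt_def s1N.
pose t := ((4 * s1) `^ (p - 1))%R.
have t0 : (0 < t)%R by apply: powR_gt0; rewrite mulr_gt0.
have := main t t0.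
have -> : (t `^ (p - 1)^-1 = 4 * s1)%R.
  by rewrite /t -powRrM mulfV ?gt_eqF// powRr1// mulr_ge0.
have -> : ((4 * s1)^-1 * (v * s1) = 4^-1 * v)%R by field.
move=> h; have {}h : (4^-1 * v <= t * V)%R by lra.
rewrite WE VE -EFinM lee_fin.
have tE : (t = 4 `^ (p - 1) * s1 `^ (p - 1))%R by rewrite /t powRM.
have Ap' : (v^-1 * W * s1 `^ (p - 1) <= C)%R.
  by move: Ap; rewrite sE poweR_EFin -EFinM lee_fin.
have h3 : (W <= 4 * (v^-1 * W) * (t * V))%R.
  have := ler_wpM2l (ltW vW) h.
  have -> : (v^-1 * W * (4^-1 * v) = 4^-1 * W)%R by field; rewrite gt_eqF.
  move=> h3; lra.
apply: (le_trans h3); rewrite tE.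
rewrite [leLHS](_ : _ = 4 * 4 `^ (p - 1) * (v^-1 * W * s1 `^ (p - 1)) * V)%R; last by ring.
rewrite ler_wpM2r// /B; apply: (@le_trans _ _ (4 * 4 `^ (p - 1) * C)%R); last by rewrite lerDl.
by rewrite ler_wpM2l// mulr_ge0// powR_ge0.
Qed.

End muckenhoupt_weights.

(** * Luxemburg norms *)

Section young_function.
Context (R : realType) (alpha : R).
Hypothesis alpha0 : 0 <= alpha.
Implicit Types s t B : R.

Lemma LlogL_factor_ge1 t : 1 <= (1 + Num.max 0 (ln t)) `^ alpha.
Proof.
rewrite -[X in X <= _](powRr0 (1 + Num.max 0 (ln t))).
by apply: ler_powR => //; rewrite lerDl le_max lexx.
Qed.

Lemma LlogL_factor_le s t : 0 <= s -> s <= t ->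
  (1 + Num.max 0 (ln s)) `^ alpha <= (1 + Num.max 0 (ln t)) `^ alpha.
Proof.
move=> s0 st; apply: ler_powR_base => //.
  by rewrite addr_ge0// le_max lexx.
rewrite lerD2l; move: s0; rewrite le_eqVlt => /predU1P[<-|s0].
  by rewrite ln0// maxxx le_max lexx.
have lst : ln s <= ln t by rewrite ler_ln// posrE (lt_le_trans s0).
by rewrite ge_max le_max lexx /= le_max lst orbT.
Qed.

Lemma LlogL_ge0 t : 0 <= t -> 0 <= LlogL alpha t.
Proof. by move=> t0; rewrite mulr_ge0// powR_ge0. Qed.

Lemma LlogL_ge t : 0 <= t -> t <= LlogL alpha t.
Proof. by move=> t0; rewrite /LlogL ler_peMr// LlogL_factor_ge1. Qed.

Lemma LlogL_le s t : 0 <= s -> s <= t -> LlogL alpha s <= LlogL alpha t.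
Proof.
move=> s0 st; apply: ler_pM => //; first exact: powR_ge0.
exact: LlogL_factor_le.
Qed.

Lemma LlogL_small t : t <= 1 -> LlogL alpha t = t.
Proof.
move=> t1; rewrite /LlogL.
have -> : Num.max 0 (ln t) = 0 by apply/max_idPl; exact: ln_le0.
by rewrite addr0 powR1 mulr1.
Qed.

Lemma LlogL_scale t B : 0 <= t -> 1 <= B -> LlogL alpha (t / B) <= B^-1 * LlogL alpha t.
Proof.
move=> t0 B1; have B0 : 0 < B by exact: lt_le_trans B1.
rewrite /LlogL mulrA [B^-1 * t]mulrC ler_wpM2l ?divr_ge0 ?(ltW B0)//.
by apply: LlogL_factor_le; rewrite ?divr_ge0 ?(ltW B0)// ler_pdivrMr// ler_peMr.
Qed.

Lemma measurable_LlogL : measurable_fun setT (LlogL alpha).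
Proof.
apply: measurable_funM => //.
apply: (measurableT_comp (measurable_powR alpha)).
by apply: measurable_funD => //; apply: measurable_maxr.
Qed.

End young_function.

Section luxemburg.
Context (R : realType) (n : nat) (alpha : R).
Hypothesis alpha0 : 0 <= alpha.
Local Notation mu := (lebesgue_rV R n).
Local Notation psi := (LlogL alpha).
Local Open Scope ereal_scope.

Variable f : 'rV[R]_n -> R.
Hypothesis mf : measurable_fun setT f.
Variable Mf : R.
Hypothesis bf : forall x, (`|f x| <= Mf)%R.

Let Mf0 : (0 <= Mf)%R.
Proof. by apply: le_trans (bf 0). Qed.

Lemma measurable_young lam : measurable_fun setT (fun x => (psi (`|f x| / lam))%:E).
Proof.
apply/measurable_EFinP; apply: (measurableT_comp (measurable_LlogL alpha)).
apply: measurable_funM => //.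
exact: measurableT_comp.
Qed.

Section one_set.
Variables (Q : set 'rV[R]_n) (v : R).
Hypothesis mQ : measurable Q.
Hypothesis v0 : (0 < v)%R.
Hypothesis muQ : mu Q = v%:E.

Definition admissible (lam : R) := \int[mu]_(x in Q) (psi (`|f x| / lam))%:E <= mu Q.

Lemma mean_le1 lam : (mean Q (fun x => (psi (`|f x| / lam))%:E) <= 1) <-> admissible lam.
Proof.
rewrite /mean muQ inver gt_eqF// /admissible muQ.
by rewrite lee_pdivrMl// mule1.
Qed.

Definition lux := fine (luxemburg psi f Q).

Let psi0 x lam : (0 < lam)%R -> 0 <= (psi (`|f x| / lam))%:E.
Proof. by move=> l0; rewrite lee_fin LlogL_ge0// divr_ge0// ltW. Qed.

Lemma luxemburg_le lam : (0 < lam)%R -> admissible lam -> luxemburg psi f Q <= lam%:E.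
Proof.
move=> l0 adm; apply: ereal_inf_lbound; exists lam => //; split => //.
exact/mean_le1.
Qed.

Lemma luxE : luxemburg psi f Q = lux%:E.
Proof.
have l0 : 0 <= luxemburg psi f Q.
  by apply: le_ereal_inf_tmp => _ [lam [lam0 _] <-]; rewrite lee_fin ltW.
rewrite /lux fineK// ge0_fin_numE//.
have M1 : (0 < Mf + 1)%R by rewrite ltr_wpDl.
apply: (@le_lt_trans _ _ (Mf + 1)%:E); last exact: ltry.
apply: luxemburg_le => //; rewrite /admissible.
rewrite -[leRHS]mul1e -integral_cst//; apply: le_integral_raw => x _.
  exact: psi0.
have h : (`|f x| / (Mf + 1) <= 1)%R.
  by rewrite ler_pdivrMr// mul1r (le_trans (bf x))// lerDl.
by rewrite lee_fin LlogL_small.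
Qed.

Lemma lux_ge0 : (0 <= lux)%R.
Proof.
rewrite -lee_fin -luxE.
by apply: le_ereal_inf_tmp => _ [lam [lam0 _] <-]; rewrite lee_fin ltW.
Qed.

Lemma lux_le lam : (0 < lam)%R -> admissible lam -> (lux <= lam)%R.
Proof. by move=> l0 adm; rewrite -lee_fin -luxE; exact: luxemburg_le. Qed.

Lemma lux_lt_admissible lam : (lux < lam)%R -> admissible lam.
Proof.
rewrite -lte_fin -luxE => /ereal_inf_lt[_ [l [l0 /mean_le1 adm] <-]].
rewrite lte_fin => llam; have lam0 : (0 < lam)%R by exact: lt_trans llam.
apply: le_trans adm; apply: le_integral_raw => x _; first exact: psi0.
rewrite lee_fin; apply: LlogL_le => //; first by rewrite divr_ge0// ltW.
by rewrite ler_wpM2l// lef_pV2// ltW.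
Qed.

(** The norm is an infimum that is not shown to be attained; estimates are proved for
    admissible constants and passed to the infimum here. *)
Lemma le_lux_of_admissible (X : \bar R) (c : R) : (0 <= c)%R ->
  (forall lam, (0 < lam)%R -> admissible lam -> X <= (c * lam)%:E) ->
  X <= (c * lux)%:E.
Proof.
move=> c0 H; apply/lee_addgt0Pr => e e0.
pose lam := (lux + e / (c + 1))%R.
have c1 : (0 < c + 1)%R by rewrite ltr_wpDl.
have lux_lam : (lux < lam)%R by rewrite ltrDl divr_gt0.
have lam0 : (0 < lam)%R by apply: le_lt_trans lux_lam; exact: lux_ge0.
apply: le_trans (H lam lam0 (lux_lt_admissible lux_lam)) _.
rewrite -EFinD lee_fin /lam mulrDr lerD2l mulrA ler_pdivrMr// mulrC.
by rewrite ler_wpM2l ?(ltW e0)// lerDl.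
Qed.

Lemma integral_le_lux : \int[mu]_(x in Q) (`|f x|)%:E <= (lux * v)%:E.
Proof.
rewrite mulrC; apply: le_lux_of_admissible; first exact: ltW.
move=> lam lam0; rewrite /admissible muQ => adm.
rewrite mulrC EFinM; apply: le_trans (lee_wpmul2l _ adm); last by rewrite lee_fin ltW.
rewrite -ge0_integralZl//; last 3 first.
- by apply: measurable_funTS; exact: measurable_young.
- by move=> x _; exact: psi0.
- by rewrite lee_fin ltW.
apply: le_integral_raw => x _; first by rewrite lee_fin.
rewrite -EFinM lee_fin mulrC -ler_pdivrMr//.
by apply: LlogL_ge => //; rewrite divr_ge0// ltW.
Qed.

End one_set.

End luxemburg.

Section exponential_duality.
Context (R : realType) (n : nat).
Local Notation mu := (lebesgue_rV R n).
Local Open Scope ereal_scope.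

Let young_exp (u t : R) : (0 <= u)%R -> (0 <= t)%R ->
  (u * t <= 2 * (LlogL 1 t + expR u))%R.
Proof.
move=> u0 t0.
have pt : (0 <= LlogL 1 t)%R by apply: LlogL_ge0.
have [h|h] := leP u (2 * Num.max 0 (ln t))%R.
  apply: (@le_trans _ _ (2 * LlogL 1 t)%R); last by rewrite ler_wpM2l// lerDl expR_ge0.
  have m0 : (0 <= Num.max 0 (ln t))%R by rewrite le_max lexx.
  rewrite /LlogL powRr1 ?addr_ge0//.
  apply: (le_trans (ler_wpM2r t0 h)).
  rewrite mulrAC -!mulrA ler_wpM2l// ler_wpM2l// lerDr//.
apply: (@le_trans _ _ (2 * expR u)%R); last by rewrite ler_wpM2l// lerDr.
have te : (t <= expR (u / 2))%R.
  move: t0; rewrite le_eqVlt => /predU1P[<-|t0]; first exact: expR_ge0.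
  rewrite -[leLHS](lnK (t0 : t \is Num.pos)) ler_expR.
  apply: (@le_trans _ _ (Num.max 0 (ln t)))%R; first by rewrite le_max lexx orbT.
  by rewrite ler_pdivlMr// mulrC ltW.
have ue : (u / 2 <= expR (u / 2))%R.
  by apply: le_trans (expR_ge1Dx _); rewrite lerDr.
rewrite [leLHS](_ : _ = 2 * ((u / 2) * t))%R; last by field.
rewrite ler_wpM2l//.
rewrite [X in expR X](_ : u = u / 2 + u / 2)%R; last by rewrite -splitr.
by rewrite expRD ler_pM// divr_ge0.
Qed.

(** The duality of L log L and exp L, from Young's inequality
    u t <= 2 (t (1 + log^+ t) + e^u), integrated with t = |f| / lam for an admissible
    lam and u = s ln eta. *)
Lemma exp_LlogL_duality (f s : 'rV[R]_n -> R) (Mf eta D : R) Q v :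
  measurable_fun setT f -> (forall x, (`|f x| <= Mf)%R) ->
  measurable_fun setT s -> (forall x, (0 <= s x)%R) ->
  measurable Q -> (0 < v)%R -> mu Q = v%:E -> (1 < eta)%R -> (0 <= D)%R ->
  \int[mu]_(x in Q) (eta `^ s x)%:E <= D%:E * mu Q ->
  \int[mu]_(x in Q) (s x * `|f x|)%:E <=
    (2 / ln eta * (1 + D) * (lux 1 f Q * v))%:E.
Proof.
move=> mf bf ms s0 mQ v0 muQ eta1 D0 hs.
have l0 : (0 < ln eta)%R by rewrite ln_gt0.
have eta0 : (0 < eta)%R by exact: lt_trans eta1.
set c := (2 / ln eta * (1 + D))%R.
have c0 : (0 <= c)%R by rewrite !mulr_ge0 ?invr_ge0 ?(ltW l0)// addr_ge0.
rewrite [(c * _)%R](_ : _ = c * v * lux 1 f Q)%R; last by ring.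
apply: (le_lux_of_admissible (ler01 : 0 <= 1)%R bf mQ v0 muQ) => //.
  by rewrite mulr_ge0// ltW.
move=> lam lam0; rewrite /admissible muQ => adm.
have K0 : (0 <= lam * (2 / ln eta))%R.
  by rewrite !mulr_ge0 ?invr_ge0 ?(ltW l0) ?(ltW lam0).
have mp : measurable_fun Q (fun x => (LlogL 1 (`|f x| / lam))%:E).
  by apply: measurable_funTS; exact: measurable_young.
have p0 x : 0 <= (LlogL 1 (`|f x| / lam))%:E.
  by rewrite lee_fin LlogL_ge0// divr_ge0// ltW.
have me : measurable_fun Q (fun x => (eta `^ s x)%:E).
  apply/measurable_funTS/measurable_EFinP.
  rewrite (_ : (fun x => eta `^ s x)%R = (fun x => expR (s x * ln eta))%R).
    by apply: (measurableT_comp (@measurable_expR R)); exact: measurable_funM.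
  by apply/funext => x; rewrite /powR gt_eqF.
apply: (@le_trans _ _ (\int[mu]_(x in Q) ((lam * (2 / ln eta))%:E *
    ((LlogL 1 (`|f x| / lam))%:E + (eta `^ s x)%:E)))).
  apply: le_integral_raw => x _; first by rewrite lee_fin mulr_ge0.
  rewrite -EFinD -EFinM lee_fin.
  have := @young_exp (s x * ln eta)%R (`|f x| / lam)%R.
  rewrite mulr_ge0 ?(ltW l0)// divr_ge0 ?(ltW lam0)// => /(_ isT isT).
  have -> : expR (s x * ln eta) = (eta `^ s x)%R by rewrite /powR gt_eqF.
  set P := (_ + _)%R => h.
  have k0 : (0 <= lam / ln eta)%R by rewrite divr_ge0// ltW.
  have := ler_wpM2l k0 h.
  rewrite [leLHS](_ : _ = s x * `|f x|)%R; last by field; rewrite !gt_eqF.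
  by rewrite [leRHS](_ : _ = lam * (2 / ln eta) * P)%R//; ring.
rewrite ge0_integralZl//; last 2 first.
- by apply: emeasurable_funD.
- by move=> x _; rewrite adde_ge0// lee_fin powR_ge0.
rewrite ge0_integralD//; last by move=> x _; rewrite lee_fin powR_ge0.
apply: (@le_trans _ _ ((lam * (2 / ln eta))%:E * (v%:E + D%:E * v%:E))).
  rewrite lee_wpmul2l ?lee_fin//; apply: leeD => //.
  by apply: le_trans hs _; rewrite muQ.
rewrite -!EFinM lee_fin /c le_eqVlt; apply/orP; left; apply/eqP.
by field; rewrite gt_eqF.
Qed.

End exponential_duality.

Section luxemburg_dyadic.
Context (R : realType) (n : nat) (alpha : R).
Hypothesis alpha0 : 0 <= alpha.
Local Notation mu := (lebesgue_rV R n).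
Local Notation psi := (LlogL alpha).
Variable f : 'rV[R]_n -> R.
Hypothesis mf : measurable_fun setT f.
Variable Mf : R.
Hypothesis bf : forall x, (`|f x| <= Mf)%R.

Definition dlux t j x : R := lux alpha f (dyadic_cube t j x).

Lemma dlux_luxemburg t j x :
  luxemburg psi f (cube (dyadic_corner t j x) (2 ^ j)) = (dlux t j x)%:E.
Proof.
rewrite /dlux -(luxE alpha bf (measurable_dyadic_cube t j x) _ (lebesgue_dyadic_cube t j x)).
  rewrite /luxemburg; congr ereal_inf; apply/seteqP.
  have e lam : mean (cube (dyadic_corner t j x) (2 ^ j)) (fun y => (psi (`|f y| / lam))%:E)
      = mean (dyadic_cube t j x) (fun y => (psi (`|f y| / lam))%:E).
    rewrite /mean integral_dyadic_cube lebesgue_cube ?expz2_gt0//.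
    by rewrite lebesgue_dyadic_cube.
  split=> _ [lam [l0 h] <-]; exists lam => //; split => //.
    by rewrite -e.
  by rewrite e.
by rewrite exprn_gt0// expz2_gt0.
Qed.

Lemma dlux_ge0 t j x : 0 <= dlux t j x.
Proof.
apply: (lux_ge0 alpha bf (measurable_dyadic_cube t j x) _ (lebesgue_dyadic_cube t j x)).
by rewrite exprn_gt0// expz2_gt0.
Qed.

Lemma dlux_cell L t k x y : dyadic R L t k x = dyadic R L t k y ->
  dlux t (L - k%:Z) x = dlux t (L - k%:Z) y.
Proof.
move=> xy; rewrite /dlux; congr lux.
by rewrite -!(cell_dyadic L t); exact: eq_cell.
Qed.

Definition lux_jump L t (B : R) p k x :=
  B * dlux t (L - p%:Z) x < dlux t (L - k%:Z) x.

Lemma lux_jump_cell L t B p k x y : (p < k)%N -> dyadic R L t k x = dyadic R L t k y ->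
  lux_jump L t B p k x = lux_jump L t B p k y.
Proof.
move=> pk xy; rewrite /lux_jump (dlux_cell xy).
by rewrite (dlux_cell (idx_le (ltnW pk) xy)).
Qed.

Local Open Scope ereal_scope.

(** After division of f by twice its norm over the larger cube, its Young function has
    average at most 1 there and, as psi (t / B) <= psi t / B, average at least B / 2
    over every cube where the norm has jumped: the weak type bound applies. *)
Lemma lux_jump_small L t (B : R) F p x : (2 <= B)%R ->
  mu (cell (dyadic R L t) p x `&`
      [set y | stopped (lux_jump L t B) F p p.+1 y])
  <= (2 / B)%:E * mu (cell (dyadic R L t) p x).
Proof.
move=> B2; have B0 : (0 < B)%R by exact: lt_le_trans B2.
set q := dyadic R L t; set Q := cell q p x.
have mQ : measurable Q by exact: measurable_cell.
have vol k y : mu (cell q k y) = ((2 ^ (L - k%:Z)) ^+ n)%:E.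
  by rewrite cell_dyadic lebesgue_dyadic_cube.
have vol0 k : (0 < (2 ^ (L - k%:Z)) ^+ n :> R)%R by rewrite exprn_gt0// expz2_gt0.
have dluxE k y : dlux t (L - k%:Z) y = lux alpha f (cell q k y).
  by rewrite /dlux -cell_dyadic.
have sj := @lux_jump_cell L t B.
have mst : measurable [set y | stopped (lux_jump L t B) F p p.+1 y].
  exact: (measurable_stopped sj).
have lx0 k y : (0 <= lux alpha f (cell q k y))%R by rewrite -dluxE; exact: dlux_ge0.
have adm k y lam : (lux alpha f (cell q k y) < lam)%R ->
    admissible alpha f (cell q k y) lam.
  exact: (lux_lt_admissible alpha0 bf (measurable_cell q k y) (vol0 k) (vol k y)).
have le k y lam : (0 < lam)%R -> admissible alpha f (cell q k y) lam ->
    (lux alpha f (cell q k y) <= lam)%R.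
  exact: (lux_le bf (measurable_cell q k y) (vol0 k) (vol k y)).
have p0 y lam : (0 < lam)%R -> 0 <= (psi (`|f y| / lam))%:E.
  by move=> l0; rewrite lee_fin LlogL_ge0// divr_ge0// ltW.
have [lz|lN] := eqVneq (lux alpha f Q) 0%R.
  (* if the norm over Q vanishes, so do the norms over all cubes inside Q *)
  rewrite [X in mu X](_ : _ = set0).
    by rewrite measure0 mule_ge0// lee_fin divr_ge0// ltW.
  apply/seteqP; split => // y [Qy /= /stoppedP[k /andP[pk _]]].
  rewrite /lux_jump !dluxE (eq_cell (Qy : q p y = q p x)) -/Q lz mulr0.
  apply/negP; rewrite -leNgt; apply/ler_addgt0Pr => e e0; rewrite add0r.
  apply: le => //.
  pose r := ((2 ^ (L - p%:Z)) ^+ n / (2 ^ (L - k%:Z)) ^+ n : R)%R.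
  have PQ : cell q k y `<=` Q.
    by rewrite /Q -(eq_cell (Qy : q p y = q p x)); apply: cellS; exact: ltnW.
  have r1 : (1 <= r)%R.
    rewrite /r ler_pdivlMr// mul1r -lee_fin -(vol k y) -(vol p x).
    by apply: le_measure; rewrite ?inE//; exact: measurable_cell.
  have r0 : (0 < r)%R by exact: lt_le_trans r1.
  have er0 : (0 < e / r)%R by rewrite divr_gt0.
  have aQ : admissible alpha f Q (e / r) by apply: adm; rewrite -/Q lz.
  rewrite /admissible.
  apply: (@le_trans _ _ (\int[mu]_(z in Q) (r^-1%:E * (psi (`|f z| / (e / r)))%:E))).
    apply: (@le_trans _ _ (\int[mu]_(z in cell q k y) (r^-1%:E * (psi (`|f z| / (e / r)))%:E))).
      apply: le_integral_raw => z _; first exact: p0.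
      rewrite -EFinM lee_fin.
      have := @LlogL_scale _ _ alpha0 (`|f z| / (e / r))%R r.
      rewrite divr_ge0 ?(ltW er0)// => /(_ isT r1).
      by rewrite (_ : `|f z| / (e / r) / r = `|f z| / e)%R//; field; rewrite !gt_eqF.
    apply: ge0_subset_integral => //; first exact: measurable_cell.
      by apply/measurable_funTS/measurable_funeM; exact: measurable_young.
    by move=> z _; rewrite mule_ge0 ?p0// lee_fin invr_ge0 ltW.
  rewrite ge0_integralZl//; last 3 first.
  - by apply/measurable_funTS; exact: measurable_young.
  - by move=> z _; exact: p0.
  - by rewrite lee_fin invr_ge0 ltW.
  rewrite lee_pdivrMl//; apply: le_trans aQ _.
  rewrite (vol p x) (vol k y) -EFinM lee_fin /r divfK// gt_eqF//.
have lp : (0 < lux alpha f Q)%R by rewrite lt_def lN lx0.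
pose lam := (2 * lux alpha f Q)%R.
have lam0 : (0 < lam)%R by rewrite mulr_gt0.
have aQ : admissible alpha f Q lam by apply: adm; rewrite /lam ltr_pMl// ltr1n.
have W : (B / 2)%:E * mu (Q `&` [set y | stopped (lux_jump L t B) F p p.+1 y]) <= mu Q.
  apply: le_trans aQ.
  apply: (@stopped_weak_type _ _ _ q (lux_jump L t B) sj mu) => //.
  - by rewrite divr_ge0// ltW.
  - exact: measurable_young.
  - by move=> z; exact: p0.
  - exact: saturated_cell.
  move=> k y pk Qy; rewrite /lux_jump !dluxE (eq_cell (Qy : q p y = q p x)) -/Q => jmp.
  have B2lam0 : (0 < B / 2 * lam)%R by rewrite mulr_gt0// divr_gt0.
  have nadm : ~ admissible alpha f (cell q k y) (B / 2 * lam).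
    move=> /(le _ _ _ B2lam0); apply/negP; rewrite -ltNge.
    by rewrite (_ : B / 2 * lam = B * lux alpha f Q)%R// /lam; field.
  move/negP : nadm; rewrite -ltNge => /ltW h.
  have B20 : (0 < B / 2)%R by rewrite divr_gt0.
  rewrite -lee_pdivlMl//; apply: le_trans h _.
  rewrite -ge0_integralZl//; last 4 first.
  - exact: measurable_cell.
  - by apply/measurable_funTS; exact: measurable_young.
  - by move=> z _; exact: p0.
  - by rewrite lee_fin invr_ge0 ltW.
  apply: le_integral_raw => z _; first exact: p0.
  rewrite -EFinM lee_fin.
  have := @LlogL_scale _ _ alpha0 (`|f z| / lam)%R (B / 2)%R.
  rewrite divr_ge0 ?(ltW lam0)// ler_pdivlMr// mul1r => /(_ isT B2).
  by rewrite (_ : `|f z| / lam / (B / 2) = `|f z| / (B / 2 * lam))%R//; field; rewrite !gt_eqF.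
rewrite (_ : 2 / B = (B / 2)^-1)%R; last by rewrite invf_div.
by rewrite lee_pdivlMl ?divr_gt0.
Qed.

End luxemburg_dyadic.

(** * Pointwise bounds of the operators *)

Section integer_sums.
Context (R : realType).
Implicit Types (j : int) (N : nat).

Definition sumZ N (h : int -> \bar R) : \bar R :=
  (\sum_(k < (2 * N).+1) h (N%:Z - k%:Z)%R)%E.

Lemma sumZ_ge N (h : int -> \bar R) j : (forall i, 0 <= h i)%E ->
  (`|j| <= N)%N -> (h j <= sumZ N h)%E.
Proof.
move=> h0 jN; have kN : (`|(N%:Z - j)%R|%N < (2 * N).+1)%N by lia.
rewrite /sumZ (bigD1 (Ordinal kN))//=.
have -> : N%:Z - `|(N%:Z - j)%R|%N%:Z = j by lia.
by rewrite leeDl// sume_ge0.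
Qed.

Lemma sumZ_le N (h : int -> \bar R) : (forall i, 0 <= h i)%E ->
  (sumZ N h <= sumZ N.+1 h)%E.
Proof.
move=> h0; rewrite /sumZ (_ : (2 * N.+1).+1 = (2 * N).+3)%N; last by rewrite mulnS.
rewrite [leRHS]big_ord_recl [X in (_ <= _ + X)%E]big_ord_recr/=.
apply: (@le_trans _ _ (\sum_(k < (2 * N).+1) h (N.+1%:Z - (bump 0 k)%:Z)%R)%E).
  apply: lee_sum => k _; rewrite (_ : N%:Z - k%:Z = N.+1%:Z - (bump 0 k)%:Z)//.
  by rewrite /bump leq0n; lia.
rewrite addeCA leeDl// adde_ge0//.
Qed.

Lemma sumZ_nd (h : int -> \bar R) : (forall i, 0 <= h i)%E ->
  {homo (fun N => sumZ N h) : M N / (M <= N)%N >-> (M <= N)%E}.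
Proof. by move=> h0; apply/nondecreasing_seqP => N; exact: sumZ_le. Qed.

Lemma lee_prod (I : Type) (s : seq I) (f g : I -> \bar R) :
  (forall i, 0 <= f i)%E -> (forall i, f i <= g i)%E ->
  (\prod_(i <- s) f i <= \prod_(i <- s) g i)%E.
Proof.
move=> f0 fg; elim: s => [|i s IH]; first by rewrite !big_nil.
by rewrite !big_cons; apply: lee_pmul => //; exact: prode_ge0.
Qed.

Lemma pow2_shell (s : R) : 0 < s -> exists j : int, 2 ^ j < s <= 2 ^ (j + 1).
Proof.
move=> s0; have l2 : 0 < ln 2 :> R by rewrite ln_gt0// ltr1n.
have E (j : int) : 2 ^ j = expR (j%:~R * ln 2) :> R.
  by rewrite -powR_intmul// /powR pnatr_eq0.
pose u := ln s / ln 2.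
have su : s = expR (u * ln 2) by rewrite /u divfK ?gt_eqF// lnK.
exists (Num.ceil u - 1); rewrite subrK !E su ltr_expR ler_expR ltr_pM2r// ler_pM2r//.
by have := ceil_itv u; rewrite intrB.
Qed.

End integer_sums.

Lemma expz2_add4 (R : realType) (j : int) : 2 ^ (j + 4)%Z = 16 * 2 ^ j :> R.
Proof.
by rewrite (_ : (j + 4)%Z = j + 1 + 1 + 1 + 1); [rewrite !expz2S; ring|lia].
Qed.

Section annulus.
Context (R : realType) (m n : nat).
Implicit Types y : 'M[R]_(m, n).

Lemma coord_le_euclidean (x : 'rV[R]_n) i : `|x 0 i| <= euclidean_norm x.
Proof.
rewrite /euclidean_norm -sqrtr_sqr ler_wsqrtr//.
by rewrite (bigD1 i)//= lerDl sumr_ge0// => j _; exact: sqr_ge0.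
Qed.

Lemma euclidean_norm_ge0 (x : 'rV[R]_n) : 0 <= euclidean_norm x.
Proof. exact: sqrtr_ge0. Qed.

Lemma coord_le_sum_norm y i j : `|y i j| <= \sum_k euclidean_norm (row k y).
Proof.
have := coord_le_euclidean (row i y) j; rewrite mxE => /le_trans; apply.
by rewrite (bigD1 i)//= lerDl sumr_ge0// => k _; exact: euclidean_norm_ge0.
Qed.

Lemma sum_norm_eq0 y : \sum_k euclidean_norm (row k y) = 0 -> y = 0.
Proof.
move=> e; apply/matrixP => i j; rewrite mxE; apply/eqP.
by rewrite -normr_le0 -e coord_le_sum_norm.
Qed.

End annulus.

Section potential_bound.
Context (R : realType) (m n : nat) (phi : 'M[R]_(m, n) -> R) (tau eps : R).
Hypothesis n0 : (0 < n)%N.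
Hypothesis m0 : (0 < m)%N.
Hypothesis hphi : condition_D phi tau eps.
Local Notation mum := (lebesgue_mx R m n).
Local Notation mu := (lebesgue_rV R n).

Let phi0 y : 0 <= phi y. Proof. by case: hphi. Qed.

Definition annulus_mass (j : int) : \bar R :=
  (\int[mum]_(y in @annulus R m n (2 ^ j) tau eps) (phi y)%:E)%E.

Lemma integral_phi_bounded (D : set 'M[R]_(m, n)) (c : R) :
  (forall y, D y -> forall i j, `|y i j| <= c) ->
  (\int[mum]_(y in D) (phi y)%:E < +oo)%E.
Proof.
move=> Dc; have [_ [_ iphi] _ _ _] := hphi.
apply: le_lt_trans (iphi _ (@compact_mx_box R m n c)).
rewrite integral_mkcond [leRHS]integral_mkcond.
apply: le_integral_raw => y _; rewrite !patchE.
  by case: ifP => //; rewrite lee_fin.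
case: ifPn => [|_]; last by case: ifP => // _; exact: abse_ge0.
rewrite inE => Dy; rewrite mem_set; last exact: Dc.
by rewrite lee_fin ler_norm.
Qed.

Definition mass j : R := fine (annulus_mass j).

Lemma mass_ge0 j : 0 <= mass j.
Proof. by apply: fine_ge0; apply: integral_ge0 => y _; rewrite lee_fin. Qed.

Lemma massE j : annulus_mass j = (mass j)%:E.
Proof.
rewrite /mass fineK// ge0_fin_numE; last by apply: integral_ge0 => y _; rewrite lee_fin.
apply: (@integral_phi_bounded _ (tau * (1 + eps) * (2 * 2 ^ j))) => y /andP[_ h] i k.
exact: le_trans (coord_le_sum_norm y i k) h.
Qed.

Lemma kernel_le_mass : exists2 C : R, 0 < C & forall (j : int) y,
  2 ^ j < \sum_i euclidean_norm (row i y) <= 2 ^ (j + 1) ->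
  phi y <= C / (2 ^ j) ^+ (n * m) * mass j.
Proof.
have [_ _ _ _ [C C0 hC]] := hphi; exists C => // j y hy.
rewrite -lee_fin EFinM -massE.
have -> : (C / (2 ^ j) ^+ (n * m) = C / 2 ^ (j * n%:Z * m%:Z))%R.
  by rewrite [(2 ^ j) ^+ _]exprnP exprz_exp PoszM mulrA.
apply: le_trans (hC j); apply: ereal_sup_ubound; exists y => //.
by rewrite /annulus/= subr0 addr0 !mul1r -expz2S.
Qed.

Local Open Scope ereal_scope.

(** The kernel is majorized on the shell of radius 2^j by a constant, and the shell
    lies in a product of balls, each contained in a cube of side 16 2^j of one of
    the shifted grids. *)
Lemma potential_le_cubes : exists2 C : R, (0 < C)%R &
  forall x (F : 'I_m -> 'rV[R]_n -> R),
  (forall i, measurable_fun setT (F i)) -> (forall i y, (0 <= F i y)%R) ->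
  \int[mum]_y (phi (\matrix_i (x - row i y))%R * \prod_i F i (row i y))%:E <=
  limn (fun N => sumZ N (fun j =>
    (C / (2 ^ j) ^+ (n * m) * mass j)%:E *
    \sum_(t : {ffun 'I_n -> bool})
      \prod_i \int[mu]_(y in dyadic_cube t (j + 4) x) (F i y)%:E)).
Proof.
have [C C0 hC] := kernel_le_mass; exists C => // x F mF F0.
pose c j : R := (C / (2 ^ j) ^+ (n * m) * mass j)%R.
have c0 j : (0 <= c j)%R.
  by rewrite /c mulr_ge0 ?mass_ge0// divr_ge0 ?(ltW C0)// exprn_ge0// ltW// expz2_gt0.
pose ball j : set 'rV[R]_n := [set y | forall l, (`|y 0%R l - x 0%R l| <= 2 * 2 ^ j)%R].
have mball j : measurable (ball j).
  rewrite (_ : ball j = [set y : 'rV[R]_n | forall l,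
      `[(x 0 l - 2 * 2 ^ j)%R, (x 0 l + 2 * 2 ^ j)%R]%classic (y 0%R l)]).
    exact: (@measurable_box R n (fun l => `[(x 0 l - 2 * 2 ^ j)%R, (x 0 l + 2 * 2 ^ j)%R]%classic)).
  apply/seteqP; split => y H l; have := H l; rewrite /= in_itv/= ler_norml;
  by move=> /andP[h1 h2]; apply/andP; split; lra.
pose H j (y : 'M[R]_(m, n)) : \bar R :=
  \prod_i (F i (row i y) * \1_(ball j) (row i y))%:E.
have mFb j i : measurable_fun setT (fun y => (F i y * \1_(ball j) y)%:E).
  by apply/measurable_EFinP; apply: measurable_funM.
have Fb0 j i y : 0 <= (F i y * \1_(ball j) y)%:E by rewrite lee_fin mulr_ge0.
have H0 j y : 0 <= H j y by apply: prode_ge0 => i _; exact: Fb0.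
have mH j : measurable_fun setT (H j).
  apply: emeasurable_prod => i; apply: (measurableT_comp (mFb j i)).
  exact: measurable_row.
pose g N y := sumZ N (fun j => (c j)%:E * H j y).
have cH0 j y : 0 <= (c j)%:E * H j y by rewrite mule_ge0// lee_fin.
have mg N : measurable_fun setT (g N).
  by apply: emeasurable_sum => k; exact/measurable_funeM.
have g0 N y : 0 <= g N y by apply: sume_ge0 => k _.
have ndg y : {homo (fun N => g N y) : M N / (M <= N)%N >-> M <= N}.
  by apply: sumZ_nd.
have gl N y : g N y <= limn (fun N => g N y).
  apply: lime_ge; first exact: ereal_nondecreasing_is_cvgn.
  by near=> M; apply: ndg; near: M; exists N.
pose diag := (@row R m n (Ordinal m0)) @^-1` [set x].
have mx1 : measurable [set x].
  rewrite (_ : [set x] = [set y : 'rV[R]_n | forall j, [set x 0%R j] (y 0%R j)]).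
    exact: (@measurable_box R n (fun j => [set x 0%R j])).
  by apply/seteqP; split => [y -> //|y h]; apply/rowP => j; exact: h.
have [mdiag diag0] := null_row (Ordinal m0) mx1 (lebesgue_rV_set1 x n0).
apply: (@le_trans _ _ (\int[mum]_y limn (fun N => g N y))).
  apply: (le_integral_off_null mdiag diag0) => y _.
  - by rewrite lee_fin mulr_ge0// prodr_ge0.
  - exact: le_trans (gl 0%N y).
  move=> ndy; set z := (\matrix_i (x - row i y))%R.
  have : (0 < \sum_i euclidean_norm (row i z))%R.
    rewrite lt_neqAle sumr_ge0// ?andbT => [|i _]; last exact: euclidean_norm_ge0.
    rewrite eq_sym; apply/eqP => /sum_norm_eq0 z_0; apply: ndy.
    have : row (Ordinal m0) z = 0%R by rewrite z_0 row0.
    by rewrite rowK => /eqP; rewrite subr_eq0 => /eqP ->.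
  move=> /pow2_shell[j hj].
  apply: le_trans (gl `|j|%N y).
  apply: le_trans (@sumZ_ge _ _ _ j _ (leqnn _)); last by move=> i; exact: cH0.
  rewrite EFinM; apply: lee_pmul => //; [by rewrite lee_fin|by rewrite lee_fin prodr_ge0|by rewrite lee_fin; exact: hC|].
  rewrite /H prodEFin lee_fin le_eqVlt; apply/orP; left; apply/eqP.
  apply: eq_bigr => i _; rewrite indicE mem_set ?mulr1// /ball/= => l.
  have := coord_le_sum_norm z i l; rewrite !mxE distrC => /le_trans; apply.
  by case/andP: hj => _; rewrite expz2S.
rewrite monotone_convergence//.
apply: lee_lim.
- apply: ereal_nondecreasing_is_cvgn => M N MN.
  by apply: le_integral_raw => y _; [exact: g0|exact: ndg].
- apply: ereal_nondecreasing_is_cvgn; apply: sumZ_nd => j.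
  apply: mule_ge0; first by rewrite lee_fin; exact: c0.
  apply: sume_ge0 => t _; apply: prode_ge0 => i _; apply: integral_ge0 => y _.
  by rewrite lee_fin.
apply: nearW => N; rewrite /g /sumZ ge0_integral_sum//; last first.
  by move=> k; exact/measurable_funeM.
apply: lee_sum => k _; set j := (_ - _)%R.
rewrite ge0_integralZl//; last by rewrite lee_fin.
rewrite lee_wpmul2l ?lee_fin//.
rewrite /H (integral_mx_prod (F := fun i y => (F i y * \1_(ball j) y)%:E))//.
have [t ht] := @dyadic_cube_contains_ball R n (j + 4) x.
rewrite (bigD1 t)//=; apply: (@le_trans _ _
  (\prod_i \int[mu]_(y in dyadic_cube t (j + 4) x) (F i y)%:E)); last first.
  rewrite leeDl//; apply: sume_ge0 => t' _; apply: prode_ge0 => i _.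
  by apply: integral_ge0 => y _; rewrite lee_fin.
apply: lee_prod => i; first by apply: integral_ge0 => y _; exact: Fb0.
rewrite [leRHS]integral_mkcond; apply: le_integral_raw => y _; first exact: Fb0.
rewrite patchE indicE; case: (boolP (y \in ball j)) => [|_]; last first.
  by rewrite mulr0; case: ifP => // _; rewrite lee_fin.
rewrite inE => by_; rewrite mulr1 mem_set//; apply: ht => l.
apply: le_trans (by_ l) _.
rewrite expz2_add4.
by have := expz2_gt0 R j; lra.
Unshelve. all: by end_near. Qed.

End potential_bound.

Section borel_reduction.
Context (R : realType) (m n : nat) (phi : 'M[R]_(m, n) -> R) (tau eps : R).
Hypothesis hphi : condition_D phi tau eps.
Local Notation mum := (lebesgue_mx R m n).
Local Notation mu := (lebesgue_rV R n).
Local Open Scope ereal_scope.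

Let phi0 y : (0 <= phi y)%R. Proof. by case: hphi. Qed.

Lemma eq_potential_off_null (f g : 'I_m -> 'rV[R]_n -> R) (N : 'I_m -> set 'rV[R]_n) x :
  (forall i, measurable (N i)) -> (forall i, mu (N i) = 0) ->
  (forall i y, ~ N i y -> f i y = g i y) ->
  potential phi f x = potential phi g x.
Proof.
move=> mN N0 fg.
pose Z (k : nat) := if insub k is Some i then (@row R m n i) @^-1` N i else set0.
have [mZ Z0] : (forall k, measurable (Z k)) /\ (forall k, mum (Z k) = 0).
  by split=> k; rewrite /Z; case: insubP => // i _ _; have [] := null_row i (mN i) (N0 i).
rewrite /potential.
have UZ0 : mum (\bigcup_k Z k) = 0 by exact: null_bigcup.
have mUZ := bigcupT_measurable _ mZ.
apply: (eq_integral_off_null mUZ UZ0) => y _ nZ.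
congr (_ * _)%R%:E; apply: eq_bigr => i _; apply: fg => Ny; apply: nZ.
by exists (val i) => //; rewrite /Z valK.
Qed.

Lemma abse_potential_le (f : 'I_m -> 'rV[R]_n -> R) x :
  `| potential phi f x | <=
  \int[mum]_y (phi (\matrix_i (x - row i y))%R * \prod_i `|f i (row i y)|)%:E.
Proof.
apply: le_trans (abse_integral_le_raw _ _ _) _.
apply: le_integral_raw => y _ //.
by rewrite /= lee_fin normrM ger0_norm// normr_prod.
Qed.

Variables (f : 'I_m -> 'rV[R]_n -> R) (Mf c : R).
Hypothesis mf : forall i, measurable_fun setT (f i).
Hypothesis bf : forall i y, (`|f i y| <= Mf)%R.
Hypothesis sf : forall i y, (f i y != 0)%R -> forall l, (`|y 0%R l| <= c)%R.
Hypothesis Mf0 : (0 <= Mf)%R.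

Let measurable_prod_rows (g : 'I_m -> 'rV[R]_n -> R) :
  (forall i, measurable_fun setT (g i)) ->
  measurable_fun setT (fun y : 'M[R]_(m, n) => \prod_i g i (row i y))%R.
Proof.
move=> mg; apply/measurable_EFinP.
rewrite (_ : _ \o _ = fun y => \prod_i (g i (row i y))%:E).
  apply: emeasurable_prod => i; apply/measurable_EFinP.
  apply: (measurableT_comp (mg i)); exact: measurable_row.
by apply/funext => y; rewrite prodEFin.
Qed.

(** The two integrals of the commutator combine into one with the factor b x - b y
    as soon as the potential of f at x is finite, which follows from the local
    integrability of the kernel because f is bounded with bounded support. *)
Lemma commutator_at_le (b : 'I_m -> 'rV[R]_n -> R) j x :
  measurable_fun setT (b j) ->
  `| commutator_at phi j b f x | <=
  \int[mum]_y (phi (\matrix_i (x - row i y))%R *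
     \prod_i (if i == j then `|b j x - b j (row i y)| * `|f i (row i y)|
              else `|f i (row i y)|))%:E.
Proof.
move=> mb; have [_ [mphi _] _ _ _] := hphi.
have [phi' mphi' [N [mN N0 phiE _]]] := borel_representative mphi.
pose S (y : 'M[R]_(m, n)) := (\matrix_i (x - row i y))%R : 'M[R]_(m, n).
have [mS muS] := @lebesgue_mx_reflect R m n x.
have mSN : measurable (S @^-1` N) by rewrite -[X in measurable X]setTI; exact: mS.
have SN0 : mum (S @^-1` N) = 0 by rewrite muS.
pose g y := (phi' (S y) * \prod_i f i (row i y))%R.
have mg : measurable_fun setT g.
  apply: measurable_funM; first exact: measurableT_comp.
  exact: measurable_prod_rows.
have gE y : ~ (S @^-1` N) y -> (phi (S y) * \prod_i f i (row i y) = g y)%R.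
  by move=> nN; rewrite /g phiE.
pose bj y := b j (row j y).
have mbj : measurable_fun setT bj by apply: (measurableT_comp mb); exact: measurable_row.
have E1 : potential phi f x = \int[mum]_y (g y)%:E.
  by apply: (eq_integral_off_null mSN SN0) => y _ nN; rewrite -gE.
have prodj (h : 'rV[R]_n -> R) (y : 'M[R]_(m, n)) (u : 'I_m -> 'rV[R]_n -> R) :
    (\prod_i (if i == j then h (row i y) * u i (row i y) else u i (row i y)) =
    h (row j y) * \prod_i u i (row i y))%R.
  rewrite (bigD1 j)//= eqxx [in RHS](bigD1 j)//= mulrA; congr (_ * _)%R.
  by apply: eq_bigr => i /negbTE ->.
have E2 : potential phi (fun i => if i == j then (b j \* f j)%R else f i) x =
    \int[mum]_y (bj y * g y)%:E.
  apply: (eq_integral_off_null mSN SN0) => y _ nN; congr EFin.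
  rewrite -gE// mulrCA; congr (_ * _)%R.
  rewrite /bj -(prodj (b j) y f); apply: eq_bigr => i _.
  by case: eqP => // ->.
pose dj y := (b j x - bj y)%R.
have mdj : measurable_fun setT dj by apply: measurable_funB.
have E3 : \int[mum]_y (phi (\matrix_i (x - row i y))%R *
     \prod_i (if i == j then `|b j x - b j (row i y)| * `|f i (row i y)|
              else `|f i (row i y)|))%:E = \int[mum]_y `|(dj y * g y)%:E|.
  apply: (eq_integral_off_null mSN SN0) => y _ nN; congr EFin.
  rewrite (prodj (fun z => `|b j x - b j z|)%R y (fun i z => `|f i z|)%R).
  by rewrite normrM -gE// normrM normr_prod (ger0_norm (phi0 _)) mulrCA.
have igfin : \int[mum]_y `|(g y)%:E| < +oo.
  pose xm := (\sum_l `|x 0%R l|)%R.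
  have xl l : (`|x 0 l| <= xm)%R by rewrite /xm (bigD1 l)//= lerDl sumr_ge0.
  pose Box := [set z : 'M[R]_(m, n) | forall i l, (`|z i l| <= c + xm)%R].
  have mBox : measurable Box.
    rewrite (_ : Box = \bigcap_(i : 'I_m) (@row R m n i @^-1`
      [set z : 'rV[R]_n | forall l, `[(- (c + xm))%R, (c + xm)%R]%classic (z 0%R l)])).
      apply: fin_bigcap_measurable => // i _; rewrite -[X in measurable X]setTI.
      apply: measurable_row => //.
      exact: (@measurable_box R n (fun l => `[(- (c + xm))%R, (c + xm)%R]%classic)).
    apply/seteqP; split => z H i; first by move=> _ l /=; rewrite mxE in_itv/= -ler_norml.
    by move=> l; have := H i I l; rewrite /= mxE in_itv/= -ler_norml.
  pose h z := (`|phi' z| * \1_Box z)%:E.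
  have mh : measurable_fun setT h.
    by apply/measurable_EFinP; apply: measurable_funM => //; exact: measurableT_comp.
  have h0 z : 0 <= h z by rewrite lee_fin mulr_ge0.
  have hS : \int[mum]_y h (S y) = \int[mum]_z h z.
    transitivity (\int[pushforward mum S]_z h z).
      by rewrite (ge0_integral_pushforward mS)// => z _; exact: h0.
    by apply: eq_measure_integral => A mA _; exact: muS.
  have hfin : \int[mum]_z h z < +oo.
    apply: le_lt_trans (integral_phi_bounded hphi (D := Box) (c := (c + xm)%R) _); last by [].
    rewrite [leRHS]integral_mkcond; apply: (le_integral_off_null mN N0) => z _ //.
      by rewrite patchE; case: ifP => //; rewrite lee_fin.
    move=> nN; rewrite /h patchE indicE; case: ifP => _; last by rewrite mulr0.
    by rewrite mulr1 -phiE// ger0_norm.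
  apply: (@le_lt_trans _ _ ((Mf ^+ m)%:E * \int[mum]_y h (S y))); last first.
    by rewrite hS; apply: lte_mul_pinfty => //; rewrite lee_fin exprn_ge0.
  rewrite -ge0_integralZl//; last 2 first.
  - by apply: measurableT_comp.
  - by rewrite lee_fin exprn_ge0.
  apply: le_integral_raw => y _ //.
  rewrite /h -EFinM lee_fin /g normrM mulrCA.
  rewrite ler_wpM2l//.
  have [/existsP[i /eqP fi0]|/existsPn fN] :=
      boolP [exists i, f i (row i y) == 0%R].
    by rewrite (bigD1 i)//= fi0 mul0r normr0 mulr_ge0// exprn_ge0.
  rewrite indicE mem_set.
    rewrite mulr1 normr_prod -[m in leRHS]card_ord -prodr_const.
    by apply: ler_prod => i _; rewrite normr_ge0 bf.
  move=> i l; rewrite /S !mxE; apply: le_trans (ler_normB _ _) _.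
  rewrite addrC lerD//; have := sf (fN i) l; by rewrite mxE.
have ig : mum.-integrable setT (EFin \o g).
  by apply/integrableP; split => //; exact/measurable_EFinP.
have [Doo|Dfin] := eqVneq (\int[mum]_y `|(dj y * g y)%:E|) +oo.
  by rewrite E3 Doo leey.
have id : mum.-integrable setT (EFin \o (fun y => dj y * g y)%R).
  apply/integrableP; split; last by rewrite ltey.
  by apply/measurable_EFinP; exact: measurable_funM.
rewrite E3 /commutator_at E1 E2.
have e : \int[mum]_y (bj y * g y)%:E =
    (b j x)%:E * \int[mum]_y (g y)%:E - \int[mum]_y (dj y * g y)%:E.
  rewrite -integralZl// -integralB//; last exact: integrableZl.
  apply: eq_integral => y _; rewrite /= -EFinM -EFinB; congr EFin.
  by rewrite /dj; ring.
rewrite e; have fP := integrable_fin_num measurableT ig.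
have fD := integrable_fin_num measurableT id.
rewrite -[X in _ * X - (_ * X - _)](fineK fP) -[X in _ - (_ - X)](fineK fD).
rewrite -EFinM -!EFinB opprB addrC subrK fineK//.
exact: abse_integral_le_raw.
Qed.

End borel_reduction.

(** * Domination by the maximal operator *)

Section maximal_operator.
Context (R : realType) (m n : nat) (phi : 'M[R]_(m, n) -> R) (tau eps : R).
Hypothesis hphi : condition_D phi tau eps.
Local Notation mu := (lebesgue_rV R n).
Local Open Scope ereal_scope.

Lemma eq_maximal_off_null (e alpha : R) (f g : 'I_m -> 'rV[R]_n -> R)
    (N : 'I_m -> set 'rV[R]_n) x :
  (forall i, measurable (N i)) -> (forall i, mu (N i) = 0) ->
  (forall i y, ~ N i y -> f i y = g i y) ->
  maximal phi tau eps e alpha f x = maximal phi tau eps e alpha g x.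
Proof.
move=> mN N0 fg; have e' i Q lam : mean Q (fun y => (LlogL alpha (`|f i y| / lam))%:E) =
    mean Q (fun y => (LlogL alpha (`|g i y| / lam))%:E).
  rewrite /mean; apply: (congr1 (fun z => _ * z)).
  apply: (eq_integral_off_null (mN i) (N0 i)) => y _ nN.
  by rewrite fg.
have E i Q : luxemburg (LlogL alpha) (f i) Q = luxemburg (LlogL alpha) (g i) Q.
  rewrite /luxemburg; apply: (congr1 (fun S => ereal_inf [set lam%:E | lam in S])).
  by apply/funext => lam; rewrite /mkset e'.
have P a l : \prod_i luxemburg (LlogL alpha) (f i) (cube a l) =
    \prod_i luxemburg (LlogL alpha) (g i) (cube a l).
  by apply: eq_bigr => i _; exact: E.
apply/eqP; rewrite eq_le; apply/andP; split; apply: ge_ereal_sup.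
  move=> _ [a [l [l0 ax ->]]]; rewrite P; apply: ereal_sup_ubound.
  by exists a, l.
move=> _ [a [l [l0 ax ->]]]; rewrite -P; apply: ereal_sup_ubound.
by exists a, l.
Qed.

(** Phi at 2^(j+4) sums over all scales up to j + 4, and the scales in the finite sum
    are at most j = N - l. *)
Lemma Phi_ge (e : R) (N : int) l K : (0 < e)%R ->
  ((\sum_(l <= i < K) mass phi tau eps (N - i%:Z) `^ e) `^ e^-1)%:E
    <= Phi phi tau eps e (2 ^ (N - l%:Z + 4)%R).
Proof.
move=> e0; rewrite /Phi -poweR_EFin.
have ei : (0 <= e^-1)%R by rewrite invr_ge0 ltW.
have pos : (0 <= \sum_(l <= i < K) mass phi tau eps (N - i%:Z) `^ e)%R.
  by apply: sumr_ge0 => i _; exact: powR_ge0.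
have term nu : 0 <= annulus_mass phi tau eps (- nu) `^ e by exact: poweR_ge0.
have h : (\sum_(l <= i < K) mass phi tau eps (N - i%:Z) `^ e)%:E <=
  \esum_(nu in [set nu : int | (ln (2 ^ (N - l%:Z + 4)%R) / ln 2^-1 <= nu%:~R :> R)%R])
     (annulus_mass phi tau eps (- nu)) `^ e.
  apply: esum_ge; pose s := [seq (- (N - i%:Z))%R | i <- index_iota l K].
  have us : uniq s.
    rewrite map_inj_uniq ?iota_uniq// => i i' /oppr_inj /addrI /oppr_inj [] //.
  exists [set` s].
    split; first exact: finite_seq.
    move=> z /= /mapP[i]; rewrite mem_index_iota => /andP[li _] ->.
    have l2 : (0 < ln 2 :> R)%R by rewrite ln_gt0// ltr1n.
    rewrite lnV ?posrE// invrN mulrN -powR_intmul// ln_powR mulfK ?gt_eqF//.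
    rewrite -rmorphN/= ler_int; lia.
  rewrite -fsbig_seq// big_map -sumEFin; apply: lee_sum => i _.
  by rewrite opprK massE// poweR_EFin.
apply: gt0_ler_poweR => //.
- by rewrite in_itv/= lee_fin pos leey.
- by rewrite in_itv/= leey andbT esum_ge0// => nu _; exact: term.
Qed.

Variable alpha : R.
Hypothesis alpha0 : (0 <= alpha)%R.

Variable f : 'I_m -> 'rV[R]_n -> R.
Variable Mf : R.
Hypothesis mf : forall i, measurable_fun setT (f i).
Hypothesis bf : forall i x, (`|f i x| <= Mf)%R.

Definition lux_prod t j x : R := (\prod_i dlux alpha (f i) t j x)%R.

Lemma lux_prod_ge0 t j x : (0 <= lux_prod t j x)%R.
Proof. by apply: prodr_ge0 => i _; exact: dlux_ge0 (bf i) _ _ _. Qed.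

Lemma lux_prod_cell L t k x y : dyadic R L t k x = dyadic R L t k y ->
  lux_prod t (L - k%:Z) x = lux_prod t (L - k%:Z) y.
Proof. by move=> xy; apply: eq_bigr => i _; exact: dlux_cell. Qed.

Lemma maximal_ge (e : R) t (N : int) l K x : (0 < e)%R ->
  ((\sum_(l <= i < K) mass phi tau eps (N - i%:Z) `^ e) `^ e^-1 *
     lux_prod t (N - l%:Z + 4) x)%:E <= maximal phi tau eps e alpha f x.
Proof.
move=> e0; set j := (_ + 4)%R.
have H : Phi phi tau eps e (2 ^ j) * \prod_i luxemburg (LlogL alpha) (f i)
    (cube (dyadic_corner t j x) (2 ^ j)) <= maximal phi tau eps e alpha f x.
  apply: ereal_sup_ubound; exists (dyadic_corner t j x), (2 ^ j).
  split => //; first exact: expz2_gt0.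
  exact/dyadic_cube_sub/dyadic_cube_self.
apply: le_trans H; rewrite EFinM.
under [X in _ <= _ * X]eq_bigr => i _ do rewrite (dlux_luxemburg alpha (bf i)).
by rewrite prodEFin lee_wpmul2r ?lee_fin ?lux_prod_ge0//; exact: Phi_ge.
Qed.

Section one_grid.
Variables (nu : {measure set 'rV[R]_n -> \bar R}) (theta : R).
Hypothesis m0 : (0 < m)%N.
Hypothesis small : forall t j x E, measurable E -> E `<=` dyadic_cube t j x ->
  mu E <= 2^-1%:E * mu (dyadic_cube t j x) ->
  nu E <= theta%:E * nu (dyadic_cube t j x).

(** The m-th power because a product of m factors jumps, the 4 m because each factor
    then jumps on a proportion 2 / (4 m) of the cube and the m exceptional sets
    together should fill at most half of it. *)
Definition jump_const (e : R) : R := ((4 * m%:R) ^+ m) `^ e.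

(** If the product jumps then one of its factors does, which happens on at most
    half of the cube. *)
Lemma lux_prod_jump_small (e : R) L t F p x : (0 < e)%R ->
  nu (cell (dyadic R L t) p x `&` [set y | stopped
    (jump (jump_const e) (fun k y => (lux_prod t (L - k%:Z) y `^ e)%R)) F p p.+1 y])
  <= theta%:E * nu (cell (dyadic R L t) p x).
Proof.
move=> e0; set q := dyadic R L t; set J := jump _ _.
have Jcell u k y z : (u < k)%N -> q k y = q k z -> J u k y = J u k z.
  move=> uk yz; rewrite /J /jump (lux_prod_cell yz).
  by rewrite (lux_prod_cell (idx_le (ltnW uk) yz)).
have mJ : measurable [set y | stopped J F p p.+1 y].
  exact: (measurable_stopped Jcell).
have mQ : measurable (cell q p x) by exact: measurable_cell.
have smallq E : measurable E -> E `<=` cell q p x ->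
    mu E <= 2^-1%:E * mu (cell q p x) -> nu E <= theta%:E * nu (cell q p x).
  by rewrite /q cell_dyadic; exact: small.
apply: smallq; first exact: measurableI.
  by move=> y [].
pose B : R := (4 * m%:R)%R.
have B2 : (2 <= B)%R.
  have : (1 <= m%:R :> R)%R by rewrite ler1n.
  rewrite /B; lra.
have B0 : (0 <= B)%R by exact: le_trans B2.
pose S (i : 'I_m) := cell q p x `&` [set y : 'rV[R]_n |
  stopped (lux_jump alpha (f i) L t B) F p p.+1 y].
pose U k := if insub k is Some i then S i else set0.
have mS i : measurable (S i).
  by apply: measurableI => //; apply: (measurable_stopped (@lux_jump_cell _ _ _ (f i) L t B)).
have muS i : mu (S i) <= (2 / B)%:E * mu (cell q p x).
  exact: (lux_jump_small alpha0 (mf i) (bf i)).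
have sub : cell q p x `&` [set y | stopped J F p p.+1 y] `<=` \big[setU/set0]_(k < m) U k.
  move=> y [Qy /= /stoppedP[k kb Jk]].
  have [i hi] : exists i, lux_jump alpha (f i) L t B p k y.
    apply/existsP; apply: contraLR Jk => /existsPn nj.
    rewrite /J /jump -leNgt /jump_const -powRM ?lux_prod_ge0 ?exprn_ge0//.
    apply: ler_powR_base; [exact: ltW|exact: lux_prod_ge0|].
    rewrite /lux_prod -/B -[m in (_ ^+ m)%R]card_ord -prodr_const -big_split/=.
    apply: ler_prod => i _; rewrite (dlux_ge0 alpha (bf i))/=.
    by rewrite leNgt; exact: nj.
  rewrite -bigcup_mkord; exists (val i) => /=; first exact: ltn_ord.
  by rewrite /U valK; split => //=; apply/stoppedP; exists k.
have mU k : measurable (U k) by rewrite /U; case: insubP => // i _ _; exact: mS.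
have := @content_subadditive _ _ _ mu _ U m (fun k _ => mU k) (measurableI _ _ mQ mJ) sub.
move=> /le_trans; apply; apply: (@le_trans _ _ (\sum_(k < m) ((2 / B)%:E * mu (cell q p x)))).
  apply: lee_sum => k _; rewrite /U; case: insubP => [i _ _|]; first exact: muS.
  by rewrite ltn_ord.
rewrite cell_dyadic lebesgue_dyadic_cube -EFinM sumEFin -EFinM lee_fin.
rewrite sumr_const card_ord -[leLHS]mulr_natl mulrA le_eqVlt; apply/orP; left; apply/eqP.
congr (_ * _)%R; rewrite /B; field.
by rewrite pnatr_eq0 -lt0n.
Qed.

End one_grid.

End maximal_operator.

Section domination.
Context (R : realType) (m n : nat) (phi : 'M[R]_(m, n) -> R) (tau eps : R).
Hypothesis hphi : condition_D phi tau eps.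
Hypothesis m0 : (0 < m)%N.
Local Notation mu := (lebesgue_rV R n).
Variable alpha : R.
Hypothesis alpha0 : 0 <= alpha.
Variables (w : 'rV[R]_n -> R) (nu : {measure set 'rV[R]_n -> \bar R}) (theta : R).
Hypothesis w0 : forall x, 0 <= w x.
Hypothesis theta01 : 0 <= theta < 1.
Hypothesis nuE : forall (f : 'rV[R]_n -> \bar R), measurable_fun setT f ->
  (forall x, 0 <= f x)%E ->
  (\int[nu]_x f x = \int[mu]_x (f x * (w x)%:E))%E.
Hypothesis nu_fin : forall t j x, (nu (dyadic_cube t j x) < +oo)%E.
Hypothesis small : forall t j x E, measurable E -> E `<=` dyadic_cube t j x ->
  (mu E <= 2^-1%:E * mu (dyadic_cube t j x) ->
  nu E <= theta%:E * nu (dyadic_cube t j x))%E.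
Variables (e r D : R).
Hypothesis e01 : 0 < e <= 1.
Hypothesis r1 : 1 <= r.
Hypothesis D0 : 0 <= D.

Let e0 : 0 < e. Proof. by case/andP: e01. Qed.
Let r0 : 0 < r. Proof. exact: lt_le_trans r1. Qed.

(** The factors that the symbols of a commutator contribute at the point x; the
    constant 1 is the case of the operator itself. The moment of order 2 p is what
    the sparse bound requires. *)
Definition multiplier (beta : {ffun 'I_n -> bool} -> int -> 'rV[R]_n -> R) :=
  [/\ forall t j x, 0 <= beta t j x,
      forall t j, measurable_fun setT (beta t j) &
      forall t j x, (\int[nu]_(y in dyadic_cube t j x) (beta t j y `^ (2 * (e * r)))%:E
        <= D%:E * nu (dyadic_cube t j x))%E].

Let measurable_bigmax (I : Type) (s : seq I) (F : I -> 'rV[R]_n -> R) :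
  (forall i, measurable_fun setT (F i)) ->
  measurable_fun setT (fun y => \big[Num.max/0]_(i <- s) F i y).
Proof.
move=> mF; elim: s => [|i s IH].
  by rewrite (_ : (fun _ => _) = cst 0)//; apply/funext => y; rewrite big_nil.
rewrite (_ : (fun _ => _) = F i \max (fun y => \big[Num.max/0]_(i <- s) F i y)).
  exact: measurable_maxr.
by apply/funext => y; rewrite big_cons.
Qed.

Local Open Scope ereal_scope.

(** The case p = e r of the sparse bound, for the e-th powers: for p at most one
    the e-th power of a sum is at most the sum of the e-th powers, which is how
    the exponent of the masses in Phi arises. *)
Lemma one_grid_bound : exists2 C : R, (0 <= C)%R &
  forall (f : 'I_m -> 'rV[R]_n -> R) (Mf : R),
  (forall i, measurable_fun setT (f i)) -> (forall i x, (`|f i x| <= Mf)%R) ->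
  forall beta, multiplier beta -> forall t (N : nat),
  \int[nu]_y ((\sum_(l < (2 * N).+1) mass phi tau eps (N%:Z - l%:Z) *
      lux_prod alpha f t (N%:Z - l%:Z + 4) y * beta t (N%:Z - l%:Z + 4)%R y)
      `^ (e * r))%:E
  <= C%:E * \int[mu]_y (maximal phi tau eps e alpha f y `^ (e * r) * (w y)%:E).
Proof.
have A1 : (1 <= @jump_const R m e)%R.
  rewrite /jump_const [leLHS](_ : _ = 1 `^ e)%R; last by rewrite powR1.
  apply: ler_powR_base => //; first exact: ltW.
  rewrite exprn_ege1//; have : (1 <= m%:R :> R)%R by rewrite ler1n.
  lra.
have [C C0 H] := sparse_bound r1 A1 theta01 D0.
exists C => // f Mf mf bf beta [b0 mb bD] t N.
pose L : int := (N%:Z + 4)%R.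
have sc (l : nat) : (N%:Z - l%:Z + 4 = L - l%:Z)%R by rewrite /L addrAC.
pose q := dyadic R L t; pose K := (2 * N)%N.
pose a (l : nat) := (mass phi tau eps (N%:Z - l%:Z) `^ e)%R.
pose G (l : nat) y := (lux_prod alpha f t (L - l%:Z) y `^ e)%R.
pose b (l : nat) y := (beta t (L - l%:Z)%R y `^ e)%R.
pose c k := (\sum_(k <= i < K.+1) a i)%R.
pose M y := (\big[Num.max/0]_(k < K.+1) (c k * G k y))%R.
have a0 l : (0 <= a l)%R by exact: powR_ge0.
have G0 l y : (0 <= G l y)%R by exact: powR_ge0.
have bb0 l y : (0 <= b l y)%R by exact: powR_ge0.
have c0 l : (0 <= c l)%R by exact: sumr_ge0.
have lp0 j y : (0 <= lux_prod alpha f t j y)%R by exact: lux_prod_ge0 bf _ _ _.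
have Gcell l x y : q l x = q l y -> G l x = G l y.
  by move=> xy; rewrite /G (lux_prod_cell alpha f xy).
have mM : measurable_fun setT M.
  apply: measurable_bigmax => k; apply: measurable_funM => //.
  by apply: (@measurable_cellwise _ _ q k) => x y /Gcell.
have mbb l : measurable_fun setT (b l).
  exact: measurableT_comp (measurable_powR _) (mb _ _).
have M0 y : (0 <= M y)%R.
  by rewrite /M; elim/big_ind: _ => // [u v u0 v0|k _]; rewrite ?le_max ?u0 ?mulr_ge0.
have MG l y : (l <= K)%N -> (c l * G l y <= M y)%R.
  move=> lK; exact: (@le_bigmax _ _ _ 0%R (fun k : 'I_K.+1 => (c k * G k y)%R)
    (Ordinal (lK : (l < K.+1)%N))).
have moment l x : \int[nu]_(y in cell q l x) (b l y `^ (2 * r))%:E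
    <= D%:E * nu (cell q l x).
  rewrite /q cell_dyadic; apply: le_trans (bD t (L - l%:Z)%R x).
  apply: le_integral_raw => y _; first by rewrite lee_fin powR_ge0.
  by rewrite lee_fin /b -powRrM mulrCA.
have fin k x : nu (cell q k x) < +oo by rewrite cell_dyadic; exact: nu_fin.
have sp F p x := lux_prod_jump_small alpha0 mf bf m0 small L t F p x e0.
have := H _ _ q nu K a G b M a0 G0 bb0 Gcell mbb fin moment sp mM MG.
have step : \int[nu]_y ((\sum_(l < K.+1) mass phi tau eps (N%:Z - l%:Z) *
      lux_prod alpha f t (N%:Z - l%:Z + 4) y * beta t (N%:Z - l%:Z + 4)%R y)
      `^ (e * r))%:E <= \int[nu]_y ((\sum_(l < K.+1) a l * G l y * b l y) `^ r)%:E.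
  apply: le_integral_raw => y _; first by rewrite lee_fin powR_ge0.
  rewrite lee_fin powRrM; apply: ler_powR_base; [exact: ltW|exact: powR_ge0|].
  apply: (le_trans (powR_sum_subadd _ e01 _)).
    by move=> l; rewrite !mulr_ge0// mass_ge0.
  apply: ler_sum => l _; rewrite sc /a /G /b.
  by rewrite powRM ?mulr_ge0 ?mass_ge0// powRM ?mass_ge0.
move=> /(le_trans step) /le_trans; apply.
rewrite lee_wpmul2l ?lee_fin//.
have mMr : measurable_fun setT (fun y => (M y `^ r)%:E).
  by apply/measurable_EFinP; exact: measurableT_comp (measurable_powR _) mM.
rewrite nuE//; last by move=> y; rewrite lee_fin powR_ge0.
apply: le_integral_raw => y _; first by rewrite mule_ge0 ?lee_fin ?powR_ge0.
rewrite lee_wpmul2r ?lee_fin//.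
rewrite /M; elim/big_ind: _ => [|u v hu hv|k _].
- by rewrite powR0 ?gt_eqF// poweR_ge0.
- by case: (leP u v).
have -> : ((c k * G k y) `^ r =
    (c k `^ e^-1 * lux_prod alpha f t (N%:Z - k%:Z + 4) y) `^ (e * r))%R.
  rewrite powRrM; apply: (congr1 (fun z => z `^ r)%R); rewrite sc /G.
  rewrite powRM; [|exact: powR_ge0|exact: lp0].
  by rewrite -powRrM mulVf ?gt_eqF// powRr1.
have MX := maximal_ge hphi alpha bf t N%:Z k K.+1 y e0.
rewrite -poweR_EFin; apply: gt0_ler_poweR.
- by rewrite mulr_ge0// ltW.
- by rewrite in_itv/= lee_fin leey andbT mulr_ge0// powR_ge0.
- rewrite in_itv/= leey andbT.
  by apply: le_trans MX; rewrite lee_fin mulr_ge0// powR_ge0.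
exact: MX.
Qed.

Let le_poweR_lim (u : nat -> R) (X : \bar R) (p : R) : (0 < p)%R ->
  (forall N, (0 <= u N)%R) -> {homo u : M N / (M <= N)%N >-> (M <= N)%R} ->
  0 <= X -> X <= limn (fun N => (u N)%:E) ->
  X `^ p <= limn (fun N => (u N `^ p)%:E).
Proof.
move=> p0 u0 ndu X0 XL.
have cu : cvgn (fun N => (u N)%:E).
  by apply: ereal_nondecreasing_is_cvgn => M N MN; rewrite lee_fin ndu.
have cp : cvgn (fun N => (u N `^ p)%:E).
  apply: ereal_nondecreasing_is_cvgn => M N MN; rewrite lee_fin.
  by apply: ler_powR_base; [exact: ltW|exact: u0|exact: ndu].
have up N : (u N `^ p)%:E <= limn (fun N => (u N `^ p)%:E).
  apply: lime_ge => //; near=> M; rewrite lee_fin.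
  apply: ler_powR_base; [exact: ltW|exact: u0|apply: ndu].
  by near: M; exists N.
move: up; set l := limn _ => up.
have l0 : 0 <= l by apply: le_trans (up 0%N); rewrite lee_fin powR_ge0.
case: l l0 up => [l l0 up| _ _|//]; last by rewrite leey.
have Xl : X <= (l `^ p^-1)%:E.
  apply: le_trans XL _; apply: lime_le => //; apply: nearW => N.
  rewrite lee_fin; apply: (@ler_powR_cancel _ p) => //; first exact: powR_ge0.
  by rewrite -powRrM mulVf ?gt_eqF// powRr1// -lee_fin.
case: X X0 XL Xl => [x x0 _ xl|//|//]; rewrite poweR_EFin lee_fin.
have -> : l = ((l `^ p^-1) `^ p)%R by rewrite -powRrM mulVf ?gt_eqF// powRr1.
by apply: ler_powR_base; [exact: ltW|rewrite -lee_fin|rewrite -lee_fin].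
Unshelve. all: by end_near. Qed.

Let p : R := (e * r)%R.
Let p0 : (0 < p)%R. Proof. exact: mulr_gt0. Qed.

(** The truncations of the discretized operator increase, so the bound for each grid,
    which does not depend on the truncation, passes to the limit by monotone
    convergence. *)
Lemma maximal_domination (C0 : R) : (0 <= C0)%R -> exists2 C : R, (0 < C)%R &
  forall (f : 'I_m -> 'rV[R]_n -> R) (Mf : R),
  (forall i, measurable_fun setT (f i)) -> (forall i x, (`|f i x| <= Mf)%R) ->
  forall beta, multiplier beta ->
  forall (X : 'rV[R]_n -> \bar R) N, measurable N -> mu N = 0 ->
  (forall x, 0 <= X x) ->
  (forall x, ~ N x -> X x <= limn (fun M => sumZ M (fun j => (C0 * mass phi tau eps j *
     \sum_t lux_prod alpha f t (j + 4) x * beta t (j + 4)%R x)%:E))) ->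
  \int[mu]_x (X x `^ (e * r) * (w x)%:E) <=
  C%:E * \int[mu]_x (maximal phi tau eps e alpha f x `^ (e * r) * (w x)%:E).
Proof.
move=> C00; have [C C1 H] := one_grid_bound.
pose T := {ffun 'I_n -> bool}.
pose C' := (C0 `^ p * (#|{: T}|%:R `^ p * (#|{: T}|%:R * C)))%R.
have C'0 : (0 <= C')%R by rewrite !mulr_ge0 ?powR_ge0.
exists (C' + 1)%R; first by rewrite ltr_wpDl.
move=> f Mf mf bf beta hbeta X N mN N0 X0 XL.
have [b0 mb _] := hbeta.
set RHS := \int[mu]_x (maximal _ _ _ _ _ _ _ `^ _ * _).
have RHS0 : 0 <= RHS by apply: integral_ge0 => x _; rewrite mule_ge0 ?poweR_ge0 ?lee_fin.
pose h t j x := (mass phi tau eps j * lux_prod alpha f t (j + 4) x * beta t (j + 4)%R x)%R.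
have h0 t j x : (0 <= h t j x)%R.
  by rewrite /h !mulr_ge0 ?mass_ge0// (lux_prod_ge0 _ bf).
have mh t j : measurable_fun setT (h t j).
  apply: measurable_funM => //; apply: measurable_funM => //.
  apply: (@measurable_cellwise _ _ (dyadic R (j + 4)%R t) 0) => x y xy.
  by have := lux_prod_cell alpha f xy; rewrite subr0.
pose u t M x := (\sum_(k < (2 * M).+1) h t (M%:Z - k%:Z) x)%R.
have u0 t M x : (0 <= u t M x)%R by exact: sumr_ge0.
have mu_ t M : measurable_fun setT (u t M) by exact: measurable_sum.
pose U M x := (C0 * \sum_t u t M x)%R.
have U0 M x : (0 <= U M x)%R by rewrite mulr_ge0// sumr_ge0.
have UE M x : (U M x)%:E = sumZ M (fun j => (C0 * mass phi tau eps j *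
     \sum_t lux_prod alpha f t (j + 4) x * beta t (j + 4)%R x)%:E).
  rewrite /sumZ sumEFin /U /u exchange_big mulr_sumr; congr EFin; apply: eq_bigr => k _.
  rewrite -mulrA; congr (_ * _)%R; rewrite mulr_sumr; apply: eq_bigr => t _.
  by rewrite /h mulrA.
have ndU x : {homo (fun M => U M x) : A B / (A <= B)%N >-> (A <= B)%R}.
  move=> A B AB; rewrite -lee_fin !UE; apply: sumZ_nd => // j.
  rewrite lee_fin !mulr_ge0 ?mass_ge0// sumr_ge0// => t _.
  by rewrite mulr_ge0// (lux_prod_ge0 _ bf).
pose g M x := (U M x `^ p)%:E.
have mg M : measurable_fun setT (g M).
  apply/measurable_EFinP; apply: (measurableT_comp (measurable_powR p)).
  by apply: measurable_funM => //; exact: measurable_sum.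
have g0 M x : 0 <= g M x by rewrite lee_fin powR_ge0.
have ndg x : {homo (fun M => g M x) : A B / (A <= B)%N >-> A <= B}.
  move=> A B AB; rewrite lee_fin; apply: ler_powR_base; [exact: ltW|exact: U0|exact: ndU].
have cg x : cvgn (fun M => g M x) by exact: ereal_nondecreasing_is_cvgn.
have gl0 x : 0 <= limn (fun M => g M x) by apply: lime_ge => //; exact: nearW.
have mlim : measurable_fun setT (fun x => limn (fun M => g M x)).
  by apply: (emeasurable_fun_cvg _ _ mg) => x _; exact: cg.
apply: (@le_trans _ _ (\int[mu]_x (limn (fun M => g M x) * (w x)%:E))).
  apply: (le_integral_off_null mN N0) => x _.
  - by rewrite mule_ge0 ?poweR_ge0 ?lee_fin.
  - by rewrite mule_ge0 ?lee_fin.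
  move=> nN; rewrite lee_wpmul2r ?lee_fin//.
  apply: (le_poweR_lim p0) => //.
  by under [X in limn X]eq_fun do rewrite UE; exact: XL.
rewrite -nuE// monotone_convergence//.
apply: lime_le.
  by apply: ereal_nondecreasing_is_cvgn => A B AB; apply: le_integral_raw => x _ //; exact: ndg.
apply: nearW => M.
apply: (@le_trans _ _ (C'%:E * RHS)); last first.
  by rewrite lee_wpmul2r// lee_fin lerDl.
have mup t : measurable_fun setT (fun x => (u t M x `^ p)%:E).
  by apply/measurable_EFinP; exact: (measurableT_comp (measurable_powR p)).
have up0 t x : 0 <= (u t M x `^ p)%:E by rewrite lee_fin powR_ge0.
apply: (@le_trans _ _ (\int[nu]_x ((C0 `^ p * #|{: T}|%:R `^ p)%:E *
    \sum_t (u t M x `^ p)%:E))).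
  apply: le_integral_raw => x _ //; rewrite sumEFin -EFinM lee_fin.
  rewrite /U powRM ?sumr_ge0// -mulrA ler_wpM2l ?powR_ge0//.
  exact: powR_sum_le.
rewrite ge0_integralZl//; last 3 first.
- exact: emeasurable_sum.
- by move=> x _; exact: sume_ge0.
- by rewrite lee_fin mulr_ge0 ?powR_ge0.
rewrite ge0_integral_sum//.
rewrite /C' mulrA (EFinM (_ * _)) -muleA lee_wpmul2l ?lee_fin ?mulr_ge0 ?powR_ge0//.
apply: (@le_trans _ _ (\sum_(t : T) (C%:E * RHS))).
  by apply: lee_sum => t _; exact: (H f Mf mf bf beta hbeta t M).
by rewrite sumr_const (EFinM _ C) -muleA mule_natl.
Qed.

End domination.

(** * Weights and functions of bounded mean oscillation *)

Section weight_data.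
Context (R : realType) (n : nat).
Local Notation mu := (lebesgue_rV R n).
Local Open Scope ereal_scope.

(** All that is used about the weight w: a Borel version of it, its measure nu, and the
    proportion theta of nu that half of a cube can carry. *)
Lemma muckenhoupt_infty_measure (w : 'rV[R]_n -> R) : muckenhoupt_infty w ->
  exists w' N (nu : {measure set 'rV[R]_n -> \bar R}) (theta : R),
  [/\ [/\ measurable N, mu N = 0 & forall x, ~ N x -> w x = w' x],
      forall x, (0 <= w' x)%R,
      (0 <= theta < 1)%R,
      (forall f, measurable_fun setT f -> (forall x, 0 <= f x) ->
        \int[nu]_x f x = \int[mu]_x (f x * (w' x)%:E)) &
      [/\ forall t j x, nu (dyadic_cube t j x) < +oo,
          forall E, measurable E -> mu E = 0 -> nu E = 0 &
          forall t j x E, measurable E -> E `<=` dyadic_cube t j x ->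
            mu E <= 2^-1%:E * mu (dyadic_cube t j x) ->
            nu E <= theta%:E * nu (dyadic_cube t j x)]].
Proof.
move=> [p0 p01 /muckenhoupt_borel[w' [N [mw Aw mN N0 ww']]]].
have [[w0 [_ iw]] _] := Aw.
have [theta theta01 H] := muckenhoupt_half p01 mw Aw.
have [nu [nuE nuI]] := weighted_measure mu w0 mw.
have mwE : measurable_fun setT (fun x => (w' x)%:E) by exact/measurable_EFinP.
exists w', N, nu, theta; split => //.
  by move=> f mf f0; exact: nuI.
have cubeE t j x : nu (dyadic_cube t j x) =
    \int[mu]_(y in cube (dyadic_corner t j x) (2 ^ j)%R) (w' y)%:E.
  by rewrite nuE ?integral_dyadic_cube//; exact: measurable_dyadic_cube.
split=> [t j x|E mE E0|t j x E mE EQ hE].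
- rewrite cubeE; apply: le_lt_trans (iw _ (@compact_cube R n (dyadic_corner t j x) (2 ^ j)%R)).
  by apply: le_integral_raw => y _; rewrite ?lee_fin// ler_norm.
- by rewrite nuE// null_set_integral//; exact: measurable_funTS.
- rewrite cubeE nuE//; apply: H => //; first exact: expz2_gt0.
    by apply: subset_trans EQ _; exact: dyadic_cube_sub.
  by move: hE; rewrite lebesgue_dyadic_cube lebesgue_cube ?expz2_gt0.
Qed.

End weight_data.

Section oscillation.
Context (R : realType) (n : nat).
Local Notation mu := (lebesgue_rV R n).
Implicit Types (t : {ffun 'I_n -> bool}) (j : int) (x : 'rV[R]_n) (b : 'rV[R]_n -> R).

Definition davg b t j x : R :=
  fine (\int[mu]_(y in dyadic_cube t j x) (b y)%:E) / fine (mu (dyadic_cube t j x)).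

Lemma davg_cube b t j x y : dyadic_cube t j x y -> davg b t j y = davg b t j x.
Proof. by move=> /eq_dyadic_cube h; rewrite /davg h. Qed.

Lemma measurable_davg b t j : measurable_fun setT (davg b t j).
Proof.
apply: (@measurable_cellwise _ _ (dyadic R j t) 0) => x y xy; apply: davg_cube.
by have : cell (dyadic R j t) 0 y x by []; rewrite cell_dyadic subr0.
Qed.

Local Open Scope ereal_scope.

(** Bounded mean oscillation as it is used below: on the half-open dyadic cubes only,
    with real averages. *)
Definition dyadic_bmo b (N : R) :=
  (forall t j x, \int[mu]_(y in dyadic_cube t j x) `|(b y)%:E| < +oo) /\
  (forall t j x, \int[mu]_(y in dyadic_cube t j x) `|b y - davg b t j x|%:E
     <= N%:E * mu (dyadic_cube t j x)).

Lemma bmo_borel b (N : R) : bmo b -> bmo_norm b <= N%:E ->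
  exists b' Z, [/\ measurable_fun setT b', dyadic_bmo b' N,
    measurable Z, mu Z = 0 & forall x, ~ Z x -> b x = b' x].
Proof.
move=> [[mb ib] _] bN.
have [b' mb' [Z [mZ Z0 bb' _]]] := borel_representative mb.
exists b', Z; split => //.
have fin t j x : \int[mu]_(y in dyadic_cube t j x) `|(b' y)%:E| < +oo.
  rewrite integral_dyadic_cube.
  apply: le_lt_trans (ib _ (@compact_cube R n (dyadic_corner t j x) (2 ^ j)%R)).
  by apply: (le_integral_off_null mZ Z0) => y _ //= nZ; rewrite bb'.
split => // t j x.
set Q := cube (dyadic_corner t j x) (2 ^ j)%R.
have v0 : (0 < (2 ^ j) ^+ n :> R)%R by rewrite exprn_gt0// expz2_gt0.
have muQ : mu Q = ((2 ^ j) ^+ n)%:E by exact/lebesgue_cube/expz2_gt0.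
have muD := @lebesgue_dyadic_cube R n t j x.
have avgE : mean Q (EFin \o b) = (davg b' t j x)%:E.
  rewrite /mean /davg muQ muD inver gt_eqF//= mulrC EFinM; apply: (congr1 (fun z => _ * z)).
  rewrite integral_dyadic_cube (eq_integral_off_null mZ Z0 (g := EFin \o b')); last first.
    by move=> y _ nZ; rewrite /= bb'.
  rewrite -integral_dyadic_cube fineK//.
  apply: integrable_fin_num; first exact: measurable_dyadic_cube.
  apply/integrableP; split; last exact: fin.
  by apply: measurable_funTS; exact/measurable_EFinP.
have : mean Q (fun y => `|(b y)%:E - mean Q (EFin \o b)|) <= N%:E.
  apply: le_trans bN; apply: ereal_sup_ubound.
  by exists (dyadic_corner t j x), (2 ^ j)%R; split => //; exact: expz2_gt0.
rewrite avgE /mean muQ inver gt_eqF// lee_pdivrMl// muleC => h.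
rewrite muD integral_dyadic_cube; apply: le_trans h.
by apply: (le_integral_off_null mZ Z0) => y _ //= nZ; rewrite bb'.
Qed.

(** In the denominator 2^n is the doubling constant of the dyadic grids, and the
    factor 2 comes from using halves of cubes as small sets. *)
Lemma john_nirenberg_dyadic (nu : {measure set 'rV[R]_n -> \bar R})
    (theta eta N : R) b t j x :
  (forall t j x, nu (dyadic_cube t j x) < +oo) ->
  (forall E, measurable E -> mu E = 0 -> nu E = 0) ->
  (forall t j x E, measurable E -> E `<=` dyadic_cube t j x ->
     mu E <= 2^-1%:E * mu (dyadic_cube t j x) ->
     nu E <= theta%:E * nu (dyadic_cube t j x)) ->
  (1 < eta)%R -> (theta * eta < 1)%R -> (0 < N)%R ->
  measurable_fun setT b -> dyadic_bmo b N ->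
  \int[nu]_(y in dyadic_cube t j x)
     (eta `^ (`|b y - davg b t j x| / (2 ^+ n * (2 * N))))%:E
  <= (eta / (1 - theta * eta))%:E * nu (dyadic_cube t j x).
Proof.
move=> nu_fin nu_mu small eta1 te N0 mb [ib osc].
have vol k y : mu (cell (dyadic R j t) k y) = ((2 ^ (j - k%:Z)) ^+ n)%:E.
  by rewrite cell_dyadic lebesgue_dyadic_cube.
have avgE k y : average (dyadic R j t) mu b k y = davg b t (j - k%:Z) y.
  by rewrite /average /davg cell_dyadic.
have := @john_nirenberg _ _ R (dyadic R j t) mu nu (2 ^+ n) 2^-1 theta N eta b
  (@dyadic_generating R n j t).
have -> : (2^-1^-1 = 2 :> R)%R by rewrite invrK.
move=> H; have := H _ _ _ _ _ _ _ _ eta1 te N0 mb _ _ 0%N x.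
rewrite avgE cell_dyadic subr0; apply => //.
- by move=> k y; rewrite [X in X < _]vol ltry.
- by move=> k y; rewrite [X in _ < X]vol lte_fin exprn_gt0// expz2_gt0.
- by move=> k y; rewrite cell_dyadic.
- by rewrite exprn_ege1// ler1n.
- move=> k y; rewrite [X in X <= _]vol [X in _ <= _ * X]vol -EFinM lee_fin -exprMn -expz2S.
  by rewrite (_ : (j - k.+1%:Z + 1 = j - k%:Z)%R)//; lia.
- by rewrite invr_gt0 ltr0n invf_le1 ?ler1n ?ltr0n.
- by move=> k y E mE; rewrite cell_dyadic; exact: small.
- by move=> k y; rewrite cell_dyadic.
- by move=> k y; rewrite cell_dyadic avgE; exact: osc.
Qed.

End oscillation.

(** * Multipliers from functions of bounded mean oscillation *)

Section oscillation_multipliers.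
Context (R : realType) (n : nat).
Local Notation mu := (lebesgue_rV R n).
Implicit Types (t : {ffun 'I_n -> bool}) (j : int) (x : 'rV[R]_n).

Let powR_affine_le (a k eta q : R) : 0 <= a -> 0 < k -> 1 < eta -> 0 < q ->
  exists2 C : R, 0 <= C & forall s, 0 <= s -> (a + s) `^ q <= C * eta `^ (s / k).
Proof.
move=> a0 k0 eta1 q0; have l0 : 0 < ln eta by rewrite ln_gt0.
pose c := ln eta / (k * q); have c0 : 0 < c by rewrite divr_gt0// mulr_gt0.
exists ((a + c^-1) `^ q); first exact: powR_ge0.
move=> s s0; have h : a + s <= (a + c^-1) * expR (c * s).
  have ic0 : 0 < c^-1 by rewrite invr_gt0.
  have ac0 : 0 <= a + c^-1 by rewrite addr_ge0// ltW.
  apply: le_trans (ler_wpM2l ac0 (expR_ge1Dx _)).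
  have -> : (a + c^-1) * (1 + c * s) = a + c^-1 + a * (c * s) + s.
    by field; rewrite gt_eqF.
  have := mulr_ge0 a0 (mulr_ge0 (ltW c0) s0).
  lra.
apply: (le_trans (ler_powR_base (ltW q0) _ h)); first exact: addr_ge0.
rewrite powRM ?expR_ge0 ?addr_ge0 ?invr_ge0 ?(ltW c0)//.
rewrite ler_wpM2l ?powR_ge0// le_eqVlt; apply/orP; left; apply/eqP.
rewrite /powR gt_eqF ?expR_gt0// expRK gt_eqF ?(lt_trans _ eta1)//.
by congr expR; rewrite /c; field; rewrite !gt_eqF.
Qed.

(** The constant C accounts for the deviation of b at the point of integration, the
    other term is the deviation at the point where the commutator is evaluated. *)
Definition osc_multiplier (m : nat) (C : R) (b : 'I_m -> 'rV[R]_n -> R) t j x : R :=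
  \sum_i (C + `|b i x - davg (b i) t j x|).

(** An exponential moment controls every power. *)
Lemma multiplier_osc (m : nat) (nu : {measure set 'rV[R]_n -> \bar R})
    (theta e r C N : R) :
  (forall t j x, nu (dyadic_cube t j x) < +oo)%E ->
  (forall E, measurable E -> mu E = 0 -> nu E = 0)%E ->
  (forall t j x E, measurable E -> E `<=` dyadic_cube t j x ->
     mu E <= 2^-1%:E * mu (dyadic_cube t j x) ->
     nu E <= theta%:E * nu (dyadic_cube t j x))%E ->
  0 <= theta < 1 -> 0 < e -> 0 < r -> 0 <= C -> 0 < N ->
  exists2 D : R, 0 <= D & forall b : 'I_m -> 'rV[R]_n -> R,
    (forall i, measurable_fun setT (b i)) -> (forall i, dyadic_bmo (b i) N) ->
    multiplier nu e r D (osc_multiplier C b).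
Proof.
move=> nu_fin nu_mu small /andP[t0 t1] e0 r0 C0 N0.
have q0 : 0 < 2 * (e * r) by rewrite !mulr_gt0.
set q := 2 * (e * r) in q0 *.
(* any number strictly between 1 and the inverse of theta would do *)
pose eta := 2 / (1 + theta); have t1p : 0 < 1 + theta by rewrite ltr_wpDr.
have eta1 : 1 < eta by rewrite ltr_pdivlMr// mul1r; lra.
have te : theta * eta < 1 by rewrite /eta mulrA ltr_pdivrMr// mul1r; lra.
pose k : R := 2 ^+ n * (2 * N); have k0 : 0 < k by rewrite !mulr_gt0// exprn_gt0.
have [A A0 hA] := powR_affine_le C0 k0 eta1 q0.
pose B := eta / (1 - theta * eta).
have B0 : 0 <= B by rewrite divr_ge0 ?subr_ge0 ?(ltW te)// ltW// (lt_trans _ eta1).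
have mR0 : 0 <= #|'I_m|%:R `^ q :> R by exact: powR_ge0.
exists (#|'I_m|%:R `^ q * (m%:R * (A * B))).
  exact: mulr_ge0 mR0 (mulr_ge0 (ler0n _ _) (mulr_ge0 A0 B0)).
move=> b mb hb.
have osc0 i t j x : 0 <= C + `|b i x - davg (b i) t j x| by rewrite addr_ge0.
have mosc i t j : measurable_fun setT (fun x => C + `|b i x - davg (b i) t j x|).
  apply: measurable_funD => //; apply: measurableT_comp => //.
  by apply: measurable_funB => //; exact: measurable_davg.
split=> [t j x|t j|t j x].
- exact: sumr_ge0.
- exact: measurable_sum.
have mQ := measurable_dyadic_cube t j x.
set Q := dyadic_cube t j x.
have mpow (i : 'I_m) : measurable_fun Q
    (fun y => ((C + `|b i y - davg (b i) t j y|) `^ q)%:E).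
  by apply/measurable_funTS/measurable_EFinP; exact: (measurableT_comp (measurable_powR q)).
have one (i : 'I_m) : (\int[nu]_(y in Q) ((C + `|b i y - davg (b i) t j y|) `^ q)%:E
    <= (A * B)%:E * nu Q)%E.
  apply: (@le_trans _ _ (\int[nu]_(y in Q)
      (A%:E * (eta `^ (`|b i y - davg (b i) t j x| / k))%:E))%E).
    apply: le_integral_raw => y Qy; first by rewrite lee_fin powR_ge0.
    by rewrite -EFinM lee_fin (davg_cube _ Qy); exact: hA.
  rewrite ge0_integralZl//; last 2 first.
  - apply/measurable_funTS/measurable_EFinP.
    rewrite (_ : (fun y => _) = (fun y => expR (`|b i y - davg (b i) t j x| / k * ln eta))).
      apply: (measurableT_comp (@measurable_expR R)); apply: measurable_funM => //.
      apply: measurable_funM => //; apply: measurableT_comp => //.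
      exact: measurable_funB.
    by apply/funext => y; rewrite /powR gt_eqF// (lt_trans _ eta1).
  - by move=> y _; rewrite lee_fin powR_ge0.
  rewrite EFinM -muleA lee_wpmul2l ?lee_fin//.
  exact: (john_nirenberg_dyadic t j x nu_fin nu_mu small eta1 te N0 (mb i) (hb i)).
apply: (@le_trans _ _ (\int[nu]_(y in Q) ((#|'I_m|%:R `^ q)%:E *
   \sum_i ((C + `|b i y - davg (b i) t j y|) `^ q)%:E))%E).
  apply: le_integral_raw => y _; first by rewrite lee_fin powR_ge0.
  by rewrite sumEFin -EFinM lee_fin; exact: powR_sum_le.
rewrite ge0_integralZl//; last 2 first.
- exact: emeasurable_sum.
- by move=> y _; apply: sume_ge0 => i _; rewrite lee_fin powR_ge0.
rewrite ge0_integral_sum//; last by move=> i y _; rewrite lee_fin powR_ge0.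
rewrite EFinM -muleA lee_wpmul2l ?lee_fin//.
apply: (@le_trans _ _ (\sum_(i < m) ((A * B)%:E * nu Q))%E); first exact: lee_sum.
by rewrite sumr_const card_ord (EFinM m%:R) -muleA mule_natl.
Qed.

(** John-Nirenberg for Lebesgue measure itself, where halves of cubes have proportion
    1/2 and the exponential base 3/2 is therefore allowed. *)
Lemma integral_osc_le_lux (N : R) : 0 < N -> exists2 C : R, 0 <= C &
  forall (f b : 'rV[R]_n -> R) (Mf : R), measurable_fun setT f ->
  (forall x, `|f x| <= Mf) -> measurable_fun setT b -> dyadic_bmo b N ->
  forall t j x, (\int[mu]_(y in dyadic_cube t j x)
     (`|b y - davg b t j x| * `|f y|)%:E <=
     (C * (dlux 1 f t j x * (2 ^ j) ^+ n))%:E)%E.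
Proof.
move=> N0; pose k : R := 2 ^+ n * (2 * N); have k0 : 0 < k by rewrite !mulr_gt0// exprn_gt0.
pose eta : R := 3 / 2; have eta1 : 1 < eta by rewrite /eta; lra.
have te : 2^-1 * eta < 1 by rewrite /eta; lra.
pose D := eta / (1 - 2^-1 * eta); have D0 : 0 <= D.
  apply: divr_ge0; first by rewrite /eta; lra.
  by rewrite subr_ge0 ltW.
have l0 : 0 < ln eta by rewrite ln_gt0.
exists (k * (2 / ln eta * (1 + D))).
  exact: mulr_ge0 (ltW k0) (mulr_ge0 (divr_ge0 (ler0n R 2) (ltW l0)) (addr_ge0 ler01 D0)).
move=> f b Mf mf bf mb hb t j x.
have mQ := measurable_dyadic_cube t j x.
have muQ := @lebesgue_dyadic_cube R n t j x.
set Q := dyadic_cube t j x in mQ muQ *.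
have v0 : 0 < (2 ^ j) ^+ n :> R by rewrite exprn_gt0// expz2_gt0.
pose s y := `|b y - davg b t j x| / k.
have ms : measurable_fun setT s.
  by apply: measurable_funM => //; apply: measurableT_comp => //; exact: measurable_funB.
have s0 y : 0 <= s y by rewrite divr_ge0// ltW.
have mu_fin : (forall t j x, mu (dyadic_cube t j x) < +oo)%E.
  by move=> t' j' x'; rewrite [X in (X < _)%E]lebesgue_dyadic_cube ltry.
have hs : (\int[mu]_(y in Q) (eta `^ s y)%:E <= D%:E * mu Q)%E.
  exact: (john_nirenberg_dyadic (nu := mu) t j x mu_fin _ _ eta1 te N0 mb hb).
have := exp_LlogL_duality mf bf ms s0 mQ v0 muQ eta1 D0 hs.
have kE : (0 <= k%:E)%E by rewrite lee_fin ltW.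
move=> /(lee_wpmul2l kE); rewrite -EFinM => h.
rewrite -mulrA; apply: (le_trans _ h).
rewrite -ge0_integralZl//; last 2 first.
- apply/measurable_funTS/measurable_EFinP; apply: measurable_funM => //.
  exact: measurableT_comp.
- by move=> y _; rewrite lee_fin mulr_ge0.
apply: le_integral_raw => y _; first by rewrite lee_fin mulr_ge0.
rewrite -EFinM lee_fin /s mulrA [k * _]mulrC divfK// gt_eqF//.
Qed.

End oscillation_multipliers.

(** * The weighted bounds *)

Section assembly.
Context (R : realType) (m n : nat) (phi : 'M[R]_(m, n) -> R) (tau eps : R).
Hypothesis n0 : (0 < n)%N.
Hypothesis m0 : (0 < m)%N.
Hypothesis hphi : condition_D phi tau eps.
Local Notation mum := (lebesgue_mx R m n).
Local Notation mu := (lebesgue_rV R n).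
Local Open Scope ereal_scope.

Lemma bounded_family_borel (f : 'I_m -> 'rV[R]_n -> R) :
  (forall i, bounded_compactly_supported (f i)) ->
  exists (f' : 'I_m -> 'rV[R]_n -> R) (Z : 'I_m -> set 'rV[R]_n) (Mf c : R),
  [/\ forall i, measurable_fun setT (f' i),
      (0 <= Mf)%R /\ (forall i y, (`|f' i y| <= Mf)%R),
      (forall i y, (f' i y != 0)%R -> forall l, (`|y 0%R l| <= c)%R),
      (forall i, measurable (Z i)) /\ (forall i, mu (Z i) = 0) &
      forall i y, ~ Z i y -> f i y = f' i y].
Proof.
move=> hf.
have H i : exists P : ('rV[R]_n -> R) * set 'rV[R]_n * (R * R),
    [/\ measurable_fun setT P.1.1,
        (0 <= P.2.1)%R /\ (forall y, (`|P.1.1 y| <= P.2.1)%R),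
        (0 <= P.2.2)%R /\
          (forall y, (P.1.1 y != 0)%R -> forall l, (`|y 0%R l| <= P.2.2)%R),
        measurable P.1.2 /\ mu P.1.2 = 0 &
        forall y, ~ P.1.2 y -> f i y = P.1.1 y].
  have [mf [M hM] _] := hf i.
  have [c [c0 hc]] := compactly_supported_bounded (hf i).
  have [f' mf' [Z [mZ Z0 ff' f'0]]] := borel_representative mf.
  exists (f', Z, (M, c)); split => //=.
    have M0 : (0 <= M)%R by exact: le_trans (hM 0%R).
    split => // y; have [Zy|nZy] := pselect (Z y); first by rewrite f'0// normr0.
    by rewrite -ff'.
  split => // y; have [Zy|nZy] := pselect (Z y); first by rewrite f'0// eqxx.
  by rewrite -ff'//; exact: hc.
have /choice[P hP] := H.
have le_sum (F : 'I_m -> R) i : (forall k, (0 <= F k)%R) -> (F i <= \sum_k F k)%R.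
  by move=> F0; rewrite (bigD1 i)//= lerDl sumr_ge0.
exists (fun i => (P i).1.1), (fun i => (P i).1.2), (\sum_i (P i).2.1)%R, (\sum_i (P i).2.2)%R.
split.
- by move=> i; have [] := hP i.
- split; first by apply: sumr_ge0 => i _; have [_ []] := hP i.
  move=> i y; have [_ [_ /(_ y) h] _ _ _] := hP i; apply: le_trans h _.
  by apply: (le_sum (fun k => (P k).2.1)) => k; have [_ []] := hP k.
- move=> i y yn l; have [_ _ [_ /(_ y yn l) h] _ _] := hP i; apply: le_trans h _.
  by apply: (le_sum (fun k => (P k).2.2)) => k; have [_ _ []] := hP k.
- by split => i; have [_ _ _ []] := hP i.
- by move=> i y; have [_ _ _ _] := hP i; exact.
Qed.

Lemma lim_sumZ_le (h g : int -> \bar R) : (forall j, 0 <= h j) ->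
  (forall j, h j <= g j) -> limn (fun N => sumZ N h) <= limn (fun N => sumZ N g).
Proof.
move=> h0 hg; have g0 j : 0 <= g j by exact: le_trans (hg j).
apply: lee_lim.
- exact/ereal_nondecreasing_is_cvgn/sumZ_nd.
- exact/ereal_nondecreasing_is_cvgn/sumZ_nd.
- by apply: nearW => N; apply: lee_sum.
Qed.

Lemma lim_sumZ_sum (h : 'I_m -> int -> \bar R) : (forall i j, 0 <= h i j) ->
  \sum_i limn (fun N => sumZ N (h i)) = limn (fun N => sumZ N (fun j => \sum_i h i j)).
Proof.
move=> h0; rewrite -lim_nnesum//; last 2 first.
- by move=> i _; apply: nearW => N; exact: sume_ge0.
- by move=> i _; exact/ereal_nondecreasing_is_cvgn/sumZ_nd.
by under [in RHS]eq_fun do rewrite /sumZ exchange_big.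
exact: (fun=> 0).
Qed.

(** The volumes of the cubes, of side 16 2^j, compensate the decay 2^(-jnm) of the
    kernel on the shell of radius 2^j. *)
Lemma discretize (C : R) (s : {ffun 'I_n -> bool} -> 'I_m -> R) j
    (F : 'I_m -> 'rV[R]_n -> R) (lux_ : {ffun 'I_n -> bool} -> 'I_m -> R) x :
  (0 < C)%R -> (forall i y, (0 <= F i y)%R) ->
  (forall t i, \int[mu]_(y in dyadic_cube t (j + 4) x) (F i y)%:E <=
     (s t i * (lux_ t i * (2 ^ (j + 4)%Z) ^+ n))%:E) ->
  (C / (2 ^ j) ^+ (n * m) * mass phi tau eps j)%:E *
     \sum_t \prod_i \int[mu]_(y in dyadic_cube t (j + 4) x) (F i y)%:E <=
  (C * 16 ^+ (n * m) * mass phi tau eps j *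
     \sum_t (\prod_i lux_ t i) * (\prod_i s t i))%:E.
Proof.
move=> C0 F0 hF.
have v0 : (0 < (2 ^ j) ^+ (n * m) :> R)%R by rewrite exprn_gt0// expz2_gt0.
have -> : (C * 16 ^+ (n * m) * mass phi tau eps j *
     \sum_t (\prod_i lux_ t i) * (\prod_i s t i) =
  (C / (2 ^ j) ^+ (n * m) * mass phi tau eps j) * (\sum_t (\prod_i lux_ t i) *
     (\prod_i s t i) * ((2 ^ (j + 4)%Z) ^+ n) ^+ m))%R.
  rewrite -mulr_suml expz2_add4 -exprM exprMn; field.
  by rewrite gt_eqF.
rewrite [X in _ <= X]EFinM lee_wpmul2l//.
  by rewrite lee_fin mulr_ge0 ?mass_ge0// divr_ge0// ltW.
rewrite -sumEFin; apply: lee_sum => t _.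
have -> : ((\prod_i lux_ t i) * (\prod_i s t i) * ((2 ^ (j + 4)%Z) ^+ n) ^+ m =
    \prod_i (s t i * (lux_ t i * (2 ^ (j + 4)%Z) ^+ n)))%R.
  by rewrite !big_split/= prodr_const card_ord; ring.
rewrite -prodEFin; apply: lee_prod => i //.
by apply: integral_ge0 => y _; rewrite lee_fin.
Qed.

Variable w : 'rV[R]_n -> R.
Hypothesis hw : muckenhoupt_infty w.
Variables e r : R.
Hypothesis e01 : (0 < e <= 1)%R.
Hypothesis r1 : (1 <= r)%R.

Let weight_off_null (w' : 'rV[R]_n -> R) Z (Y : 'rV[R]_n -> \bar R) :
  measurable Z -> mu Z = 0 -> (forall x, ~ Z x -> w x = w' x) ->
  \int[mu]_x (Y x * (w x)%:E) = \int[mu]_x (Y x * (w' x)%:E).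
Proof.
by move=> mZ Z0 ww'; apply: (eq_integral_off_null mZ Z0) => x _ nZ; rewrite ww'.
Qed.

Lemma potential_bound : exists2 C : R, (0 < C)%R &
  forall f : 'I_m -> 'rV[R]_n -> R, (forall i, bounded_compactly_supported (f i)) ->
  \int[mu]_x (`|potential phi f x| `^ (e * r) * (w x)%:E) <=
  C%:E * \int[mu]_x (maximal phi tau eps e 0 f x `^ (e * r) * (w x)%:E).
Proof.
have [w' [Zw [nu [theta [[mZw Zw0 ww'] w'0 theta01 nuI [nu_fin nu_mu small]]]]]] :=
  muckenhoupt_infty_measure hw.
have [C C0 hC] := potential_le_cubes n0 m0 hphi.
have C'0 : (0 <= C * 16 ^+ (n * m))%R by rewrite mulr_ge0 ?(ltW C0)// exprn_ge0.
have [B B0 hB] := maximal_domination hphi m0 (lexx 0%R : (0 <= 0 :> R)%R) w'0 theta01 nuI nu_fin small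
  e01 r1 (ler01 : (0 <= 1 :> R)%R) C'0.
exists B => // f /bounded_family_borel[f' [Z [Mf [c [mf [Mf0 bf] sf [mZ Z0] ff']]]]].
rewrite !(weight_off_null _ mZw Zw0 ww').
under eq_integral do rewrite (eq_potential_off_null phi _ mZ Z0 ff').
under [in leRHS]eq_integral do rewrite (@eq_maximal_off_null _ _ _ _ _ _ _ _ _ _ _ _ mZ Z0 ff').
apply: (hB f' Mf mf bf (fun _ _ _ => 1%R) _ (fun x => `|potential phi f' x|) set0) => //.
  split=> // t j x; rewrite mul1e powR1 integral_cst ?mul1e//.
  exact: measurable_dyadic_cube.
move=> x _; apply: le_trans (abse_potential_le hphi f' x) _.
have maf i : measurable_fun setT (fun y => `|f' i y|%R) by exact: measurableT_comp.
apply: (le_trans (hC x (fun i y => `|f' i y|%R) maf _)) => //.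
apply: lim_sumZ_le => j.
  apply: mule_ge0.
    by rewrite lee_fin mulr_ge0 ?mass_ge0// divr_ge0 ?(ltW C0)// exprn_ge0// ltW// expz2_gt0.
  apply: sume_ge0 => t _; apply: prode_ge0 => i _; apply: integral_ge0 => y _.
  by rewrite lee_fin.
have hl t i : \int[mu]_(y in dyadic_cube t (j + 4) x) (`|f' i y|%R)%:E <=
    (1 * (dlux 0 (f' i) t (j + 4) x * (2 ^ (j + 4)%Z) ^+ n))%:E.
  rewrite mul1r; apply: (integral_le_lux (lexx 0%R) (mf i) (bf i)).
  - exact: measurable_dyadic_cube.
  - by rewrite exprn_gt0// expz2_gt0.
  - exact: lebesgue_dyadic_cube.
apply: (le_trans (discretize (s := fun _ _ => 1%R) C0 (fun i y => normr_ge0 (f' i y)) hl)).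
rewrite lee_fin le_eqVlt; apply/orP; left; apply/eqP.
congr (_ * _)%R; apply: eq_bigr => t _; congr (_ * _)%R; exact: big1_eq.
Qed.

(** Each summand of the commutator has one factor in which b occurs. Over a cube its
    mean is at most (K + |b x - average|) times the L log L norm: K comes from the
    duality, the other term from b x - average being constant in y. *)
Lemma commutator_bound (N : R) : exists2 C : R, (0 < C)%R &
  forall b : 'I_m -> 'rV[R]_n -> R,
  (forall j, bmo (b j)) -> bmo_vector_norm b = N%:E ->
  forall f : 'I_m -> 'rV[R]_n -> R, (forall i, bounded_compactly_supported (f i)) ->
  \int[mu]_x (`|commutator phi b f x| `^ (e * r) * (w x)%:E) <=
  C%:E * \int[mu]_x (maximal phi tau eps e 1 f x `^ (e * r) * (w x)%:E).
Proof.
pose N' := (`|N| + 1)%R; have N'0 : (0 < N')%R by rewrite ltr_wpDl.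
have [w' [Zw [nu [theta [[mZw Zw0 ww'] w'0 theta01 nuI [nu_fin nu_mu small]]]]]] :=
  muckenhoupt_infty_measure hw.
have [C C0 hC] := potential_le_cubes n0 m0 hphi.
have C'0 : (0 <= C * 16 ^+ (n * m))%R by rewrite mulr_ge0 ?(ltW C0)// exprn_ge0.
have [K K0 hK] := @integral_osc_le_lux R n N' N'0.
have e0 : (0 < e)%R by case/andP: e01.
have [D D0 hD] := @multiplier_osc R n m nu theta e r K N' nu_fin nu_mu small theta01
  e0 (lt_le_trans ltr01 r1) K0 N'0.
have [B B0 hB] := maximal_domination hphi m0 (ler01 : (0 <= 1 :> R)%R) w'0 theta01 nuI
  nu_fin small e01 r1 D0 C'0.
exists B => // b hb bN f /bounded_family_borel[f' [Z [Mf [c [mf [Mf0 bf] sf [mZ Z0] ff']]]]].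
have Hb j : exists P : ('rV[R]_n -> R) * set 'rV[R]_n,
    [/\ measurable_fun setT P.1, dyadic_bmo P.1 N', measurable P.2, mu P.2 = 0 &
        forall x, ~ P.2 x -> b j x = P.1 x].
  have bj : bmo_norm (b j) <= N'%:E.
    apply: (@le_trans _ _ N%:E).
      by rewrite -bN; apply: ereal_sup_ubound; exists j.
    by rewrite lee_fin /N' (le_trans (ler_norm N))// lerDl.
  by have [b' [Y [? ? ? ? ?]]] := bmo_borel (hb j) bj; exists (b', Y).
have /choice[P hP] := Hb.
pose b' j := (P j).1; pose Y j := (P j).2.
have mb j : measurable_fun setT (b' j) by have [] := hP j.
have bb j : dyadic_bmo (b' j) N' by have [] := hP j.
have mY j : measurable (Y j) by have [] := hP j.
have Y0 j : mu (Y j) = 0 by have [] := hP j.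
have bb' j x : ~ Y j x -> b j x = b' j x by have [_ _ _ _] := hP j; exact.
pose V := \bigcup_(k : nat) (if insub k is Some j then Y j else set0).
have mYk (k : nat) : measurable (if insub k is Some j then Y j else set0).
  by case: insubP => // i _ _; exact: mY.
have mV : measurable V by exact: bigcupT_measurable.
have V0 : mu V = 0.
  by apply: null_bigcup => // k; case: insubP => // i _ _; exact: Y0.
have nV j x : ~ V x -> ~ Y j x.
  by apply: contra_not => Yx; exists (val j) => //; rewrite valK.
rewrite !(weight_off_null _ mZw Zw0 ww').
under [in leRHS]eq_integral do rewrite (@eq_maximal_off_null _ _ _ _ _ _ _ _ _ _ _ _ mZ Z0 ff').
have cE x : ~ V x -> commutator phi b f x = commutator phi b' f' x.
  move=> nVx; apply: eq_bigr => j _; rewrite /commutator_at.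
  rewrite (bb' _ _ (nV j x nVx)) (eq_potential_off_null phi _ mZ Z0 ff').
  congr (_ - _); apply: (@eq_potential_off_null _ _ _ _ _ _ (fun i => Z i `|` Y i)).
  - by move=> i; exact: measurableU.
  - by move=> i; exact: etrans (measureU0 (mZ i) (mY i) (Y0 i)) (Z0 i).
  move=> i y /not_orP[nZ nY]; case: eqP => [ij|_]; last exact: ff'.
  by rewrite /= -ij ff'// bb'.
apply: (hB f' Mf mf bf (osc_multiplier K b') (hD b' mb bb)
  (fun x => `|commutator phi b f x|) V) => // x nVx.
rewrite cE//; apply: (le_trans (lee_abs_sum _ _ _)).
pose h jj j := (C * 16 ^+ (n * m) * mass phi tau eps j *
  \sum_t lux_prod 1 f' t (j + 4) x *
    (K + `|b' jj x - davg (b' jj) t (j + 4) x|))%:E.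
have lux0 i t j : (0 <= dlux 1 (f' i) t j x)%R by exact: dlux_ge0 (bf i) _ _ _.
have h0 jj j : 0 <= h jj j.
  rewrite lee_fin mulr_ge0 ?(mulr_ge0 C'0) ?mass_ge0// sumr_ge0// => t _.
  by rewrite mulr_ge0 ?addr_ge0// (lux_prod_ge0 _ bf).
suff one jj : `|commutator_at phi jj b' f' x| <= limn (fun M => sumZ M (h jj)).
  apply: (@le_trans _ _ (\sum_jj limn (fun M => sumZ M (h jj)))); first exact: lee_sum.
  rewrite lim_sumZ_sum//; apply: lim_sumZ_le => j; first exact: sume_ge0.
  rewrite /h sumEFin lee_fin -mulr_sumr exchange_big/= ler_wpM2l//.
    by rewrite mulr_ge0// mass_ge0.
  by apply: ler_sum => t _; rewrite /osc_multiplier mulr_sumr.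
apply: (le_trans (commutator_at_le hphi mf bf sf Mf0 x (mb jj))).
pose F i y := (if i == jj then `|b' jj x - b' jj y| * `|f' i y| else `|f' i y|)%R.
have mF i : measurable_fun setT (F i).
  have mfi : measurable_fun setT (fun y => `|f' i y|%R) by exact: measurableT_comp.
  rewrite /F; case: eqP => // _; apply: measurable_funM => //.
  by apply: measurableT_comp => //; exact: measurable_funB.
have F0 i y : (0 <= F i y)%R by rewrite /F; case: ifP.
apply: (le_trans (hC x F mF F0)).
apply: lim_sumZ_le => j.
  apply: mule_ge0.
    by rewrite lee_fin mulr_ge0 ?mass_ge0// divr_ge0 ?(ltW C0)// exprn_ge0// ltW// expz2_gt0.
  apply: sume_ge0 => t _; apply: prode_ge0 => i _; apply: integral_ge0 => y _.
  by rewrite lee_fin.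
pose s t (i : 'I_m) : R :=
  if i == jj then (K + `|b' jj x - davg (b' jj) t (j + 4) x|)%R else 1%R.
have hl t i : \int[mu]_(y in dyadic_cube t (j + 4) x) (F i y)%:E <=
    (s t i * (dlux 1 (f' i) t (j + 4) x * (2 ^ (j + 4)%Z) ^+ n))%:E.
  have mQ := measurable_dyadic_cube t (j + 4) x.
  have v0 : (0 < (2 ^ (j + 4)%Z) ^+ n :> R)%R by rewrite exprn_gt0// expz2_gt0.
  have L := integral_le_lux ler01 (mf i) (bf i) mQ v0 (lebesgue_dyadic_cube t (j + 4) x).
  rewrite /F /s; case: eqP => [ij|_]; last by rewrite mul1r.
  set A := davg _ _ _ _.
  have mabs : measurable_fun (dyadic_cube t (j + 4) x) (fun y => (`|f' i y|%R)%:E).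
    by apply/measurable_funTS/measurable_EFinP; exact: measurableT_comp.
  have mosc : measurable_fun (dyadic_cube t (j + 4) x)
      (fun y => (`|b' jj y - A| * `|f' i y|)%:E).
    apply/measurable_funTS/measurable_EFinP; apply: measurable_funM => //.
      by apply: measurableT_comp => //; exact: measurable_funB.
    exact: measurableT_comp.
  apply: (@le_trans _ _ (\int[mu]_(y in dyadic_cube t (j + 4) x)
      ((`|b' jj y - A| * `|f' i y|)%:E + (`|b' jj x - A|)%:E * (`|f' i y|)%:E))).
    apply: le_integral_raw => y _; first by rewrite lee_fin mulr_ge0.
    rewrite -EFinM -EFinD lee_fin -mulrDl ler_wpM2r//.
    by rewrite [leRHS]addrC [X in (_ <= _ + X)%R]distrC ler_distD.
  rewrite ge0_integralD//; last first.
    by apply: measurable_funeM.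
  rewrite ge0_integralZl// mulrDl EFinD; apply: leeD.
    exact: (hK (f' i) (b' jj) Mf (mf i) (bf i) (mb jj) (bb jj)).
  by rewrite (EFinM `|_|) lee_wpmul2l ?lee_fin.
apply: (le_trans (discretize C0 F0 hl)).
rewrite lee_fin le_eqVlt; apply/orP; left; apply/eqP.
congr (_ * _)%R; apply: eq_bigr => t _; congr (_ * _)%R.
by rewrite (bigD1 jj)//= big1 ?mulr1 /s ?eqxx// => i /negbTE ->.
Qed.

End assembly.

Theorem theorem3p10 (R : realType) (n m : nat) (hn : (1 <= n)%N)
    (hm : (1 <= m)%N) (phi : 'M[R]_(m, n) -> R) (tau eps : R)
    (hphi : condition_D phi tau eps)
    (w : 'rV[R]_n -> R) (hw : muckenhoupt_infty w) :
  [/\ forall p : R, 0 < p <= 1 ->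
        exists2 C : R, 0 < C &
        forall f : 'I_m -> 'rV[R]_n -> R,
          (forall i, bounded_compactly_supported (f i)) ->
          (\int[lebesgue_rV R n]_x (`|potential phi f x| `^ p * (w x)%:E) <=
           C%:E * \int[lebesgue_rV R n]_x
             ((maximal phi tau eps p 0 f x) `^ p * (w x)%:E))%E,
      forall p : R, 0 < p <= 1 -> reverse_holder p^-1 w ->
        forall N : R, exists2 C : R, 0 < C &
        forall b : 'I_m -> 'rV[R]_n -> R,
          (forall j, bmo (b j)) -> bmo_vector_norm b = N%:E ->
        forall f : 'I_m -> 'rV[R]_n -> R,
          (forall i, bounded_compactly_supported (f i)) ->
          (\int[lebesgue_rV R n]_x (`|commutator phi b f x| `^ p * (w x)%:E) <=
           C%:E * \int[lebesgue_rV R n]_x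
             ((maximal phi tau eps p 1 f x) `^ p * (w x)%:E))%E
    & forall p : R, 1 < p ->
        (exists2 C : R, 0 < C &
         forall f : 'I_m -> 'rV[R]_n -> R,
           (forall i, bounded_compactly_supported (f i)) ->
           (\int[lebesgue_rV R n]_x (`|potential phi f x| `^ p * (w x)%:E) <=
            C%:E * \int[lebesgue_rV R n]_x
              ((maximal phi tau eps 1 0 f x) `^ p * (w x)%:E))%E)
        /\
        (forall N : R, exists2 C : R, 0 < C &
         forall b : 'I_m -> 'rV[R]_n -> R,
           (forall j, bmo (b j)) -> bmo_vector_norm b = N%:E ->
         forall f : 'I_m -> 'rV[R]_n -> R,
           (forall i, bounded_compactly_supported (f i)) ->
           (\int[lebesgue_rV R n]_x (`|commutator phi b f x| `^ p * (w x)%:E) <=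
            C%:E * \int[lebesgue_rV R n]_x
              ((maximal phi tau eps 1 1 f x) `^ p * (w x)%:E))%E)].
Proof.
have i01 : (0 < 1 :> R) && (1 <= 1 :> R) by rewrite ltr01 lexx.
split=> [p p01|p p01 _ N|p /ltW p1].
- by have := potential_bound hn hm hphi hw p01 (lexx 1); rewrite mulr1.
- by have := commutator_bound hn hm hphi hw p01 (lexx 1) N; rewrite mulr1.
split=> [|N].
- by have := potential_bound hn hm hphi hw i01 p1; rewrite mul1r.
- by have := commutator_bound hn hm hphi hw i01 p1 N; rewrite mul1r.
Qed.
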